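(* Let $\mathcal L$ be a centerless Lie torus of type $(\Delta,\Lambda)$ with $\Delta$ reduced, let $D=\bigoplus_{\mu\in\Gamma}D^\mu$ be a permissible subalgebra of $\mathrm{SCDer}(\mathcal L)$, and let $E:=E(\mathcal L,D,\kappa=0)$. Let $\tau$ be a Chevalley involution for $\mathcal L$. If $$(1)\qquad \chi^{-\mu}D^\mu=\chi^{\mu}D^{-\mu}\qquad(\mu\in\Gamma),$$ then $\tau$ extends to a Chevalley involution $\bar\tau$ for $E$ such that $\bar\tau(\chi^\mu\partial_\theta)=-\chi^{-\mu}\partial_\theta$ for any $\mu$ and $\theta$ (with $\chi^\mu\partial_\theta\in D^\mu$). Suppose further that $$(2)\qquad \chi^{-\mu}D^\mu=\mathrm{span}_{\mathbb C}\{\partial_\theta\in\chi^{-\mu}D^\mu\mid\theta\in\mathrm{Hom}_{\mathbb Z}(\Lambda,\mathbb Z)\}\qquad(\mu\in\Gamma).$$ Then any integral structure $\mathcal B_c$ for $(E_c,\bar\tau_c)$, where $\bar\tau_c:=\bar\tau|_{E_c}$, satisfying $$(3)\qquad \chi^\mu(\mathcal B_c\cap\mathcal L^\lambda_{\dot\alpha})\subseteq\mathrm{span}_{\mathbb Z}\mathcal B_c\qquad(\mu\in\Gamma,\ \lambda\in\Lambda,\ \dot\alpha\in\Delta^\times)$$ extends to (i.e. is contained in) an integral structure for $(E,\bar\tau)$.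
   Context: All vector spaces are over $\mathbb C$. Lie tori. $\Lambda$ is a free abelian group of finite rank and $\Delta$ an irreducible finite root system (containing $0$; $\Delta^\times=\Delta\setminus\{0\}$) with root lattice $Q$. A Lie torus of type $(\Delta,\Lambda)$ is a $(Q\times\Lambda)$-graded Lie algebra $\mathcal L=\bigoplus_{(\alpha,\lambda)}\mathcal L^\lambda_\alpha$ with $\mathcal L^\lambda_\alpha=0$ for $\alpha\notin\Delta$ such that: for $\alpha\in\Delta^\times$, $\dim\mathcal L^\lambda_\alpha\le1$, and $\dim\mathcal L^0_\alpha=1$ if $\frac12\alpha\notin\Delta$; if $\dim\mathcal L^\lambda_\alpha=1$ ($\alpha\in\Delta^\times$) there are $0\ne e^{\pm\lambda}_{\pm\alpha}\in\mathcal L^{\pm\lambda}_{\pm\alpha}$ with $[[e^\lambda_\alpha,e^{-\lambda}_{-\alpha}],x]=\langle\beta,\alpha^\vee\rangle x$ for all $\beta\in\Delta$, $\mu\in\Lambda$, $x\in\mathcal L^\mu_\beta$; $\mathcal L^\lambda_0=\sum_{\alpha\in\Delta^\times,\mu\in\Lambda}[\mathcal L^\mu_\alpha,\mathcal L^{\lambda-\mu}_{-\alpha}]$; and $\Lambda=\mathrm{span}_{\mathbb Z}\{\lambda\mid\mathcal L^\lambda_\alpha\neq0\text{ for some }\alpha\in\Delta\}$. It is centerless if its center is $0$. $\mathcal L^\lambda=\sum_\alpha\mathcal L^\lambda_\alpha$. Fix a non-degenerate invariant $\Lambda$-graded symmetric bilinear form $(\cdot,\cdot)_{\mathcal L}$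 on $\mathcal L$ (one exists). Derivations. The centroid of $\mathcal L$ is $\mathcal C(\mathcal L)=\bigoplus_{\mu\in\Gamma}\mathbb C\chi^\mu$, $\Gamma$ a subgroup of $\Lambda$, $\chi^\mu$ an endomorphism of degree $\mu$, $\chi^\mu\chi^\nu=\chi^{\mu+\nu}$. For $\theta\in\mathrm{Hom}_{\mathbb Z}(\Lambda,\mathbb C)$, $\partial_\theta(x)=\theta(\lambda)x$ for $x\in\mathcal L^\lambda$; $\mathcal D=\{\partial_\theta\}$. $\mathrm{SCDer}(\mathcal L)=\bigoplus_{\mu\in\Gamma}\mathrm{SCDer}(\mathcal L)^\mu$, $\mathrm{SCDer}(\mathcal L)^\mu=\chi^\mu\{\partial_\theta\in\mathcal D\mid\theta(\mu)=0\}$, with bracket $[\chi^\mu\partial_\theta,\chi^\nu\partial_\psi]=\chi^{\mu+\nu}(\theta(\nu)\partial_\psi-\psi(\mu)\partial_\theta)$. A $\Gamma$-graded subalgebra $D=\bigoplus_\mu D^\mu$ of $\mathrm{SCDer}(\mathcal L)$ is permissible if the map $\mathrm{ev}:\Lambda\to(D^0)^\star$, $\mathrm{ev}(\lambda)(\partial_\theta)=\theta(\lambda)$, is injective with discrete image and there is an affine cocycle $\kappa:D\times D\to D^{gr\star}$; here the cocycle is $\kappa=0$, which is always an affine cocycle. The graded dual is $D^{gr\star}=\sum_\mu(D^\mu)^\star$, with $(D^{gr\star})^\mu=(D^{-\mu})^\star$, and $D$-action $(d\cdot\varphi)(d')=\varphi([d',d])$. The algebra $E(\mathcal L,D,0)=\mathcal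 L\oplus D^{gr\star}\oplus D$ has bracket $[x_1+c_1+d_1,x_2+c_2+d_2]=([x_1,x_2]_{\mathcal L}+d_1(x_2)-d_2(x_1))+(\sigma_D(x_1,x_2)+d_1\cdot c_2-d_2\cdot c_1)+[d_1,d_2]$, where $\sigma_D(x,y)(d)=(d(x),y)_{\mathcal L}$, and form $(x_1+c_1+d_1,x_2+c_2+d_2)=(x_1,x_2)_{\mathcal L}+c_1(d_2)+c_2(d_1)$. With $\mathcal H=\mathcal L^0_0\oplus(D^0)^\star\oplus D^0$ it is an extended affine Lie algebra, with root space decomposition $E=\sum_{\alpha\in R}E_\alpha$ with respect to $\mathcal H$, where $R=\{\alpha\in\mathcal H^\star\mid E_\alpha\neq0\}$. For $\alpha\in R$, $t_\alpha\in\mathcal H$ represents $\alpha$ via the form, $(\alpha,\beta)=(t_\alpha,t_\beta)$, $R^0=\{\alpha\in R\mid(\alpha,\alpha)=0\}$, $R^\times=R\setminus R^0$, $h_\alpha=2t_\alpha/(\alpha,\alpha)$ for $\alpha\in R^\times$. The core $E_c$ is the subalgebra generated by $E_\alpha$, $\alpha\in R^\times$; $E_c=\mathcal L\oplus D^{gr\star}$. Chevalley involutions. For $\mathcal L$: a finite order automorphism $\tau$ with $\tau(\mathcal L^\lambda)=\mathcal L^{-\lambda}$ for $\lambda\in\Lambda$ and $\tau(h)=-h$ for $h\in\mathcal L^0_0$. For $E$: a finite order automorphism with $\tau(E_\alpha)=E_{-\alpha}$, $\alpha\in R$. For $E_c$: a finite order automorphism of $E_c$ with $\tau(E_\alpha)=E_{-\alpha}$,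 $\alpha\in R^\times$. Integral structures. A Chevalley system for $(E_c,\tau)$ is a set $\{x_\alpha\in E_\alpha\mid\alpha\in R^\times\}$ with $[x_\alpha,x_{-\alpha}]=h_\alpha$, $\tau(x_\alpha)=-x_{-\alpha}$. An integral structure for $(E_c,\tau)$ is $\mathcal B_c\subseteq E_c$ with: elements of $\mathcal B_c$ are root vectors of $E$; $\tau(\mathcal B_c)=-\mathcal B_c$; $\{\mathcal B_c\cap E_\alpha\mid\alpha\in R^\times\}$ is a Chevalley system for $(E_c,\tau)$; for $\sigma\in R^0$, $\mathrm{span}_{\mathbb Z}(\mathcal B_c\cap E_\sigma)=\sum_{\alpha\in R^\times}\mathbb Z[\mathcal B_c\cap E_{\alpha+\sigma},\mathcal B_c\cap E_{-\alpha}]$. An integral structure for $(E,\tau)$ is $\mathcal B\subseteq E$ such that, with $\mathcal B\cap E_c=:\mathcal B_c$: $\mathcal B$ spans $E$ and consists of root vectors; $\tau(\mathcal B)=-\mathcal B$; $[\mathcal B\cap E_\alpha,\mathcal B\cap E_{-\alpha}]=\{h_\alpha\}$ for $\alpha\in R^\times$; for $\sigma\in R^0$, $\mathrm{span}_{\mathbb Z}(\mathcal B_c\cap E_\sigma)=\sum_{\alpha\in R^\times}\mathbb Z[\mathcal B\cap E_{\alpha+\sigma},\mathcal B\cap E_{-\alpha}]$; $[\mathcal B\setminus\mathcal B_c,\mathcal B]\subseteq\mathrm{span}_{\mathbb Z}\mathcal B$.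
   Formalization: The basis χ^μ of the centroid is assumed compatible with τ, i.e. τχ^μ = χ^{-μ}τ for μ in Γ (the claim fails for arbitrary χ); it is also proved that every Chevalley involution τ admits such a choice of χ. *)

(* Defs.v *)
From HB Require Import structures.
From mathcomp Require Import all_boot all_order all_algebra.
From mathcomp Require Import finmap complex ring.
From mathcomp Require Import all_classical all_reals all_analysis.

Set Implicit Arguments.
Unset Strict Implicit.
Unset Printing Implicit Defensive.

Import Order.TTheory GRing.Theory Num.Theory.
Import numFieldNormedType.Exports.

Local Open Scope classical_set_scope.
Local Open Scope ring_scope.

Section LinearAlgebra.
Context {K : fieldType} {V : lmodType K}.

Definition is_subspace (S : set V) : Prop :=
  S 0 /\ forall (a : K) (u v : V), S u -> S v -> S (a *: u + v).

Definition is_subgroup (W : zmodType) (S : set W) : Prop :=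
  S 0 /\ forall u v : W, S u -> S v -> S (u - v).

Definition lspan (A : set V) : set V := smallest is_subspace A.

Definition line (e : V) : set V := [set a *: e | a in [set: K]].

Definition dim_le1 (S : set V) : Prop := exists e : V, S `<=` line e.

Definition dim_eq1 (S : set V) : Prop := exists2 e : V, e != 0 & S = line e.

Lemma lspan_subspace (A : set V) : is_subspace (lspan A).
Proof.
split=> [S [[]]//|a u v uA vA S [SS AS]].
by case: (SS) => _; apply; [apply: uA|apply: vA].
Qed.

Lemma lspan_sub (A : set V) : A `<=` lspan A.
Proof. exact: sub_gen_smallest. Qed.

Lemma lspan_min (A S : set V) : is_subspace S -> A `<=` S -> lspan A `<=` S.
Proof. exact: smallest_sub. Qed.

Lemma subspaceD (S : set V) (u v : V) : is_subspace S -> S u -> S v -> S (u + v).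
Proof. by move=> [_ h] Su Sv; rewrite -[u]scale1r; exact: h. Qed.

Lemma subspaceZ (S : set V) (a : K) (u : V) : is_subspace S -> S u -> S (a *: u).
Proof. by move=> [S0 h] Su; rewrite -[_ *: _]addr0; exact: h. Qed.

Lemma subspaceN (S : set V) (u : V) : is_subspace S -> S u -> S (- u).
Proof. by move=> hS Su; rewrite -scaleN1r; exact: subspaceZ. Qed.

End LinearAlgebra.

Definition zspan (W : zmodType) (A : set W) : set W := smallest (@is_subgroup W) A.

Definition opp_set (W : zmodType) (A : set W) : set W := [set - x | x in A].

(* The values of a bracket on a pair of subsets; it is only ever placed
   under [lspan] or [zspan], or compared with a singleton. *)
Definition bracket_set (W : Type) (br : W -> W -> W) (A B : set W) : set W :=
  [set z | exists x y, [/\ A x, B y & z = br x y]].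

Definition free_of_finite_rank (M : zmodType) : Prop :=
  exists (n : nat) (b : 'I_n -> M),
    forall x : M, exists! c : {ffun 'I_n -> int}, x = \sum_(i < n) b i *~ c i.

Record submod (K : fieldType) (V : lmodType K) := Submod {
  submod_set :> set V;
  submodP : is_subspace submod_set }.

Section SubmodType.
Context {K : fieldType} {V : lmodType K} (S : submod V).

Definition submod_pred : {pred V} := fun x => `[< submod_set S x >].

Lemma submod_pred_closed : GRing.submod_closed submod_pred.
Proof.
case: (submodP S) => S0 Sl; split; first exact/asboolP.
by move=> a u v /asboolP Su /asboolP Sv; apply/asboolP; exact: Sl.
Qed.

HB.instance Definition _ :=
  GRing.isSubmodClosed.Build K V submod_pred (GRing.submod_closed_semi submod_pred_closed).

Record submod_type := SubmodElt {
  submod_val : V;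
  submod_valP : submod_val \in submod_pred }.

HB.instance Definition _ := [isSub for submod_val].
HB.instance Definition _ := [Choice of submod_type by <:].
HB.instance Definition _ := [SubChoice_isSubLmodule of submod_type by <:].

Definition submod_elt (x : V) (Sx : submod_set S x) : submod_type :=
  @SubmodElt x (asboolT Sx).

Lemma submod_in (x : submod_type) : submod_set S (val x).
Proof. exact/asboolP/(submod_valP x). Qed.

Lemma submod_val_lin (a : K) (x y : submod_type) :
  submod_val (a *: x + y) = a *: submod_val x + submod_val y.
Proof. exact: (linearP (val : submod_type -> V)). Qed.

End SubmodType.

Section DirectSum.
Context {K : fieldType} {V : lmodType K} {I : choiceType}.
Variable S : I -> set V.

Definition decomposition (x : V) (f : I -> V) : Prop :=
  [/\ finite_set [set i | f i != 0], forall i, S i (f i)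
    & x = \sum_(i \in [set: I]) f i].

Definition is_direct_sum : Prop :=
  (forall i, is_subspace (S i)) /\
  forall x : V, exists! f : I -> V, decomposition x f.

Definition component (x : V) : I -> V := xget (fun=> 0) (decomposition x).

Hypothesis dS : is_direct_sum.

Lemma componentP x : decomposition x (component x).
Proof. by rewrite /component; case: xgetP => // /(_ _); case: (dS.2 x) => f [fP _] /(_ f). Qed.

Lemma component_uniq x f : decomposition x f -> component x = f.
Proof.
move=> fP; case: (dS.2 x) => g [gP gu].
by rewrite -(gu _ fP) -(gu _ (componentP x)).
Qed.

Lemma component_homog i x : S i x -> component x = fun j => if j == i then x else 0.
Proof.
move=> Sx; apply: component_uniq; split.
- apply: (sub_finite_set _ (finite_set1 i)) => j /=.
  by case: ifP => [/eqP//|_]; rewrite eqxx.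
- by move=> j; case: ifP => [/eqP->//|_]; case: (dS.1 j).
- rewrite (fsbigTE [fset i]%fset) ?big_seq_fset1 ?eqxx// => j.
  by rewrite inE => /negbTE ->.
Qed.

Lemma component_lin a x y : component (a *: x + y) = fun i => a *: component x i + component y i.
Proof.
have [fx Sx ex] := componentP x; have [fy Sy ey] := componentP y.
have fu : finite_set ([set i | component x i != 0] `|` [set i | component y i != 0]).
  by rewrite finite_setU.
apply: component_uniq; split.
- apply: sub_finite_set fu => i /=; apply: contra_neqP.
  by move=> /not_orP[/negP/negPn/eqP-> /negP/negPn/eqP->]; rewrite scaler0 addr0.
- by move=> i; exact: (dS.1 i).2.
have h (f : I -> V) : (forall i, f i != 0 -> component x i != 0 \/ component y i != 0) ->
    \sum_(i \in [set: I]) f i = \sum_(i <- fset_set ([set i | component x i != 0]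
      `|` [set i | component y i != 0])) f i.
  move=> hf; rewrite (fsbigTE (fset_set ([set i | component x i != 0]
      `|` [set i | component y i != 0])))// => i; rewrite in_fset_set// notin_setE /= => h.
  by apply: contra_notP h => /eqP /hf.
rewrite {1}ex {1}ey (h (component x)); last by left.
rewrite (h (component y)); last by right.
rewrite h ?scaler_sumr -?big_split//= => i.
apply: contra_neqP => /not_orP[/negP/negPn/eqP-> /negP/negPn/eqP->].
by rewrite scaler0 addr0.
Qed.

Lemma homog_ind (P : V -> Prop) : P 0 -> (forall x y, P x -> P y -> P (x + y)) ->
  (forall i x, S i x -> P x) -> forall x, P x.
Proof.
move=> P0 PD PS x; have [_ Sx ->] := componentP x.
by apply: (big_ind P) => // i _; exact: PS (Sx i).
Qed.

End DirectSum.

Section LieAlgebra.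
Context {K : fieldType} {V : lmodType K}.
Variable br : V -> V -> V.

Definition is_lie_bracket : Prop :=
  [/\ forall y, linear (br ^~ y), forall x, linear (br x), forall x, br x x = 0
    & forall x y z, br x (br y z) + br y (br z x) + br z (br x y) = 0].

Definition is_subalgebra (S : set V) : Prop :=
  is_subspace S /\ forall x y, S x -> S y -> S (br x y).

Definition is_automorphism (f : V -> V) : Prop :=
  [/\ linear f, bijective f & forall x y, f (br x y) = br (f x) (f y)].

Definition finite_order (f : V -> V) : Prop :=
  exists2 n : nat, (0 < n)%N & forall x, iter n f x = x.

Definition in_centroid (f : V -> V) : Prop :=
  linear f /\ forall x y, f (br x y) = br (f x) y /\ f (br x y) = br x (f y).

End LieAlgebra.

(* The field of complex numbers is R[i], for R the real numbers. *)
Section ExtendedAffine.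
Context {R : realType}.
Local Notation C := R[i].

(* 0 is counted among the roots.  [rs_coroot a] is the coroot of a as a linear
   form: <b, a^v> is [rs_coroot a b]; it is uniquely determined by the axioms
   for a a nonzero root, and irrelevant for other a. *)
Record rootSystem := RootSystem {
  rs_space : vectType C;
  rs_roots : seq rs_space;
  rs_coroot : rs_space -> {scalar rs_space};
  rs_zero : 0 \in rs_roots;
  rs_span : <<rs_roots>>%VS = fullv;
  rs_coroot2 : forall a, a \in rs_roots -> a != 0 -> rs_coroot a a = 2;
  rs_reflection : forall a b, a \in rs_roots -> b \in rs_roots -> a != 0 ->
    b - rs_coroot a b *: a \in rs_roots;
  rs_integral : forall a b, a \in rs_roots -> b \in rs_roots -> a != 0 ->
    exists n : int, rs_coroot a b = n%:~R }.

Definition nonzero_root (Delta : rootSystem) (a : rs_space Delta) : Prop :=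
  a \in rs_roots Delta /\ a != 0.

Definition irreducible (Delta : rootSystem) : Prop :=
  (exists a : rs_space Delta, nonzero_root a) /\
  ~ exists A B : set (rs_space Delta),
      [/\ A !=set0, B !=set0, A `|` B = [set a | nonzero_root a]
        & forall a b, A a -> B b -> rs_coroot a b = 0 /\ rs_coroot b a = 0].

Definition reduced (Delta : rootSystem) : Prop :=
  forall a : rs_space Delta, nonzero_root a -> a *+ 2 \notin rs_roots Delta.

(* The degrees range over the whole space of Delta instead of its root
   lattice; by [lt_gr_out] this makes no difference. *)
Record lieTorus (Delta : rootSystem) (Lambda : zmodType) := LieTorus {
  lt_alg :> lmodType C;
  lt_br : lt_alg -> lt_alg -> lt_alg;
  lt_gr : rs_space Delta -> Lambda -> set lt_alg;
  lt_lie : is_lie_bracket lt_br;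
  lt_direct : is_direct_sum (fun p : rs_space Delta * Lambda => lt_gr p.1 p.2);
  lt_graded : forall a b l m x y, lt_gr a l x -> lt_gr b m y ->
    lt_gr (a + b) (l + m) (lt_br x y);
  lt_gr_out : forall a l, a \notin rs_roots Delta -> lt_gr a l = [set 0];
  lt_dim_le1 : forall a l, nonzero_root a -> dim_le1 (lt_gr a l);
  lt_dim_eq1 : forall a, nonzero_root a ->
    (2^-1 : C) *: a \notin rs_roots Delta -> dim_eq1 (lt_gr a 0);
  lt_sl2 : forall a l, nonzero_root a -> dim_eq1 (lt_gr a l) ->
    exists e f : lt_alg,
      [/\ lt_gr a l e /\ e != 0, lt_gr (- a) (- l) f /\ f != 0
        & forall b m x, b \in rs_roots Delta -> lt_gr b m x ->
            lt_br (lt_br e f) x = rs_coroot a b *: x];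
  lt_core : forall l, lt_gr 0 l =
    lspan (\bigcup_(p in [set p : rs_space Delta * Lambda | nonzero_root p.1])
             bracket_set lt_br (lt_gr p.1 p.2) (lt_gr (- p.1) (l - p.2)));
  lt_full : zspan [set l | exists2 a, a \in rs_roots Delta & lt_gr a l <> [set 0]]
            = [set: Lambda] }.

Section Torus.
Context {Delta : rootSystem} {Lambda : zmodType}.
Variable L : lieTorus Delta Lambda.

Definition centerless : Prop :=
  forall x : L, (forall y : L, lt_br x y = 0) -> x = 0.

Definition lam_gr (l : Lambda) : set L :=
  lspan (\bigcup_(a in [set: rs_space Delta]) lt_gr a l).

Record gradedForm := GradedForm {
  gf_form :> L -> L -> C;
  gf_linear : forall y, scalar (gf_form ^~ y);
  gf_sym : forall x y, gf_form x y = gf_form y x;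
  gf_invariant : forall x y z, gf_form (lt_br x y) z = gf_form x (lt_br y z);
  gf_graded : forall l m x y, l + m != 0 -> lam_gr l x -> lam_gr m y ->
    gf_form x y = 0;
  gf_nondeg : forall x, (forall y, gf_form x y = 0) -> x = 0 }.

(* The presentation of the centroid as the direct sum of the lines spanned by
   chi m for m in Gamma.  The values of chi outside Gamma are irrelevant. *)
Record centroidBasis := CentroidBasis {
  cb_Gamma : set Lambda;
  cb_chi : Lambda -> L -> L;
  cb_subgroup : is_subgroup cb_Gamma;
  cb_centroid : forall m, cb_Gamma m -> in_centroid (@lt_br _ _ L) (cb_chi m);
  cb_degree : forall m l x, cb_Gamma m -> lam_gr l x -> lam_gr (l + m) (cb_chi m x);
  cb_mul : forall m n, cb_Gamma m -> cb_Gamma n ->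
    cb_chi m \o cb_chi n = cb_chi (m + n);
  cb_basis : forall f : L -> L, in_centroid (@lt_br _ _ L) f ->
    exists! c : Lambda -> C,
      [/\ finite_set [set m | c m != 0], forall m, c m != 0 -> cb_Gamma m
        & f = \sum_(m \in [set: Lambda]) c m *: cb_chi m] }.

Definition torus_gr (p : rs_space Delta * Lambda) : set L := lt_gr p.1 p.2.

Definition degree_derivation (theta : {additive Lambda -> C}) (x : L) : L :=
  \sum_(p \in [set: rs_space Delta * Lambda]) theta p.2 *: component torus_gr x p.

Definition integral_hom (theta : {additive Lambda -> C}) : Prop :=
  forall l, exists n : int, theta l = n%:~R.

Definition chevalley_involution (tau : L -> L) : Prop :=
  [/\ is_automorphism (@lt_br _ _ L) tau, finite_order tau,
      forall l, tau @` lam_gr l = lam_gr (- l)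
    & forall h, lt_gr 0 0 h -> tau h = - h].

(* For a Chevalley involution tau the endomorphism tau chi^m tau^-1 is always a
   nonzero multiple c(m) of chi^(-m), and the character c becomes trivial after
   rescaling chi by a character b of Gamma with b^2 = c^-1.  An extension of tau
   to E can satisfy chi^m d_theta |-> - chi^(-m) d_theta only when c(m) = 1, so
   the basis of the centroid has to be chosen compatibly with tau. *)
Definition normalized (cb : centroidBasis) (tau : L -> L) : Prop :=
  forall m, cb_Gamma cb m -> tau \o cb_chi cb m = cb_chi cb (- m) \o tau.

Lemma lam_gr_homog a l (x : L) : lt_gr a l x -> lam_gr l x.
Proof. by move=> h; apply: lspan_sub; exists a. Qed.

Lemma lam_gr_ind (P : L -> Prop) : P 0 -> (forall x y, P x -> P y -> P (x + y)) ->
  (forall l x, lam_gr l x -> P x) -> forall x, P x.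
Proof.
move=> P0 PD PS; apply: (homog_ind (lt_direct L)) => // -[a l] x /= h.
exact: PS (lam_gr_homog h).
Qed.

Lemma degree_derivation_linear theta : linear (degree_derivation theta).
Proof.
move=> c x y; rewrite /degree_derivation; set S := torus_gr.
have dS : is_direct_sum S := lt_direct L.
have [fx _ _] := componentP dS x; have [fy _ _] := componentP dS y.
pose U := [set i | component S x i != 0] `|` [set i | component S y i != 0].
have fU : finite_set U by rewrite finite_setU.
have h (z : L) : (forall p, component S z p != 0 -> U p) ->
    \sum_(p \in [set: rs_space Delta * Lambda]) theta p.2 *: component S z p =
    \sum_(p <- fset_set U) theta p.2 *: component S z p.
  move=> hz; rewrite (fsbigTE (fset_set U))// => p; rewrite in_fset_set// notin_setE => nU.
  have : ~ component S z p != 0 by move=> /hz.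
  by move=> /negP/negPn/eqP->; rewrite scaler0.
rewrite (h (c *: x + y)); last first.
  move=> p; rewrite (component_lin dS) => hp; apply: contrapT => nU; move: hp.
  move/not_orP: nU => [/negP/negPn/eqP-> /negP/negPn/eqP->].
  by rewrite scaler0 addr0 eqxx.
rewrite (h x); last by left.
rewrite (h y); last by right.
rewrite scaler_sumr -big_split /=; apply: eq_bigr => p _.
by rewrite (component_lin dS) scalerDr !scalerA mulrC.
Qed.

Lemma degree_derivationE theta l x : lam_gr l x ->
  degree_derivation theta x = theta l *: x.
Proof.
move=> h; suff : lam_gr l `<=` [set x | degree_derivation theta x = theta l *: x] by exact.
have lin := degree_derivation_linear theta.
apply: lspan_min.
  split=> [/=|c u v /= hu hv]; last first.
    by rewrite lin hu hv scalerDr !scalerA mulrC.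
  have := lin (-1) 0 0; rewrite !scaleN1r oppr0 addr0 => ->.
  by rewrite addNr scaler0.
move=> {h}x [a _ h] /=; rewrite /degree_derivation; set S := torus_gr.
have dS : is_direct_sum S := lt_direct L.
rewrite (component_homog dS (i := (a, l)) h).
rewrite (fsbigTE [fset (a, l)]%fset) ?big_seq_fset1 ?eqxx// => j.
by rewrite inE => /negbTE ->; rewrite scaler0.
Qed.

Variable cb : centroidBasis.
Local Notation Gamma := (cb_Gamma cb).
Local Notation chi := (cb_chi cb).

(* Empty when m is not in Gamma. *)
Definition scder_gr (m : Lambda) : set (L -> L) :=
  [set d | Gamma m /\ exists2 theta : {additive Lambda -> C},
                        theta m = 0 & d = chi m \o degree_derivation theta].

Definition scder : set (L -> L) := lspan (\bigcup_(m in [set: Lambda]) scder_gr m).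

(* The commutator; on the graded pieces it is given by
   [chi^m d_theta, chi^n d_psi] = chi^(m+n) (theta(n) d_psi - psi(m) d_theta). *)
Definition commutator (d e : L -> L) : L -> L := fun x => d (e x) - e (d x).

Lemma chi_linear m : Gamma m -> linear (chi m).
Proof. by move=> /(cb_centroid (c:=cb))[]. Qed.

Lemma scder_gr_linear m d : scder_gr m d -> linear d.
Proof.
move=> [Gm [theta _ ->]] c x y /=.
by rewrite degree_derivation_linear chi_linear.
Qed.

Lemma scder_gr_degree m d l x : scder_gr m d -> lam_gr l x -> lam_gr (l + m) (d x).
Proof.
move=> [Gm [theta _ ->]] lx /=; apply: cb_degree => //.
rewrite (degree_derivationE _ lx).
by apply: subspaceZ lx; exact: lspan_subspace.
Qed.

Lemma linear_0 (f : L -> L) : linear f -> f 0 = 0.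
Proof. by move=> lf; have := lf (-1) 0 0; rewrite scaler0 addr0 scaleN1r addNr. Qed.

Lemma linear_D (f : L -> L) x y : linear f -> f (x + y) = f x + f y.
Proof. by move=> lf; have := lf 1 x y; rewrite !scale1r. Qed.

Lemma linear_Z (f : L -> L) c x : linear f -> f (c *: x) = c *: f x.
Proof. by move=> lf; have := lf c x 0; rewrite !addr0 (linear_0 lf) addr0. Qed.

Lemma cb_GammaD m n : Gamma m -> Gamma n -> Gamma (m + n).
Proof.
case: (cb_subgroup cb) => G0 GB Gm Gn.
by rewrite -[n]opprK; apply: (GB) => //; rewrite -[- n]add0r; exact: GB.
Qed.

Lemma scder_gr_comm m n d e : scder_gr m d -> scder_gr n e ->
  scder_gr (m + n) (commutator d e).
Proof.
move=> hd he.
have dlin := scder_gr_linear hd; have elin := scder_gr_linear he.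
case: (hd) => Gm [theta tm ed]; case: (he) => Gn [psi pn ee].
split; first exact: cb_GammaD.
pose xi l : C := theta n * psi l - psi m * theta l.
have xiB : zmod_morphism xi.
  by move=> u v; rewrite /xi !raddfB /=; ring.
pose xi' : {additive Lambda -> C} := HB.pack xi (GRing.isZmodMorphism.Build _ _ xi xiB).
exists xi'.
  by rewrite /= /xi !raddfD /= tm pn add0r addr0 mulrC subrr.
apply/funext; apply: lam_gr_ind.
- rewrite /commutator /= (linear_0 (degree_derivation_linear _)).
  by rewrite !(linear_0 dlin, linear_0 elin) (linear_0 (chi_linear (cb_GammaD Gm Gn))) subrr.
- move=> x y hx hy; rewrite /= (linear_D _ _ (degree_derivation_linear _)).
  rewrite (linear_D _ _ (chi_linear (cb_GammaD Gm Gn))) /=.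
  move: hx hy => /= <- <-.
  by rewrite /commutator !(linear_D _ _ dlin, linear_D _ _ elin) opprD addrACA.
- move=> l x lx; rewrite /= (degree_derivationE _ lx) /commutator ed ee /=.
  have lin_m := chi_linear Gm; have lin_n := chi_linear Gn.
  rewrite !(degree_derivationE _ lx).
  rewrite (linear_Z _ _ lin_n) (linear_Z _ _ lin_m).
  rewrite !(linear_Z _ _ (degree_derivation_linear _)).
  rewrite (degree_derivationE _ (cb_degree Gn lx)) (degree_derivationE _ (cb_degree Gm lx)).
  rewrite (linear_Z _ _ (chi_linear (cb_GammaD Gm Gn))).
  rewrite !(linear_Z _ _ lin_m, linear_Z _ _ lin_n).
  have -> : chi m (chi n x) = chi (m + n) x by rewrite -(cb_mul Gm Gn).
  have -> : chi n (chi m x) = chi (m + n) x by rewrite addrC -(cb_mul Gn Gm).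
  rewrite !scalerA -scalerBl /= /xi; congr (_ *: _).
  by rewrite !raddfD /=; ring.
Qed.

Lemma scder_gr_subspace m : Gamma m -> is_subspace (scder_gr m).
Proof.
move=> Gm; split.
  have zB : zmod_morphism ((fun=> 0) : Lambda -> C).
    by move=> u v /=; rewrite subrr.
  pose z : {additive Lambda -> C} :=
    HB.pack ((fun=> 0) : Lambda -> C) (GRing.isZmodMorphism.Build _ _ _ zB).
  split=> //; exists z => //; apply/funext; apply: lam_gr_ind => /=.
  - by rewrite (linear_0 (degree_derivation_linear _)) (linear_0 (chi_linear Gm)).
  - move=> x y /= hx hy; rewrite (linear_D _ _ (degree_derivation_linear _)).
    by rewrite (linear_D _ _ (chi_linear Gm)) -hx -hy /= addr0.
  - move=> l x lx; rewrite (degree_derivationE _ lx) /= scale0r.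
    by rewrite (linear_0 (chi_linear Gm)).
move=> c d e [_ [theta tm ->]] [_ [psi pm ->]]; split=> //.
pose xi l : C := c * theta l + psi l.
have xiB : zmod_morphism xi by move=> u v; rewrite /xi !raddfB /=; ring.
pose xi' : {additive Lambda -> C} := HB.pack xi (GRing.isZmodMorphism.Build _ _ xi xiB).
exists xi'; first by rewrite /= /xi tm pm mulr0 addr0.
have dl := degree_derivation_linear; have cl := chi_linear Gm.
apply/funext; apply: lam_gr_ind; rewrite !fctE.
- by rewrite /= !(linear_0 (dl _)) (linear_0 cl) scaler0 addr0.
- move=> x y; rewrite ?fctE /= => hx hy; rewrite !(linear_D _ _ (dl _)) !(linear_D _ _ cl).
  by rewrite -hx -hy scalerDr addrACA.
- move=> l x lx; rewrite ?fctE /= !(degree_derivationE _ lx) !(linear_Z _ _ cl) /= /xi.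
  by rewrite scalerDl scalerA.
Qed.

Definition graded_part (D : set (L -> L)) (m : Lambda) : set (L -> L) :=
  D `&` scder_gr m.

(* D^0 consists of derivations d_theta, so (D^0)^* is realised inside the
   functions on { theta | d_theta in D^0 }. *)
Definition degree_zero_homs (D : set (L -> L)) : set {additive Lambda -> C} :=
  [set theta | graded_part D 0 (degree_derivation theta)].

(* D^0 is finite-dimensional when Lambda has finite rank, and the topology of
   the finite-dimensional space (D^0)^* is that of pointwise convergence. *)
Definition ev (D : set (L -> L)) (l : Lambda) :
    {ptws degree_zero_homs D -> C^o} :=
  fun theta => val theta l.

(* The existence of an affine cocycle is not a condition, since 0 is one. *)
Record permissible := Permissible {
  pm_sub :> submod (L -> L);
  pm_scder : pm_sub `<=` scder;
  pm_comm : forall d e, submod_set pm_sub d -> submod_set pm_sub e ->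
    submod_set pm_sub (commutator d e);
  pm_graded : submod_set pm_sub =
    lspan (\bigcup_(m in [set: Lambda]) graded_part pm_sub m);
  pm_ev_inj : injective (ev (D := pm_sub));
  pm_ev_discrete : range (ev (D := pm_sub)) `<=` isolated (range (ev (D := pm_sub))) }.

Variable form : gradedForm.
Variable D : permissible.

Local Notation der := (submod_type D).

Definition der_gr (m : Lambda) : set der := [set d | graded_part D m (submod_val d)].

Definition der_br (d e : der) : der :=
  submod_elt (pm_comm (submod_in d) (submod_in e)).

(* The sum of the duals of the D^m: the linear functionals vanishing on all but
   finitely many D^m. *)
Definition is_graded_functional (phi : der -> C^o) : Prop :=
  scalar phi /\ finite_set [set m | exists2 d, der_gr m d & phi d != 0].

Lemma graded_functional_subspace : is_subspace is_graded_functional.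
Proof.
split=> [|a u v [ul uf] [vl vf]].
  split=> [c x y /=|]; first by rewrite mulr0 addr0.
  apply: (sub_finite_set _ (finite_set0 _)) => m [d _]; by rewrite eqxx.
split=> [c x y|].
  rewrite /= !fctE /= ul vl !scalerDr addrACA; congr (_ + _).
  by rewrite mulrDr; congr (_ + _); rewrite /GRing.scale/= mulrCA.
apply: (@sub_finite_set _ _ ([set m | exists2 d, der_gr m d & u d != 0] `|`
   [set m | exists2 d, der_gr m d & v d != 0])); last by rewrite finite_setU.
move=> m [d dm]; rewrite fctE => h.
have [ud|ud] := eqVneq (u d) 0; last by left; exists d.
right; exists d => //; apply: contraNneq h => vd.
by rewrite /= fctE ud vd scaler0 addr0.
Qed.

Definition graded_dual_submod : submod (der -> C^o) :=
  Submod graded_functional_subspace.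

Local Notation graded_dual := (submod_type graded_dual_submod).

Lemma der_linear (d : der) : linear (submod_val d).
Proof.
have := submod_in d; rewrite pm_graded => h.
suff : lspan (\bigcup_(m in [set: Lambda]) graded_part D m)
    `<=` [set d : L -> L | linear d] by move=> /(_ _ h).
apply: lspan_min; last by move=> e [m _ [_ /scder_gr_linear]].
split=> [c x y /=|c u v ul vl a x y]; first by rewrite scaler0 addr0.
rewrite !fctE ul vl !scalerDr addrACA; congr (_ + _).
by rewrite !scalerA mulrC -!scalerA.
Qed.

Lemma sigma_functional (x y : L) :
  is_graded_functional (fun d => form (submod_val d x) y).
Proof.
split=> [c d e|]; first by rewrite /= fctE gf_linear.
have form0l z : form 0 z = 0.
  by have := gf_linear form z (-1) 0 0; rewrite scaler0 addr0 mulN1r addNr.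
have form0r z : form z 0 = 0 by rewrite gf_sym.
have formDl u v z : form (u + v) z = form u z + form v z.
  by have := gf_linear form z 1 u v; rewrite scale1r mul1r.
have formDr u v z : form z (u + v) = form z u + form z v.
  by rewrite gf_sym formDl !(gf_sym form z).
have finU (A B E : set Lambda) : finite_set A -> finite_set B ->
    E `<=` A `|` B -> finite_set E.
  by move=> fA fB EAB; apply: (sub_finite_set EAB); rewrite finite_setU.
move: x; apply: lam_gr_ind.
- apply: (sub_finite_set _ (finite_set0 _)) => m [d _].
  by rewrite (linear_0 (der_linear d)) form0l eqxx.
- move=> u v fu fv; apply: (finU _ _ _ fu fv) => m [d dm].
  rewrite (linear_D _ _ (der_linear d)) formDl => h.
  have [ud|ud] := eqVneq (form (submod_val d u) y) 0; last by left; exists d.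
  by right; exists d => //; move: h; rewrite ud add0r.
move=> l x lx; move: y; apply: lam_gr_ind.
- by apply: (sub_finite_set _ (finite_set0 _)) => m [d _]; rewrite form0r eqxx.
- move=> u v fu fv; apply: (finU _ _ _ fu fv) => m [d dm].
  rewrite formDr => h.
  have [ud|ud] := eqVneq (form (submod_val d x) u) 0; last by left; exists d.
  by right; exists d => //; move: h; rewrite ud add0r.
move=> n y ny; apply: (sub_finite_set _ (finite_set1 (- (l + n)))) => m [d [_ dm]].
move=> h /=; apply/eqP; rewrite -addr_eq0; apply: contraNT h => mn.
apply/eqP/(gf_graded form (l := l + m) (m := n)) => //.
  by rewrite addrAC addrC.
exact: scder_gr_degree dm lx.
Qed.

Definition sigma (x y : L) : graded_dual :=
  @submod_elt _ _ graded_dual_submod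
    (fun d : der => form (submod_val d x) y) (sigma_functional x y).

Lemma der_br_lin (c : C) (d e e' : der) :
  der_br (c *: e + e') d = c *: der_br e d + der_br e' d.
Proof.
apply: val_inj; apply/funext => x /=.
rewrite /commutator ?submod_val_lin !fctE /= (linear_D _ _ (der_linear d)) (linear_Z _ _ (der_linear d)).
by rewrite scalerBr opprD addrACA.
Qed.

Lemma dual_action_functional (d : der) (phi : graded_dual) :
  is_graded_functional (fun e => submod_val phi (der_br e d)).
Proof.
have [lphi fphi] : is_graded_functional (submod_val phi) := submod_in phi.
split=> [c e e'|]; first by rewrite /= der_br_lin lphi.
have := submod_in d; rewrite pm_graded => hd.
pose fin (d : der) := finite_set [set m | exists2 e, der_gr m e & submod_val phi (der_br e d) != 0].
suff : lspan (\bigcup_(m in [set: Lambda]) graded_part D m)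
    `<=` [set d : L -> L | submod_set D d /\ forall d' : der, submod_val d' = d -> fin d'].
  by move=> /(_ _ hd) [_]; apply.
have brr c (e u v : der) : der_br e (c *: u + v) = c *: der_br e u + der_br e v.
  apply: val_inj; apply/funext => x /=.
  rewrite /commutator ?submod_val_lin !fctE /= (linear_D _ _ (der_linear e)) (linear_Z _ _ (der_linear e)).
  by rewrite scalerBr opprD addrACA.
have phi0 : submod_val phi 0 = 0.
  by have := lphi (-1) 0 0; rewrite scaler0 addr0 mulN1r addNr.
apply: lspan_min.
  split=> [|c u v [Du fu] [Dv fv]].
    split; first by case: (submodP D).
    move=> d' d'0; have -> : d' = 0 by apply: val_inj; exact: d'0.
    apply: (sub_finite_set _ (finite_set0 _)) => m [e _].
    have -> : der_br e 0 = 0.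
      by have := brr (-1) e 0 0; rewrite scaler0 addr0 scaleN1r addNr.
    by rewrite phi0 eqxx.
  split; first exact: (submodP D).2.
  move=> d' d'E; pose du : der := submod_elt Du; pose dv : der := submod_elt Dv.
  have -> : d' = c *: du + dv by apply: val_inj; exact: d'E.
  have fuv := fu du erefl; have {}fv := fv dv erefl.
  apply: (@sub_finite_set _ _ (
     [set m | exists2 e, der_gr m e & submod_val phi (der_br e du) != 0] `|`
     [set m | exists2 e, der_gr m e & submod_val phi (der_br e dv) != 0]));
    last by rewrite finite_setU.
  move=> m [e em]; rewrite brr lphi => h.
  have [ud|ud] := eqVneq (submod_val phi (der_br e du)) 0; last by left; exists e.
  by right; exists e => //; move: h; rewrite ud mulr0 add0r.
move=> u [n _ [Du un]]; split=> // d' d'E.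
have := finite_image (fun m => m - n) fphi.
apply: sub_finite_set => m [e [De em]] h /=.
exists (m + n); last by rewrite addrK.
exists (der_br e d') => //; split; first exact: submod_in.
by rewrite /= d'E; exact: scder_gr_comm.
Qed.

Definition dual_action (d : der) (phi : graded_dual) : graded_dual :=
  @submod_elt _ _ graded_dual_submod
    (fun e : der => submod_val phi (der_br e d)) (dual_action_functional d phi).

Definition ealg : lmodType C := (L * graded_dual * der)%type.

Definition inL (x : L) : ealg := (x, 0, 0).
Definition inD (d : der) : ealg := (0, 0, d).

Definition ebr (u v : ealg) : ealg :=
  let: (x1, c1, d1) := u in let: (x2, c2, d2) := v in
  (lt_br x1 x2 + submod_val d1 x2 - submod_val d2 x1,
   sigma x1 x2 + dual_action d1 c2 - dual_action d2 c1,
   der_br d1 d2).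

Definition eform (u v : ealg) : C :=
  let: (x1, c1, d1) := u in let: (x2, c2, d2) := v in
  form x1 x2 + submod_val c1 d2 + submod_val c2 d1.

(* (D^gr* )^0 = (D^0)^* consists of the functionals vanishing on all other
   D^m. *)
Definition cartan_set : set ealg :=
  [set u | [/\ lt_gr 0 0 u.1.1,
               forall m d, m != 0 -> der_gr m d -> submod_val u.1.2 d = 0
             & der_gr 0 u.2]].

Lemma cartan_subspace : is_subspace cartan_set.
Proof.
have [S0 Sl] := scder_gr_subspace (cb_subgroup cb).1.
have [D0 Dl] := submodP D.
split.
  split=> [|//|]; first exact: ((lt_direct L).1 (0, 0)).1.
  by split.
move=> c [[x f] d] [[y g] e] [xu fu [Du du]] [xv fv [Dv dv]]; split.
- exact: ((lt_direct L).1 (0, 0)).2.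
- move=> m d' m0 dm; have {}fu := fu m d' m0 dm; have {}fv := fv m d' m0 dm.
  have -> : submod_val (c *: (x, f, d) + (y, g, e)).1.2 = c *: submod_val f + submod_val g.
    exact: submod_val_lin.
  have -> : (c *: submod_val f + submod_val g) d' =
      c * submod_val f d' + submod_val g d' by [].
  have -> : submod_val f d' = 0 := fu.
  have -> : submod_val g d' = 0 := fv.
  by rewrite mulr0 addr0.
- split; first exact: (Dl c _ _ Du Dv).
  exact: (Sl c _ _ du dv).
Qed.

Definition cartan_submod : submod ealg := Submod cartan_subspace.

Local Notation cartan := (submod_type cartan_submod).

(* Elements of the dual of the Cartan subalgebra are functions on it; those
   with a nonzero root space are automatically linear. *)
Definition root_space (a : cartan -> C) : set ealg :=
  [set u | forall h : cartan, ebr (submod_val h) u = a h *: u].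

Definition is_root (a : cartan -> C) : Prop :=
  scalar a /\ exists2 u, root_space a u & u != 0.

(* [t_vec a] is the element of the Cartan subalgebra representing a; the
   default value 0 is never used, the form being nondegenerate there. *)
Definition t_vec (a : cartan -> C) : cartan :=
  xget 0 [set t : cartan | forall h : cartan, eform (submod_val t) (submod_val h) = a h].

Definition root_form (a b : cartan -> C) : C := eform (submod_val (t_vec a)) (submod_val (t_vec b)).

Definition isotropic_root (a : cartan -> C) : Prop := is_root a /\ root_form a a = 0.

Definition nonisotropic_root (a : cartan -> C) : Prop := is_root a /\ root_form a a <> 0.

Definition h_vec (a : cartan -> C) : ealg := (2 / root_form a a) *: submod_val (t_vec a).

Definition core : set ealg :=
  smallest (is_subalgebra ebr) (\bigcup_(a in nonisotropic_root) root_space a).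

Definition is_root_vector (u : ealg) : Prop :=
  u != 0 /\ exists2 a, is_root a & root_space a u.

Definition chevalley_involution_ealg (tau : ealg -> ealg) : Prop :=
  [/\ is_automorphism ebr tau, finite_order tau
    & forall a, is_root a -> tau @` root_space a = root_space (- a)].

Definition chevalley_system (tau : ealg -> ealg) (x : (cartan -> C) -> ealg) : Prop :=
  forall a, nonisotropic_root a ->
    [/\ root_space a (x a), ebr (x a) (x (- a)) = h_vec a & tau (x a) = - x (- a)].

(* The sum over a in R^x of Z[B \cap E_(a + s), B \cap E_(-a)]. *)
Definition bracket_span (B : set ealg) (s : cartan -> C) : set ealg :=
  zspan (\bigcup_(a in nonisotropic_root)
    bracket_set ebr (B `&` root_space (a + s)) (B `&` root_space (- a))).

(* The involution of the core is given as the restriction of a map of E. *)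
Definition integral_structure_core (tau : ealg -> ealg) (Bc : set ealg) : Prop :=
  [/\ Bc `<=` core, Bc `<=` is_root_vector, tau @` Bc = opp_set Bc,
      exists2 x, chevalley_system tau x &
        forall a, nonisotropic_root a -> Bc `&` root_space a = [set x a]
    & forall s, isotropic_root s -> zspan (Bc `&` root_space s) = bracket_span Bc s].

Definition integral_structure (tau : ealg -> ealg) (B : set ealg) : Prop :=
  (lspan B = [set: ealg] /\ B `<=` is_root_vector) /\
  [/\ tau @` B = opp_set B,
      forall a, nonisotropic_root a ->
        bracket_set ebr (B `&` root_space a) (B `&` root_space (- a)) = [set h_vec a],
      forall s, isotropic_root s ->
        zspan (B `&` core `&` root_space s) = bracket_span B s
    & bracket_set ebr (B `\` core) B `<=` zspan B].

(* chi^n D^m, as a set of endomorphisms of L. *)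
Definition chi_graded_part (n m : Lambda) : set (L -> L) :=
  [set chi n \o d | d in graded_part D m].

Definition symmetric_der : Prop :=
  forall m, Gamma m -> chi_graded_part (- m) m = chi_graded_part m (- m).

Definition integrally_spanned_der : Prop :=
  forall m, Gamma m -> chi_graded_part (- m) m =
    lspan (chi_graded_part (- m) m `&`
           [set degree_derivation theta | theta in integral_hom]).

Definition chi_stable (Bc : set ealg) : Prop :=
  forall m l a x, Gamma m -> nonzero_root a -> lt_gr a l x -> Bc (inL x) ->
    zspan Bc (inL (chi m x)).

Definition extends (tau : L -> L) (taub : ealg -> ealg) : Prop :=
  forall x, taub (inL x) = inL (tau x).

Definition opposite_on_der (taub : ealg -> ealg) : Prop :=
  forall m (theta : {additive Lambda -> C}) (d : der), Gamma m ->
    der_gr m d -> submod_val d = chi m \o degree_derivation theta ->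
    exists2 d' : der, submod_val d' = - (chi (- m) \o degree_derivation theta)
      & taub (inD d) = inD d'.

End Torus.
End ExtendedAffine.

Arguments rootSystem R : clear implicits.

(* Main.v *)
(* The centroid basis is normalised by a square root of the character c of Gamma
   given by tau chi^m tau^-1 = c(m) chi^(-m); the square root exists since Gamma is
   a subgroup of a free abelian group.

   tau is extended by conjugation d |-> tau d tau^-1 on D and by its transpose on
   the graded dual.  This respects the bracket because tau preserves the form, and
   it maps E_a to E_(-a) because it is -1 on the Cartan subalgebra.

   An integral structure B_c of the core is completed by the nonzero
   chi^m d_theta in D^m with theta integral.  The nonisotropic root spaces of E are
   the L_a^l with a nonzero, where such a derivation acts by an integer multiple of
   chi^m; on an isotropic root vector of B_c it acts through the Leibniz rule,
   since that vector is an integral combination of brackets of nonisotropic ones.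
   B_c spans the whole core because two pairs of root vectors with the same
   bracket in L have brackets in E that differ by an element of the graded dual,
   and these differences span it. *)
Require Import Defs.
From HB Require Import structures.
From mathcomp Require Import all_boot all_order all_algebra.
From mathcomp Require Import finmap complex ring.
From mathcomp Require Import all_classical all_reals all_analysis.

Set Implicit Arguments.
Unset Strict Implicit.
Unset Printing Implicit Defensive.

Import Order.TTheory GRing.Theory Num.Theory.

Local Open Scope classical_set_scope.
Local Open Scope ring_scope.

(** * Spans and direct sums *)

Section Spans.

(** Root spaces of E are given only as eigenspaces, so the position of a root vector has to be read
    off from its eigenvalues. Reducedness makes L_a^0 nonzero for every nonzero root a, so L_0^0
    contains an element acting on each L_b^m by <b, a^v>. These elements separate the roots, and
    injectivity of [ev] separates the degrees. A root of E is isotropic exactly when it vanishes on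
    L_0^0. Adding an isotropic root s to r therefore leaves the values on L_0^0 unchanged; this
    controls the brackets of E_(r+s) with E_(-r) in the definition of an integral structure, where r
    + s is not assumed to be a root.

    An isotropic root space mixes parts of L, of the graded dual and of D, and B_c is known there
    only through its integral span.

    The condition theta(m) = 0 on chi^m d_theta enters twice: it makes derivations skew for the
    form, hence [sigma] equivariant under D, and it makes D^m commute with D^(-m), hence the Cartan
    subalgebra act diagonally. *)

Lemma zspan_subgroup (W : zmodType) (A : set W) : is_subgroup (zspan A).
Proof.
split=> [S [[]]//|u v uA vA S [SS AS]].
by case: (SS) => _; apply; [apply: uA|apply: vA].
Qed.

Lemma zspan_sub (W : zmodType) (A : set W) : A `<=` zspan A.
Proof. exact: sub_gen_smallest. Qed.

Lemma zspan_min (W : zmodType) (A S : set W) :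
  is_subgroup S -> A `<=` S -> zspan A `<=` S.
Proof. exact: smallest_sub. Qed.

Lemma zspanS (W : zmodType) (A B : set W) : A `<=` B -> zspan A `<=` zspan B.
Proof.
by move=> AB; apply: zspan_min (zspan_subgroup _) _ => x /AB; exact: zspan_sub.
Qed.

Lemma subgroupN (W : zmodType) (S : set W) u : is_subgroup S -> S u -> S (- u).
Proof. by move=> [S0 SB] Su; rewrite -sub0r; exact: SB. Qed.

Lemma subgroupD (W : zmodType) (S : set W) u v :
  is_subgroup S -> S u -> S v -> S (u + v).
Proof.
by move=> hS Su Sv; rewrite -[v]opprK; apply: hS.2 => //; exact: subgroupN.
Qed.

Lemma subgroupMn (W : zmodType) (S : set W) u n : is_subgroup S -> S u -> S (u *+ n).
Proof.
move=> hS Su; elim: n => [|n IH]; first by rewrite mulr0n; case: hS.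
by rewrite mulrS; exact: subgroupD.
Qed.

Lemma subgroupMz (W : zmodType) (S : set W) u k : is_subgroup S -> S u -> S (u *~ k).
Proof.
move=> hS Su; case: k => n; first exact: subgroupMn.
by rewrite NegzE mulrNz; apply: subgroupN => //; exact: subgroupMn.
Qed.

Context {K : fieldType} {V : lmodType K}.

Lemma subspace_subgroup (S : set V) : is_subspace S -> is_subgroup S.
Proof.
move=> hS; split; first by case: hS.
by move=> u v Su Sv; apply: subspaceD => //; exact: subspaceN.
Qed.

Lemma subspaceB (S : set V) u v : is_subspace S -> S u -> S v -> S (u - v).
Proof. by move=> hS Su Sv; apply: (subspace_subgroup hS).2. Qed.

Lemma lspanS (A B : set V) : A `<=` B -> lspan A `<=` lspan B.
Proof.
by move=> AB; apply: lspan_min (lspan_subspace _) _ => x /AB; exact: lspan_sub.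
Qed.

Lemma zspan_lspan (A : set V) : zspan A `<=` lspan A.
Proof.
apply: zspan_min; last exact: lspan_sub.
exact/subspace_subgroup/lspan_subspace.
Qed.

Lemma dim_eq1_le1 (S : set V) x : is_subspace S -> dim_le1 S -> S x -> x != 0 ->
  S = line x.
Proof.
move=> hS [e Se] Sx x0; apply/seteqP; split; last first.
  by move=> _ [a _ <-]; exact: subspaceZ.
have [c _ cx] := Se _ Sx.
have c0 : c != 0 by apply: contraNneq x0 => c0; rewrite -cx c0 scale0r.
move=> y /Se[b _ <-]; exists (b / c) => //.
by rewrite -cx scalerA mulfVK.
Qed.

(* Induction on the number of functionals: if g is nonzero on S, normalise v in
   S by g v = 1 and correct f by f v times g. *)
Lemma functional_span (n : nat) (S : set V) (g : 'I_n -> V -> K) (f : V -> K) :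
    is_subspace S ->
    (forall i a u v, S u -> S v -> g i (a *: u + v) = a * g i u + g i v) ->
    (forall a u v, S u -> S v -> f (a *: u + v) = a * f u + f v) ->
    (forall v, S v -> (forall i, g i v = 0) -> f v = 0) ->
  exists c : 'I_n -> K, forall v, S v -> f v = \sum_(i < n) c i * g i v.
Proof.
elim: n S g => [|n IH] S g hS hg hf hgf.
  by exists (fun=> 0) => v Sv; rewrite big_ord0; apply: hgf => // -[].
pose S' := S `&` [set v | g ord_max v = 0].
have hS' : is_subspace S'.
  split=> [|a u v [Su /= gu] [Sv /= gv]].
    split; first by case: hS.
    by have /= := hg ord_max (-1) 0 0 hS.1 hS.1; rewrite scaler0 addr0 mulN1r addNr.
  split; first exact: hS.2.
  by rewrite /= hg // gu gv mulr0 addr0.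
have [|||c hc] := IH S' (fun i => g (widen_ord (leqnSn n) i)) hS'.
- by move=> i a u v [Su _] [Sv _]; exact: hg.
- by move=> a u v [Su _] [Sv _]; exact: hf.
- move=> v [Sv gv] h; apply: hgf => // i.
  case: (unliftP ord_max i) => [j|] ->; last exact: gv.
  rewrite -(h j); congr (g _ v); apply: val_inj => /=.
  by rewrite /bump leqNgt ltn_ord.
have [[v [Sv gv0]]|nov] := pselect (exists v, S v /\ g ord_max v <> 0); last first.
  exists (fun i => if insub (val i) is Some j then c j else 0) => v Sv.
  have gv : g ord_max v = 0 by apply: contrapT => h; apply: nov; exists v.
  rewrite big_ord_recr /= gv mulr0 addr0 hc//; apply: eq_bigr => i _.
  case: insubP => [j _ ji|]; last by rewrite /= ltn_ord.
  by congr (c _ * _); apply: val_inj; rewrite ji.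
pose v1 := (g ord_max v)^-1 *: v.
have Sv1 : S v1 by exact: subspaceZ.
have gv1 : g ord_max v1 = 1.
  have := hg ord_max (g ord_max v)^-1 v 0 Sv hS.1.
  have -> : g ord_max 0 = 0.
    by have := hg ord_max (-1) 0 0 hS.1 hS.1; rewrite scaler0 addr0 mulN1r addNr.
  by rewrite !addr0 mulVf//; exact/eqP.
(* The last coefficient is forced by evaluating at [v1], where the last functional is 1. *)
pose c' (i : 'I_n.+1) := if insub (val i) is Some j then c j else
  f v1 - \sum_(i < n) c i * g (widen_ord (leqnSn n) i) v1.
exists c' => u Su.
pose u' := - g ord_max u *: v1 + u.
have Su' : S u' by exact: hS.2.
have : S' u' by split=> //=; rewrite hg // gv1 mulr1 addNr.
move=> /hc; rewrite hf // => /(canRL (addKr _)) ->.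
rewrite big_ord_recr /= {2}/c' insubF /= ?ltnn//.
rewrite (eq_bigr (fun i => c' (widen_ord (leqnSn n) i) * g (widen_ord (leqnSn n) i) u
   - g ord_max u * (c i * g (widen_ord (leqnSn n) i) v1))); last first.
  move=> i _; rewrite hg // /c'; case: insubP => [j _ ji|]; last by rewrite /= ltn_ord.
  have -> : j = i by apply: val_inj; rewrite ji.
  by rewrite mulrDr mulNr mulrN addrC; congr (_ - _); rewrite mulrCA.
rewrite big_split /= sumrN -mulr_sumr; set s1 := \sum_(i < n) _; set s2 := \sum_(i < n) _.
ring.
Qed.

End Spans.

Section LinearMaps.
Context {K : fieldType} {U V : lmodType K} {f : U -> V}.
Hypothesis lf : linear f.

Lemma lin0 : f 0 = 0.
Proof. by have := lf (-1) 0 0; rewrite scaler0 addr0 scaleN1r addNr. Qed.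

Lemma linD x y : f (x + y) = f x + f y.
Proof. by have := lf 1 x y; rewrite !scale1r. Qed.

Lemma linZ c x : f (c *: x) = c *: f x.
Proof. by have := lf c x 0; rewrite !addr0 lin0 addr0. Qed.

Lemma linN x : f (- x) = - f x.
Proof. by rewrite -scaleN1r linZ scaleN1r. Qed.

Lemma linB x y : f (x - y) = f x - f y.
Proof. by rewrite linD linN. Qed.

Lemma linMz x (n : int) : f (x *~ n) = f x *~ n.
Proof. by rewrite -!scaler_int linZ. Qed.

End LinearMaps.

Section Components.
Context {K : fieldType} {V : lmodType K} {I : choiceType} {S : I -> set V}.
Hypothesis dS : is_direct_sum S.

Lemma component0 i : component S 0 i = 0.
Proof.
by have := component_lin dS (-1) 0 0; rewrite scaler0 addr0 => ->; rewrite scaleN1r addNr.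
Qed.

Lemma componentD x y i : component S (x + y) i = component S x i + component S y i.
Proof. by rewrite -[x in LHS]scale1r (component_lin dS) scale1r. Qed.

Lemma componentB x y i : component S (x - y) i = component S x i - component S y i.
Proof. by rewrite addrC -scaleN1r (component_lin dS) scaleN1r addrC. Qed.

Lemma component_in x i : S i (component S x i).
Proof. by case: (componentP dS x). Qed.

Lemma component_id i x : S i x -> component S x i = x.
Proof. by move=> h; rewrite (component_homog dS h) eqxx. Qed.

Lemma component_neq i j x : S i x -> j != i -> component S x j = 0.
Proof. by move=> h /negbTE ji; rewrite (component_homog dS h) ji. Qed.

(** Its use is to locate eigenvectors: an eigenvector of T has nonzero components only where k takes
    that eigenvalue. *)
Lemma component_diag (T : V -> V) (k : I -> K) : linear T ->
  (forall i x, S i x -> T x = k i *: x) ->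
  forall x i, component S (T x) i = k i *: component S x i.
Proof.
move=> lT hT x i; move: x; apply: (homog_ind dS).
- by rewrite (lin0 lT) component0 scaler0.
- by move=> x y hx hy; rewrite (linD lT) !componentD hx hy scalerDr.
move=> j x Sx; rewrite (hT _ _ Sx).
have [->|ij] := eqVneq i j.
  by rewrite !component_id //; exact: subspaceZ (dS.1 j) Sx.
rewrite (component_neq Sx ij) scaler0 (component_neq (i := j)) //.
exact: subspaceZ (dS.1 j) Sx.
Qed.

Lemma component_eq0 x : (forall i, component S x i = 0) -> x = 0.
Proof.
move=> h; have [_ _ ->] := componentP dS x.
by rewrite fsbig1 // => i _; rewrite h.
Qed.

Lemma component_supp1 j x : (forall i, i != j -> component S x i = 0) -> S j x.
Proof.
move=> h; suff -> : x = component S x j by exact: component_in.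
apply/eqP; rewrite -subr_eq0; apply/eqP/component_eq0 => i.
rewrite componentB; have [->|ij] := eqVneq i j.
  by rewrite (component_id (component_in _ _)) subrr.
by rewrite h // (component_neq (component_in _ _) ij) subrr.
Qed.

Lemma component_neq0 x : x != 0 -> exists i, component S x i != 0.
Proof.
move=> x0; apply: contrapT => h; move/eqP: x0; apply; apply: component_eq0 => i.
by apply: contrapT => /eqP hi; apply: h; exists i.
Qed.

End Components.

(** * Root systems and Lie tori *)

Section RootSystem.
Context {R : realType} {Delta : rootSystem R}.
Implicit Types a b : rs_space Delta.

Lemma root_opp a : a \in rs_roots Delta -> - a \in rs_roots Delta.
Proof.
move=> Da; have [->|a0] := eqVneq a 0; first by rewrite oppr0 rs_zero.
have := rs_reflection Da Da a0; rewrite rs_coroot2 //.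
by rewrite scaler_nat mulr2n opprD addrA subrr sub0r.
Qed.

Lemma nonzero_root_opp a : nonzero_root a -> nonzero_root (- a).
Proof. by move=> [Da a0]; split; [exact: root_opp|rewrite oppr_eq0]. Qed.

(* If a and b have the same pairings with all coroots, s_a s_b translates every
   a + k (a - b) by 2 (a - b), so finiteness of the root system forces a = b. *)
Lemma coroot_separates a b : a \in rs_roots Delta -> b \in rs_roots Delta ->
  (forall c, nonzero_root c -> rs_coroot c a = rs_coroot c b) -> a = b.
Proof.
move=> Da Db h.
have two0 : (2 : R[i]) != 0 by rewrite pnatr_eq0.
have h' c : c \in rs_roots Delta -> c != 0 -> rs_coroot c (a - b) = 0.
  by move=> Dc c0; rewrite linearB /= h ?subrr.
have [a0|a0] := eqVneq a 0.
  have [->//|b0] := eqVneq b 0.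
  have := h b (conj Db b0); rewrite a0 linear0 rs_coroot2 // => e.
  by move: two0; rewrite -e eqxx.
have [b0|b0] := eqVneq b 0.
  have := h a (conj Da a0); rewrite b0 linear0 rs_coroot2 // => e.
  by move: two0; rewrite e eqxx.
apply/eqP; rewrite -subr_eq0; apply/negPn/negP => d0.
have ht c u n : nonzero_root c ->
    rs_coroot c (u + (a - b) *+ n) = rs_coroot c u.
  by move=> [Dc c0]; rewrite linearD linearMn /= h' // mul0rn addr0.
have step k : a + (a - b) *+ (k * 2) \in rs_roots Delta.
  elim: k => [|k IH]; first by rewrite mul0n mulr0n addr0.
  have := rs_reflection Db IH b0.
  rewrite ht // h // rs_coroot2 // => IH2.
  have e1 : a + (a - b) *+ (k * 2) - 2 *: b = - a + (a - b) *+ (k.+1 * 2).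
    rewrite mulSn mulrnDr; set T := (a - b) *+ (k * 2).
    by rewrite scaler_nat mulrnBl (mulr2n a) !addrA addNr add0r addrAC.
  rewrite e1 in IH2; have := rs_reflection Da IH2 a0.
  rewrite ht // linearN /= rs_coroot2 // scaleNr opprK scaler_nat mulr2n.
  by rewrite addrAC addKr.
(* One more translate than there are roots; the translates are distinct because the characteristic
   is zero. *)
pose s := [seq a + (a - b) *+ (k * 2) | k <- iota 0 (size (rs_roots Delta)).+1].
have us : uniq s.
  rewrite map_inj_uniq ?iota_uniq // => i j /addrI /eqP.
  rewrite -subr_eq0 => /eqP e; apply/eqP.
  have : ((i * 2)%:R - (j * 2)%:R : R[i]) *: (a - b) = 0.
    by rewrite scalerBl !scaler_nat.
  move=> /eqP; rewrite scaler_eq0 (negbTE d0) orbF subr_eq0 eqr_nat.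
  by rewrite eqn_pmul2r.
have /(uniq_leq_size us) : {subset s <= rs_roots Delta}.
  by move=> x /mapP[k _ ->]; exact: step.
by rewrite size_map size_iota ltnn.
Qed.

End RootSystem.

(** * Lie tori: weights of L_0^0 and generation *)

Section Torus.
Context {R : realType} {Lambda : zmodType} {Delta : rootSystem R}.
Variable L : lieTorus Delta Lambda.
Local Notation C := R[i].
Local Notation "[ x , y ]" := (lt_br x y).
Implicit Types (x y z : L) (a b : rs_space Delta) (l m : Lambda).

Lemma br_linl y : linear (fun x => [x, y] : L).
Proof. by case: (lt_lie L) => h _ _ _; exact: h. Qed.

Lemma br_linr x : linear (fun y => [x, y] : L).
Proof. by case: (lt_lie L) => _ h _ _; exact: h. Qed.

Lemma br_skew x y : [x, y] = - [y, x].
Proof.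
have [_ _ h _] := lt_lie L; have := h (x + y).
rewrite (linD (br_linl _)) !(linD (br_linr _)) !h add0r addr0 => /eqP.
by rewrite addr_eq0 => /eqP.
Qed.

Lemma gr_subspace a l : is_subspace (lt_gr a l : set L).
Proof. exact: ((lt_direct L).1 (a, l)). Qed.

Lemma lam_subspace l : is_subspace (lam_gr (L := L) l).
Proof. exact: lspan_subspace. Qed.

Lemma gr_out a l x : a \notin rs_roots Delta -> lt_gr a l x -> x = 0.
Proof. by move=> aD; rewrite (lt_gr_out _ _ aD). Qed.

Lemma gr_line a l x y : nonzero_root a -> lt_gr a l x -> x != 0 -> lt_gr a l y ->
  exists c : C, y = c *: x.
Proof.
move=> ha lx x0; rewrite (dim_eq1_le1 (gr_subspace a l) (lt_dim_le1 L l ha) lx x0).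
by move=> [c _ <-]; exists c.
Qed.

(** The axiom gives a triple for some e in the line L_a^l only; when e = c x, multiplying f by c
    moves the scalar from e to f. *)
Lemma sl2_triple a l x : nonzero_root a -> lt_gr a l x -> x != 0 ->
  exists f, [/\ lt_gr (- a) (- l) f, f != 0 &
    forall b m y, lt_gr b m y -> [[x, f], y] = rs_coroot a b *: y].
Proof.
move=> ha lx x0.
have ex := dim_eq1_le1 (gr_subspace a l) (lt_dim_le1 L l ha) lx x0.
have [e [f [[le e0] [lf f0] h]]] := lt_sl2 ha (ex_intro2 _ _ x x0 ex).
have [c ec] := gr_line ha lx x0 le.
have c0 : c != 0 by apply: contraNneq e0 => c0; rewrite ec c0 scale0r.
exists (c *: f); split.
- exact: subspaceZ (gr_subspace _ _) lf.
- by rewrite scaler_eq0 negb_or c0.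
move=> b m y ly; have [Db|Db] := boolP (b \in rs_roots Delta); last first.
  by rewrite (gr_out Db ly) scaler0 (lin0 (br_linr _)).
by rewrite (linZ (br_linr _)) -(linZ (br_linl _)) -ec; exact: h Db ly.
Qed.

(** If half of a were a root, its double a could not be one in a reduced system; so the axiom on the
    dimension of L_a^0 applies to every nonzero root. *)
Lemma gr_neq0 a : reduced Delta -> nonzero_root a ->
  exists2 x : L, lt_gr a 0 x & x != 0.
Proof.
move=> red ha; have [|x x0 ex] := lt_dim_eq1 L ha.
  apply/negP => h2; have : nonzero_root ((2^-1 : C) *: a).
    by split => //; rewrite scaler_eq0 negb_or invr_eq0 pnatr_eq0; case: ha.
  move=> /red; rewrite -scaler_nat scalerA divff ?pnatr_eq0 // scale1r.
  by case: ha => ->.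
by exists x => //; rewrite ex; exists 1 => //; rewrite scale1r.
Qed.

(** These are the test elements by which L_0^0 tells roots apart. *)
Lemma coroot_elt a : reduced Delta -> nonzero_root a ->
  exists2 t : L, lt_gr 0 0 t &
    forall b m y, lt_gr b m y -> [t, y] = rs_coroot a b *: y.
Proof.
move=> red ha; have [x lx x0] := gr_neq0 red ha.
have [f [lf _ h]] := sl2_triple ha lx x0.
exists [x, f] => //; have := lt_graded lx lf.
by rewrite !subrr.
Qed.

Lemma br_weight a l x y : nonzero_root a -> lt_gr a l x ->
  lt_gr (- a) (- l) y -> exists c : C, forall d n z, lt_gr d n z ->
    [[x, y], z] = c * rs_coroot a d *: z.
Proof.
move=> ha lx ly; have [->|x0] := eqVneq x 0.
  exists 0 => d n z _; by rewrite !(lin0 (br_linl _)) mul0r scale0r.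
have [f [lf f0 h]] := sl2_triple ha lx x0.
have [c ->] := gr_line (nonzero_root_opp ha) lf f0 ly.
exists c => d n z lz.
by rewrite (linZ (br_linr _)) (linZ (br_linl _)) (h _ _ _ lz) scalerA.
Qed.

(** L_0^0 is spanned by brackets of opposite pieces, and each such bracket acts through a multiple
    of a coroot, whatever the degree in Lambda. *)
Lemma cartan_weight t : lt_gr 0 0 t -> exists w : {scalar rs_space Delta},
  forall b m y, lt_gr b m y -> [t, y] = w b *: y.
Proof.
rewrite lt_core => h.
suff : [set t : L | exists w : {scalar rs_space Delta},
    forall b m y, lt_gr b m y -> [t, y] = w b *: y] t by [].
move: t h; apply: lspan_min.
  split; first by exists \0%R => b m y _; rewrite (lin0 (br_linl _)) scale0r.
  move=> c u v [w hw] [w' hw'].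
  exists (c \*: w \+ w') => b m y ly.
  by rewrite (br_linl _ c u v) (hw _ _ _ ly) (hw' _ _ _ ly) scalerA -scalerDl.
move=> _ [[a l] /= ha] [x [y [lx ly ->]]]; rewrite sub0r in ly.
have [c hc] := br_weight ha lx ly.
exists (c \*: rs_coroot a) => d n z lz; exact: hc lz.
Qed.

Lemma torus_gen (S : set L) : is_subspace S ->
  (forall a l x, nonzero_root a -> lt_gr a l x -> S x) ->
  (forall a l m x y, nonzero_root a -> lt_gr a l x -> lt_gr (- a) m y -> S [x, y]) ->
  forall x, S x.
Proof.
move=> hS h1 h2; apply: (homog_ind (lt_direct L)) => [|x y Sx Sy|[a l] x /= lx].
- by case: hS.
- exact: subspaceD.
have [a0|a0] := eqVneq a 0; last first.
  have [Da|Da] := boolP (a \in rs_roots Delta); first exact: (h1 a l).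
  by rewrite (gr_out Da lx); case: hS.
move: lx; rewrite a0 lt_core; move: x; apply: lspan_min => //.
by move=> _ [[b m] /= hb] [y [z [ly lz ->]]]; exact: h2 ly lz.
Qed.

(** A nonzero x in L_a^l, a nonzero, is half of [[x, f], x] for its sl2 triple; the pieces L_0^l are
    spanned by brackets already. *)
Lemma torus_perfect (S : set L) : is_subspace S -> (forall x y, S [x, y]) ->
  forall x, S x.
Proof.
move=> hS h; apply: torus_gen => // a l x ha lx.
have [->|x0] := eqVneq x 0; first by case: hS.
have [f [lf f0 /(_ _ _ _ lx)]] := sl2_triple ha lx x0.
rewrite rs_coroot2; [|by case: ha..].
move=> /(congr1 (fun y => (2^-1 : C) *: y)); rewrite scalerA mulVf ?pnatr_eq0 // scale1r => <-.
exact: subspaceZ.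
Qed.

(** A nonzero L_0^l contains a nonzero bracket of opposite pieces of nonzero root, so l is a sum of
    two degrees occurring at nonzero roots. *)
Lemma Lambda_gen (S : set Lambda) : is_subgroup S ->
  (forall a l x, nonzero_root a -> lt_gr (l0 := L) a l x -> x != 0 -> S l) ->
  forall l, S l.
Proof.
move=> hS h l; have : zspan [set l | exists2 a, a \in rs_roots Delta &
  lt_gr (l0 := L) a l <> [set 0]] l by rewrite lt_full.
apply: zspan_min => // {}l [a Da al].
have {al} [x lx x0] : exists2 x : L, lt_gr a l x & x != 0.
  apply: contrapT => hx; apply: al; apply/seteqP; split=> [x lx /=|x /= ->].
    by apply: contrapT => /eqP x0; apply: hx; exists x.
  by case: (gr_subspace a l).
have [a0|a0] := eqVneq a 0; last exact: h lx x0.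
apply: contrapT => nS; move/eqP: x0; apply.
move: lx; rewrite a0 lt_core; move: x; apply: lspan_min.
  by split=> // c u v /= -> ->; rewrite scaler0 addr0.
move=> _ [[b m] /= hb] [y [z [ly lz ->]]].
have [->|y0] := eqVneq y 0; first by rewrite /= (lin0 (br_linl _)).
have [->|z0] := eqVneq z 0; first by rewrite /= (lin0 (br_linr _)).
exfalso; apply: nS.
have := subgroupD hS (h _ _ _ hb ly y0) (h _ _ _ (nonzero_root_opp hb) lz z0).
by rewrite addrC subrK.
Qed.

Lemma degree_derivation_inj (theta psi : {additive Lambda -> C}) :
  degree_derivation (L := L) theta = degree_derivation psi -> theta =1 psi.
Proof.
move=> e; apply: Lambda_gen.
  split=> [|u v /= hu hv]; first by rewrite /= !raddf0.
  by rewrite !raddfB hu hv.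
move=> a l x ha lx x0; have := congr1 (fun d => d x) e.
rewrite !(degree_derivationE _ (lam_gr_homog lx)) => /eqP.
by rewrite -subr_eq0 -scalerBl scaler_eq0 (negbTE x0) orbF subr_eq0 => /eqP.
Qed.

Lemma component_lam l y (p : rs_space Delta * Lambda) : lam_gr l y ->
  p.2 != l -> component (@torus_gr _ _ _ L) y p = 0.
Proof.
move=> ly pl; move: y ly.
have dS : is_direct_sum (@torus_gr _ _ _ L) := lt_direct L.
apply: (lspan_min (S := [set y | component (@torus_gr _ _ _ L) y p = 0])).
  split; first exact: component0.
  by move=> c u v /= hu hv; rewrite (component_lin dS) hu hv scaler0 addr0.
move=> x [a _ lx] /=; apply: (component_neq dS (i := (a, l))) => //.
by apply: contraNneq pl => ->.
Qed.

(* Distinct roots are distinct weights of L_0^0. *)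
Lemma weight_gr a n y : reduced Delta -> a \in rs_roots Delta -> lam_gr n y ->
  (forall t (w : {scalar rs_space Delta}), lt_gr 0 0 t ->
     (forall b m z, lt_gr b m z -> [t, z] = w b *: z) -> [t, y] = w a *: y) ->
  lt_gr a n y.
Proof.
move=> red Da ly h.
have dS : is_direct_sum (@torus_gr _ _ _ L) := lt_direct L.
apply: (component_supp1 dS (j := (a, n))) => -[b m] bm.
have [emn|mn] := eqVneq m n; last exact: (component_lam (p := (b, m)) ly mn).
subst m; have ba : b != a by apply: contraNneq bm => ->.
have [Db|Db] := boolP (b \in rs_roots Delta); last first.
  exact: (gr_out Db (component_in dS y (b, n))).
apply/eqP/negPn/negP => yb; move/eqP: ba; apply.
apply: coroot_separates => // c hc.
have [t t0 ht] := coroot_elt red hc.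
have := component_diag dS (k := fun p => rs_coroot c p.1) (br_linr t)
  (fun p x lx => ht _ _ _ lx) y (b, n).
rewrite (h t (rs_coroot c) t0 ht).
have := component_lin dS (rs_coroot c a) y 0; rewrite addr0 => ->.
rewrite component0 // addr0 => /eqP; rewrite -subr_eq0 -scalerBl scaler_eq0 (negbTE yb).
by rewrite orbF subr_eq0 => /eqP ->.
Qed.

(** An element of the centroid commutes with the action of L_0^0, hence preserves its weights, which
    determine the root. *)
Lemma centroid_gr (f : L -> L) a l n x : reduced Delta ->
  in_centroid (@lt_br _ _ _ L) f ->
  lt_gr a l x -> lam_gr n (f x) -> lt_gr a n (f x).
Proof.
move=> red [lf hf] lx lfx.
have [Da|Da] := boolP (a \in rs_roots Delta); last first.
  by rewrite (gr_out Da lx) (lin0 lf); case: (gr_subspace a n).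
apply: weight_gr => // t w _ hw.
by rewrite -(hf t x).2 (hw _ _ _ lx) (linZ lf).
Qed.

(** * The invariant form on a Lie torus *)

Section Form.
Variable form : gradedForm L.

Lemma form_linl y : linear (fun x => form x y : C^o).
Proof. exact: (gf_linear form). Qed.

Lemma form_linr x : linear (fun y => form x y : C^o).
Proof. by move=> c u v; rewrite !(gf_sym form x); exact: (gf_linear form). Qed.

Lemma gform0l y : form 0 y = 0. Proof. exact: (lin0 (form_linl y)). Qed.
Lemma gform0r x : form x 0 = 0. Proof. exact: (lin0 (form_linr x)). Qed.
Lemma gformDl x x' y : form (x + x') y = form x y + form x' y.
Proof. exact: (linD (form_linl y)). Qed.
Lemma gformDr x y y' : form x (y + y') = form x y + form x y'.
Proof. exact: (linD (form_linr x)). Qed.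
Lemma gformNl x y : form (- x) y = - form x y. Proof. exact: (linN (form_linl y)). Qed.
Lemma gformNr x y : form x (- y) = - form x y. Proof. exact: (linN (form_linr x)). Qed.
Lemma gformZl c x y : form (c *: x) y = c * form x y.
Proof. exact: (linZ (form_linl y)). Qed.
Lemma gformZr c x y : form x (c *: y) = c * form x y.
Proof. exact: (linZ (form_linr x)). Qed.

Lemma form_weight t x y (c d : C) : [t, x] = c *: x -> [t, y] = d *: y ->
  (c + d) * form x y = 0.
Proof.
move=> hx hy; rewrite mulrDl -gformZl -gformZr -hx -hy br_skew gformNl.
by rewrite (gf_invariant form) addNr.
Qed.

(** The form is assumed graded by Lambda only. The root part follows because the test elements act
    skewly and separate roots. *)
Lemma form_graded a b l m x y : reduced Delta -> lt_gr a l x -> lt_gr b m y ->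
  form x y != 0 -> b = - a /\ m = - l.
Proof.
move=> red lx ly xy.
have [Da|Da] := boolP (a \in rs_roots Delta); last first.
  by move: xy; rewrite (gr_out Da lx) gform0l eqxx.
have [Db|Db] := boolP (b \in rs_roots Delta); last first.
  by move: xy; rewrite (gr_out Db ly) gform0r eqxx.
split; last first.
  apply/eqP; rewrite -addr_eq0; apply/negPn/negP => lm; move/eqP: xy; apply.
  by apply: (gf_graded form (l := l) (m := m));
    [rewrite addrC|exact: lam_gr_homog lx|exact: lam_gr_homog ly].
apply: coroot_separates => //; first exact: root_opp.
move=> c hc; have [t _ ht] := coroot_elt red hc.
have /eqP := form_weight (ht _ _ _ lx) (ht _ _ _ ly).
by rewrite mulf_eq0 (negbTE xy) orbF addrC addr_eq0 linearN /= => /eqP.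
Qed.

Lemma form_dual a l x : reduced Delta -> lt_gr a l x -> x != 0 ->
  exists2 y, lt_gr (- a) (- l) y & form x y != 0.
Proof.
move=> red lx x0; apply: contrapT => h; move/eqP: x0; apply.
apply: (gf_nondeg (g := form)) => y; move: y; apply: (homog_ind (lt_direct L)).
- exact: gform0r.
- by move=> y z hy hz; rewrite gformDr hy hz addr0.
move=> [b m] y /= ly; apply: contrapT => /eqP xy; apply: h.
have [eb em] := form_graded red lx ly xy.
by exists y => //; rewrite -eb -em.
Qed.

Lemma form_neq0 a l x f : reduced Delta -> nonzero_root a ->
  lt_gr a l x -> x != 0 -> lt_gr (- a) (- l) f -> f != 0 -> form x f != 0.
Proof.
move=> red ha lx x0 lf f0; have [y ly xy] := form_dual red lx x0.
have [c e] := gr_line (nonzero_root_opp ha) lf f0 ly.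
by apply: contraNneq xy => h; rewrite e gformZr h mulr0.
Qed.

(** L is perfect; on a bracket [x, z], f can be passed from one factor to the other and, by
    invariance, across the form. *)
Lemma centroid_form (f : L -> L) : in_centroid (@lt_br _ _ _ L) f ->
  forall x y, form (f x) y = form x (f y).
Proof.
move=> [lf hf] x y; move: x; apply: torus_perfect.
  split=> [|c u v hu hv]; first by rewrite /= (lin0 lf) !gform0l.
  by rewrite /= lf !(gformDl, gformZl) hu hv.
move=> x z /=.
by rewrite (hf x z).1 !(gf_invariant form) -(hf z y).2 -(gf_invariant form) -(hf x z).1
  (hf x z).2 (gf_invariant form) (hf z y).1.
Qed.

End Form.

End Torus.

(** * Characters and the centroid *)

Section CharacterSqrt.
Context {C : numClosedFieldType} {M : zmodType}.
Implicit Types (S : set M) (c b : M -> C).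

Definition character_on S c : Prop :=
  (forall x y, S x -> S y -> c (x + y) = c x * c y) /\ forall x, S x -> c x != 0.

Lemma character0 S c : is_subgroup S -> character_on S c -> c 0 = 1.
Proof.
move=> [S0 _] [cD cn]; apply: (mulfI (cn _ S0)).
by rewrite -cD // addr0 mulr1.
Qed.

Lemma characterN S c x : is_subgroup S -> character_on S c -> S x -> c (- x) = (c x)^-1.
Proof.
move=> hS hc Sx; case: (hc) => cD cn; apply: (mulfI (cn _ Sx)).
rewrite -cD //; last exact: subgroupN.
by rewrite subrr (character0 hS hc) divff // cn.
Qed.

Lemma characterMz S c x (k : int) : is_subgroup S -> character_on S c -> S x ->
  c (x *~ k) = c x ^ k.
Proof.
move=> hS hc Sx; case: (hc) => cD cn.
have h n : c (x *+ n) = c x ^+ n.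
  elim: n => [|n IH]; first by rewrite mulr0n expr0 (character0 hS hc).
  rewrite mulrS exprS cD ?IH //; exact: subgroupMn.
case: k => n; first by rewrite -pmulrn h.
rewrite NegzE mulrNz (characterN hS hc) -?pmulrn ?h -?exprnN //.
exact: subgroupMn.
Qed.

(* Induction on the number of coordinates: the last coordinate maps S onto a
   cyclic group, which splits off the kernel. *)
Lemma character_sqrt (n : nat) (phi : 'I_n -> M -> int) S c :
    is_subgroup S -> (forall i, zmod_morphism (phi i)) ->
    (forall x, S x -> (forall i, phi i x = 0) -> x = 0) ->
    character_on S c ->
  exists b, character_on S b /\ forall x, S x -> b x ^+ 2 = c x.
Proof.
elim: n phi S => [|n IH] phi S hS hphi hinj hc.
  exists (fun=> 1); split; first by split=> *; rewrite ?mulr1 ?oner_neq0.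
  move=> x Sx; rewrite (hinj x Sx) ?expr1n ?(character0 hS hc) // => -[] //.
pose p := phi ord_max.
have pB x y : p (x - y) = p x - p y by exact: hphi.
have p0 : p 0 = 0 by rewrite -(subrr 0) pB subrr.
have pD x y : p (x + y) = p x + p y.
  by rewrite -{1}[y]opprK pB -(sub0r y) pB p0 sub0r opprK.
have pMz x k : p (x *~ k) = k * p x.
  have pMn m : p (x *+ m) = m%:Z * p x.
    elim: m => [|m Im]; first by rewrite mulr0n p0 mul0r.
    by rewrite mulrS pD Im intS mulrDl mul1r.
  case: k => m; first by rewrite -pmulrn pMn.
  by rewrite NegzE mulrNz -sub0r pB p0 sub0r -pmulrn pMn mulNr.
pose S' := S `&` [set x | p x = 0].
have hS' : is_subgroup S'.
  split=> [|u v [Su pu] [Sv pv]]; first by split; [case: hS|].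
  by split; [exact: hS.2|rewrite /= pB pu pv].
have [|||b' [[bD bn] b2]] := IH (fun i => phi (widen_ord (leqnSn n) i)) S' hS'.
- by move=> i; exact: hphi.
- move=> x [Sx px] h; apply: hinj => // i; case: (unliftP ord_max i) => [j|] -> //.
  rewrite -(h j); congr (phi _ x); apply: val_inj => /=.
  by rewrite /bump leqNgt ltn_ord.
- by case: hc => cD cn; split=> [x y [Sx _] [Sy _]|x [Sx _]]; [exact: cD|exact: cn].
have [[x0 Sx0 px0]|nox] := pselect (exists2 x, S x & p x <> 0); last first.
  have SS' x : S x -> S' x.
    by move=> Sx; split=> //; apply: contrapT => h; apply: nox; exists x.
  exists b'; split; first by split=> [x y /SS' ? /SS'|x /SS'] ?; [exact: bD|exact: bn].
  by move=> x /SS'; exact: b2.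
(* The least positive value d of the last coordinate on S generates all its values there; g is an
   element of S where it is attained. *)
pose P k := `[< (0 < k)%N /\ exists2 g, S g & p g = k%:Z >].
have exP : exists k, P k.
  exists `|p x0|%N; apply/asboolP; split; first by rewrite absz_gt0; exact/eqP.
  have [h|h] := leP 0 (p x0); first by exists x0 => //; rewrite gez0_abs.
  exists (- x0); first exact: subgroupN.
  by rewrite -sub0r pB p0 sub0r ltz0_abs.
have [d /asboolP[d0 [g Sg pg]] dmin] := ex_minnP exP.
have dvd x : S x -> p x = (p x %/ d%:Z)%Z * d%:Z.
  move=> Sx; rewrite {1}(divz_eq (p x) d%:Z).
  suff -> : (p x %% d%:Z)%Z = 0 by rewrite addr0.
  have r0 : (0 <= (p x %% d%:Z)%Z) by rewrite modz_ge0 // -lt0n.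
  have rd : ((p x %% d%:Z)%Z < d%:Z) by rewrite ltz_pmod.
  apply: contrapT => h.
  have : P `|(p x %% d%:Z)%Z|%N.
    apply/asboolP; split; first by rewrite absz_gt0; exact/eqP.
    exists (x - g *~ (p x %/ d%:Z)%Z).
      by apply: hS.2 => //; exact: subgroupMz.
    by rewrite pB pMz pg gez0_abs // {1}(divz_eq (p x) d%:Z) addrC addKr.
  by move/dmin; rewrite leqNgt -ltz_nat gez0_abs // rd.
pose q x := (p x %/ d%:Z)%Z.
have dZ : d%:Z != 0 by rewrite -lt0n.
have qD x y : S x -> S y -> q (x + y) = q x + q y.
  move=> Sx Sy; rewrite /q pD (dvd _ Sx) (dvd _ Sy) -mulrDl.
  by rewrite !mulzK.
have S'q x : S x -> S' (x - g *~ q x).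
  move=> Sx; split; first by apply: hS.2 => //; exact: subgroupMz.
  by rewrite /= pB pMz pg {1}(dvd _ Sx) subrr.
(* S is the direct sum of S' and the free group on g, so either square root of c(g) may be
   prescribed at g. *)
pose s := sqrtC (c g).
have s0 : s != 0 by rewrite sqrtC_eq0; exact: hc.2.
exists (fun x => b' (x - g *~ q x) * s ^ q x); split; first split.
- move=> x y Sx Sy; rewrite qD // expfzDr // mulrACA -bD; [|exact: S'q..].
  by rewrite mulrzDr opprD addrACA.
- by move=> x Sx; rewrite mulf_neq0 ?expfz_neq0 // bn //; exact: S'q.
move=> x Sx; rewrite exprMn b2; last exact: S'q.
have -> : (s ^ q x) ^+ 2 = c g ^ q x.
  by rewrite exprnP exprz_exp mulrC -exprz_exp -exprnP sqrtCK.
rewrite -(characterMz _ hS hc Sg) -hc.1 ?subrK //; first by case: (S'q x Sx).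
exact: subgroupMz.
Qed.

End CharacterSqrt.

Lemma free_coordinates (M : zmodType) : free_of_finite_rank M ->
  exists n (phi : 'I_n -> M -> int), (forall i, zmod_morphism (phi i)) /\
    forall x, (forall i, phi i x = 0) -> x = 0.
Proof.
move=> [n [e h]]; exists n.
have [co hco] := choice (fun x => h x).
exists (fun i x => co x i); split; last first.
  move=> x hx; rewrite (hco x).1 big1 // => i _; by rewrite hx mulr0z.
move=> i x y; have -> : co (x - y) = [ffun j => co x j - co y j].
  case: (hco (x - y)) => _; apply.
  under eq_bigr => j _ do rewrite ffunE mulrzBr.
  by rewrite sumrB -(hco x).1 -(hco y).1.
by rewrite ffunE.
Qed.

(** * Homogeneous elements of the centroid *)

Section Centroid.
Context {R : realType} {Lambda : zmodType} {Delta : rootSystem R}.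
Context {L : lieTorus Delta Lambda}.
Local Notation C := R[i].
Implicit Types (x y z : L) (a b : rs_space Delta) (l m n : Lambda).

Local Notation S := (@torus_gr _ _ _ L).

(** The terms have distinct degrees, so only F m contributes to the degree of x. This extracts one
    term from the expansion of a homogeneous centroid element. *)
Lemma finsum_single (A : set Lambda) (F : Lambda -> L) l m x : finite_set A ->
  (forall n, lam_gr (l + n) (F n)) -> (forall n, ~ A n -> F n = 0) ->
  lam_gr (l + m) x -> x = \sum_(n <- fset_set A) F n -> x = F m.
Proof.
move=> fA hF F0 lx ex; have dS : is_direct_sum S := lt_direct L.
apply/eqP; rewrite -subr_eq0; apply/eqP/(component_eq0 dS) => p.
rewrite (componentB dS); have [e|pl] := eqVneq p.2 (l + m); last first.
  by rewrite (component_lam lx pl) (component_lam (hF m) pl) subrr.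
rewrite ex (big_morph (fun y => component S y p) (id1 := 0) (op1 := +%R)); last first.
- exact: component0.
- by move=> u v; exact: componentD.
have z n : n != m -> component S (F n) p = 0.
  move=> nm; apply: (component_lam (hF n)); rewrite e.
  by rewrite (inj_eq (addrI l)) eq_sym.
have [Am|Am] := pselect (A m).
  rewrite (big_fsetD1 m) /=; last by rewrite in_fset_set // inE.
  rewrite big_seq big1 ?addr0 ?subrr // => n.
  by rewrite !inE => /andP[nm _]; exact: z.
rewrite (F0 _ Am) component0 // subr0 big_seq big1 // => n.
rewrite in_fset_set // inE => An; apply: z.
by apply: contra_not_neq Am => <-.
Qed.

Section Chi.
Variable cb : centroidBasis L.
Local Notation Gamma := (cb_Gamma cb).
Local Notation chi := (cb_chi cb).

Lemma GammaN m : Gamma m -> Gamma (- m).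
Proof. exact: subgroupN (cb_subgroup cb). Qed.

(** If chi^m vanished, both the zero family and the indicator of m would expand the zero
    endomorphism, against uniqueness of coefficients. *)
Lemma chi_neq0 m : Gamma m -> exists x, chi m x != 0.
Proof.
move=> Gm; apply: contrapT => h.
have chi0 : chi m = 0.
  apply/funext => x; apply: contrapT => /eqP hx; apply: h; by exists x.
have cz : in_centroid (@lt_br _ _ _ L) (fun=> 0).
  split=> [a x y|x y]; first by rewrite scaler0 addr0.
  by rewrite (lin0 (br_linl _)) (lin0 (br_linr _)).
have [c [_ uc]] := cb_basis cb cz.
have c0 : c = fun=> 0.
  apply: uc; split.
  - by apply: (sub_finite_set _ (finite_set0 _)) => k /=; rewrite eqxx.
  - by move=> k; rewrite eqxx.
  - by rewrite fsbig1 // => k _; rewrite scale0r.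
have : c = fun k => (k == m)%:R.
  apply: uc; split.
  - apply: (sub_finite_set _ (finite_set1 m)) => k /=.
    by have [->//|_] := eqVneq k m; rewrite eqxx.
  - by move=> k; have [->//|_] := eqVneq k m; rewrite eqxx.
  - rewrite fsbig1 // => k _; have [->|_] := eqVneq k m; last by rewrite scale0r.
    by rewrite chi0 scaler0.
move=> /(congr1 (fun f => f m)); rewrite c0 eqxx => /eqP.
by rewrite eq_sym oner_eq0.
Qed.

(** Comparison of degrees in the expansion of f. Outside Gamma the maps [chi] are arbitrary and
    possibly not linear, whence the case splits on vanishing coefficients. *)
Lemma centroid_homog m (f : L -> L) : in_centroid (@lt_br _ _ _ L) f ->
  (forall l x, lam_gr l x -> lam_gr (l + m) (f x)) ->
  exists c : C, (c != 0 -> Gamma m) /\ forall x, f x = c *: chi m x.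
Proof.
move=> cf df; have [c [[fc cG ef] _]] := cb_basis cb cf.
exists (c m); split; first exact: cG.
have lin_n n : c n != 0 -> linear (chi n) by move=> /cG; exact: chi_linear.
have lf : linear f by case: cf.
apply: lam_gr_ind.
- rewrite (lin0 lf); have [->|cm] := eqVneq (c m) 0; first by rewrite scale0r.
  by rewrite (lin0 (lin_n _ cm)) scaler0.
- move=> x y hx hy; rewrite (linD lf) hx hy.
  have [->|cm] := eqVneq (c m) 0; first by rewrite !scale0r addr0.
  by rewrite (linD (lin_n _ cm)) scalerDr.
move=> l x lx.
apply: (finsum_single (A := [set m | c m != 0]) (F := fun n => c n *: chi n x) fc).
- move=> n; have [->|cn] := eqVneq (c n) 0; first by rewrite scale0r; exact: (lam_subspace L _).1.
  apply: (subspaceZ _ (lam_subspace L _)).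
  exact: cb_degree (cG _ cn) lx.
- by move=> n /= /negP/negPn/eqP ->; rewrite scale0r.
- exact: df.
rewrite {1}ef (fsbigTE (fset_set [set m | c m != 0])); last first.
  move=> n; rewrite in_fset_set // notin_setE /= => /negP/negPn/eqP ->.
  by rewrite scale0r.
by rewrite fct_sumE.
Qed.

(** The identity lies in the centroid in degree 0, so it is a multiple of chi^0, and chi^0 is
    idempotent. *)
Lemma chi0 x : chi 0 x = x.
Proof.
have G0 : Gamma 0 by case: (cb_subgroup cb).
have [|l y ly|c [_ hc]] := centroid_homog (m := 0) (f := id).
- by split=> // u v.
- by rewrite addr0.
have e y : chi 0 (chi 0 y) = chi 0 y.
  by have /(congr1 (fun f => f y)) /= := cb_mul G0 G0; rewrite addr0.
by rewrite [in RHS](hc x) -[in LHS]e -[X in _ *: X]e -(hc (chi 0 x)) e.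
Qed.

Lemma chiD m n x : Gamma m -> Gamma n -> chi m (chi n x) = chi (m + n) x.
Proof. by move=> Gm Gn; have /(congr1 (fun f => f x)) := cb_mul Gm Gn. Qed.

Lemma chiNK m x : Gamma m -> chi (- m) (chi m x) = x.
Proof. by move=> Gm; rewrite chiD ?addNr ?chi0 //; exact: GammaN. Qed.

Lemma chiKN m x : Gamma m -> chi m (chi (- m) x) = x.
Proof. by move=> Gm; rewrite chiD ?subrr ?chi0 //; exact: GammaN. Qed.

Lemma chi_eq0 m x : Gamma m -> (chi m x == 0) = (x == 0).
Proof.
move=> Gm; apply/eqP/eqP => [h|->]; last exact: (lin0 (chi_linear Gm)).
by rewrite -(chiNK x Gm) h (lin0 (chi_linear (GammaN Gm))).
Qed.

Lemma chi_gr a l m x : reduced Delta -> Gamma m -> lt_gr a l x ->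
  lt_gr a (l + m) (chi m x).
Proof.
move=> red Gm lx; apply: (centroid_gr red (cb_centroid Gm) lx).
exact: cb_degree Gm (lam_gr_homog lx).
Qed.

End Chi.
End Centroid.

(** * Chevalley involutions of a Lie torus *)

Section Chevalley.
Context {R : realType} {Lambda : zmodType} {Delta : rootSystem R}.
Context {L : lieTorus Delta Lambda}.
Local Notation C := R[i].
Implicit Types (x y z : L) (a b : rs_space Delta) (l m n : Lambda).
Local Notation "[ x , y ]" := (lt_br x y).

Lemma chevalley_inverse (tau : L -> L) : chevalley_involution tau ->
  exists g, [/\ cancel tau g, cancel g tau & chevalley_involution g].
Proof.
move=> [[lt [g gK tK] tbr] [n n0 tn] tl t0]; exists g; split=> //; split.
- split.
  + by move=> c x y; rewrite -{1}[x]tK -{1}[y]tK -lt gK.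
  + by exists tau.
  + by move=> x y; rewrite -{1}[x]tK -{1}[y]tK -tbr gK.
- exists n => // x; have h k z : iter k g (iter k tau z) = z.
    elim: k z => // k IH z; by rewrite iterSr iterS gK IH.
  by rewrite -{1}[x]tn h.
- move=> l; apply/seteqP; split=> [_ [x lx <-]|x lx].
    by move: lx; rewrite -[l]opprK -tl => -[y ly <-]; rewrite gK opprK.
  exists (tau x); last by rewrite gK.
  by rewrite -[l]opprK -tl; exists x.
- by move=> h h0; rewrite -[h in LHS]opprK -(t0 _ h0) -(linN lt) gK t0.
Qed.

Lemma chevalley_linear (tau : L -> L) : chevalley_involution tau -> linear tau.
Proof. by case=> -[]. Qed.

Lemma chevalley_br (tau : L -> L) x y : chevalley_involution tau ->
  tau [x, y] = [tau x, tau y].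
Proof. by case=> -[]. Qed.

Lemma chevalley_lam (tau : L -> L) l x : chevalley_involution tau ->
  lam_gr l x -> lam_gr (- l) (tau x).
Proof. by case=> _ _ <- _ lx; exists x. Qed.

Lemma chevalley_derivation (tau : L -> L) theta x : chevalley_involution tau ->
  tau (degree_derivation theta x) = - degree_derivation theta (tau x).
Proof.
move=> ct; have lt := chevalley_linear ct; 
have dl : linear (degree_derivation (L := L) theta) by exact: degree_derivation_linear.
move: x; apply: lam_gr_ind.
- by rewrite (lin0 dl) (lin0 lt) (lin0 dl) oppr0.
- move=> x y hx hy.
  by rewrite (linD dl) (linD lt) hx hy (linD lt) (linD dl) opprD.
move=> l x lx; rewrite (degree_derivationE _ lx) (linZ lt).
by rewrite (degree_derivationE _ (chevalley_lam ct lx)) raddfN /= scaleNr opprK.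
Qed.

(* The difference (tau x, tau y) - (x, y) is an invariant form whose radical
   contains L_0^0, hence the root vectors, since these are eigenvectors of
   L_0^0 for nonzero eigenvalues, hence everything. *)
Lemma chevalley_form (tau : L -> L) (form : gradedForm L) x y :
  reduced Delta -> chevalley_involution tau -> form (tau x) (tau y) = form x y.
Proof.
move=> red ct; have lt := chevalley_linear ct.
have subspace_l u : is_subspace [set v | form (tau v) (tau u) = form v u].
  split=> [|c v w /= hv hw]; first by rewrite /= (lin0 lt) !gform0l.
  by rewrite lt !gformDl !gformZl hv hw.
have h0 t u : lt_gr 0 0 t -> form (tau t) (tau u) = form t u.
  move=> lt0; case: (ct) => _ _ _ h; rewrite (h t lt0) gformNl.
  move: u; apply: (homog_ind (lt_direct L)).
  - by rewrite (lin0 lt) !gform0r oppr0.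
  - by move=> u v hu hv; rewrite (linD lt) !gformDr opprD hu hv.
  move=> [a l] u /= lu.
  have lam0 := lam_gr_homog lt0; have lamu := lam_gr_homog lu.
  have [l0|l0] := eqVneq l 0; last first.
    rewrite (gf_graded form _ lam0 lamu) ?add0r //.
    rewrite (gf_graded form _ lam0 (chevalley_lam ct lamu)) ?oppr0 //.
    by rewrite add0r oppr_eq0.
  subst l; have [a0|a0] := eqVneq a 0; first by subst a; rewrite h // gformNr opprK.
  have [Da|Da] := boolP (a \in rs_roots Delta); last first.
    by rewrite (gr_out Da lu) (lin0 lt) !gform0r oppr0.
  have ha : nonzero_root a by [].
  (* [s] has eigenvalues 0 on t and 2 on u, and [tau s] has eigenvalues 0 on t and 2 on [tau u]; so
     both pairings vanish. *)
  have [s s0 hs] := coroot_elt L red ha.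
  have [w hw] := cartan_weight lt0.
  have st : [s, t] = 0 by rewrite (hs _ _ _ lt0) linear0 scale0r.
  have two : (0 + 2 : C) != 0 by rewrite add0r pnatr_eq0.
  have -> : form t u = 0.
    have e1 : [s, t] = (0 : C) *: t by rewrite st scale0r.
    have e2 : [s, u] = (2 : C) *: u by rewrite (hs _ _ _ lu) rs_coroot2.
    have /eqP := form_weight form e1 e2.
    by rewrite mulf_eq0 (negbTE two) => /eqP.
  have e1 : [tau s, t] = (0 : C) *: t by rewrite (h s s0) (linN (br_linl _)) st oppr0 scale0r.
  have e2 : [tau s, tau u] = (2 : C) *: tau u.
    by rewrite -(chevalley_br _ _ ct) (hs _ _ _ lu) rs_coroot2 // (linZ lt).
  have /eqP := form_weight form e1 e2.
  by rewrite mulf_eq0 (negbTE two) => /eqP ->; rewrite oppr0.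
have h1 a l u v : nonzero_root a -> lt_gr a l u -> form (tau u) (tau v) = form u v.
  move=> ha lu; have [t t0 ht] := coroot_elt L red ha.
  have -> : u = (2^-1 : C) *: [t, u].
    rewrite (ht _ _ _ lu) scalerA rs_coroot2; [|by case: ha..].
    by rewrite mulVf ?scale1r // pnatr_eq0.
  rewrite (linZ lt) !gformZl (chevalley_br _ _ ct) !(gf_invariant form).
  by rewrite -(chevalley_br _ _ ct) h0.
move: x; apply: (torus_gen (subspace_l y)) => [a l x ha lx|a l m x z ha lx lz] /=.
  exact: h1 ha lx.
by rewrite (chevalley_br _ _ ct) !(gf_invariant form) -(chevalley_br _ _ ct) (h1 a l).
Qed.

Lemma conj_centroid (tau g f : L -> L) : chevalley_involution tau ->
  cancel tau g -> cancel g tau -> chevalley_involution g ->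
  in_centroid (@lt_br _ _ _ L) f -> in_centroid (@lt_br _ _ _ L) (tau \o f \o g).
Proof.
move=> ct tK gK cg [lf hf]; split.
  move=> a x y; rewrite /= (chevalley_linear cg) lf.
  exact: (chevalley_linear ct).
move=> x y /=; rewrite (chevalley_br _ _ cg); split.
  by rewrite (hf _ _).1 (chevalley_br _ _ ct) gK.
by rewrite (hf _ _).2 (chevalley_br _ _ ct) gK.
Qed.

Lemma normalized_exists (cb : centroidBasis L) (tau : L -> L) :
  free_of_finite_rank Lambda -> chevalley_involution tau ->
  exists cb' : centroidBasis L, normalized cb' tau.
Proof.
move=> free ct; have [g [tK gK cg]] := chevalley_inverse ct.
have lt := chevalley_linear ct.
pose G := cb_Gamma cb; pose chi := cb_chi cb.
have hG : is_subgroup G := cb_subgroup cb.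
(* Conjugation by tau takes chi^m to a centroid element of degree -m, hence to a multiple of
   chi^(-m). *)
have ex m : exists c : C, G m -> forall x, tau (chi m x) = c *: chi (- m) (tau x).
  have [Gm|nG] := pselect (G m); last by exists 0.
  have [|c [_ hc]] := @centroid_homog _ _ _ L cb (- m) _
    (conj_centroid ct tK gK cg (cb_centroid Gm)).
    move=> l x lx /=; rewrite -[l]opprK -opprD.
    apply: (chevalley_lam ct); apply: (cb_degree Gm); exact: chevalley_lam.
  by exists c => _ x; rewrite -hc /= tK.
have [c hc] := choice ex.
have cn m : G m -> c m != 0.
  move=> Gm; have [x x0] := chi_neq0 Gm; apply: contraNneq x0 => c0.
  by rewrite -(inj_eq (can_inj tK)) (lin0 lt) -/chi hc // c0 scale0r.
have cD m n : G m -> G n -> c (m + n) = c m * c n.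
  move=> Gm Gn; have Gmn := cb_GammaD Gm Gn.
  have [x x0] := chi_neq0 (GammaN Gmn); apply/eqP; rewrite -subr_eq0.
  apply/negPn/negP => h; move: x0; rewrite -[x]gK.
  suff : (c (m + n) - c m * c n) *: chi (- (m + n)) (tau (g x)) = 0.
    by move/eqP; rewrite scaler_eq0 (negbTE h) /chi => /= ->.
  rewrite scalerBl -hc // /chi -(chiD _ Gm Gn) -/chi hc // hc //.
  rewrite /chi (linZ (chi_linear (GammaN Gm))) scalerA.
  by rewrite (chiD _ (GammaN Gm) (GammaN Gn)) -opprD subrr.
have [n [phi [phiB phi0]]] := free_coordinates free.
have chc : character_on G c by split.
have [s [chs s2]] := character_sqrt hG phiB (fun u _ => phi0 u) chc.
have sn : forall m, G m -> s m != 0 by case: chs.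
pose chi' m x := (s m)^-1 *: chi m x.
have cen' m : G m -> in_centroid (@lt_br _ _ _ L) (chi' m).
  move=> Gm; have [lc hcc] := cb_centroid Gm; split.
    by move=> a x y; rewrite /chi' /chi lc scalerDr !scalerA mulrC.
  move=> x y; rewrite /chi' /chi (linZ (br_linl _)) (linZ (br_linr _)).
  by rewrite -(hcc x y).1 -(hcc x y).2.
have deg' m l x : G m -> lam_gr l x -> lam_gr (l + m) (chi' m x).
  by move=> Gm lx; apply: (subspaceZ _ (lam_subspace L _)); exact: cb_degree.
have mul' m k : G m -> G k -> chi' m \o chi' k = chi' (m + k).
  move=> Gm Gk; apply/funext => x; rewrite /= /chi' /chi (linZ (chi_linear Gm)) scalerA.
  by rewrite chiD // (proj1 chs) // invfM.
have basis' f : in_centroid (@lt_br _ _ _ L) f ->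
   exists! d : Lambda -> C,
     [/\ finite_set [set m | d m != 0], forall m, d m != 0 -> G m
       & f = \sum_(m \in [set: Lambda]) d m *: chi' m].
  move=> cf; have [d [[fd dG ef] ud]] := cb_basis cb cf.
  have dG0 m : ~ G m -> d m = 0 by move=> h; apply: contra_notP h => /eqP; exact: dG.
  exists (fun m => d m * s m); split.
    split.
    - apply: sub_finite_set fd => m /=; apply: contraNN => /eqP ->; by rewrite mul0r.
    - by move=> m h; apply: dG; apply: contraNN h => /eqP ->; rewrite mul0r.
    - rewrite ef; apply: eq_fsbigr => m _; apply/funext => x; rewrite !fctE /chi' /chi scalerA.
      have [Gm|nG] := pselect (G m); first by rewrite mulfK // sn.
      by rewrite dG0 // !mul0r !scale0r.
  move=> d' [fd' dG' ef'].
  have dG0' m : ~ G m -> d' m = 0 by move=> h; apply: contra_notP h => /eqP; exact: dG'.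
  have e : d = fun m => d' m / s m.
    apply: ud; split.
    - apply: sub_finite_set fd' => m /=; apply: contraNN => /eqP ->; by rewrite mul0r.
    - by move=> m h; apply: dG'; apply: contraNN h => /eqP ->; rewrite mul0r.
    - rewrite ef'; apply: eq_fsbigr => m _; apply/funext => x.
      by rewrite !fctE /chi' /chi scalerA.
  apply/funext => m; rewrite e; have [Gm|nG] := pselect (G m); first by rewrite mulfVK // sn.
  by rewrite dG0' // !mul0r.
exists (CentroidBasis hG cen' deg' mul' basis') => m /= Gm.
apply/funext => x; rewrite /= /chi' (linZ lt) hc // scalerA.
(* s(m)^-1 c(m) = s(m) = s(-m)^-1, since s is a character with s^2 = c. *)
congr (_ *: _); rewrite -s2 // expr2 mulKf ?sn //.
by rewrite (characterN hG chs) // invrK.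
Qed.

End Chevalley.

(** * Derivations and their graded dual *)

Section Derivations.
Context {R : realType} {Lambda : zmodType} {Delta : rootSystem R}.
Context {L : lieTorus Delta Lambda} {cb : centroidBasis L}.
Variable D : permissible cb.
Local Notation C := R[i].
Local Notation Gamma := (cb_Gamma cb).
Local Notation chi := (cb_chi cb).
Local Notation der := (submod_type D).
Local Notation dual := (submod_type (graded_dual_submod D)).
Implicit Types (x y z : L) (a b : rs_space Delta) (l m n : Lambda) (d e : der).
Implicit Types (phi psi : dual) (theta eta : {additive Lambda -> C}).
Local Notation "[ x , y ]" := (lt_br x y).

Lemma der_ind (P : set der) : is_subspace P ->
  (forall m d, der_gr m d -> P d) -> forall d, P d.
Proof.
move=> hP h d; have := submod_in d; rewrite {1}pm_graded => hd.
suff : lspan (\bigcup_(m in [set: Lambda]) graded_part cb D m)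
    `<=` [set f : L -> L | exists2 e : der, submod_val e = f & P e].
  by move=> /(_ _ hd) [e /val_inj <-].
apply: lspan_min.
  split=> [|c u v [e <- Pe] [e' <- Pe']].
    by exists 0 => //; case: hP.
  exists (c *: e + e'); [exact: submod_val_lin|exact: hP.2].
move=> f [m _ [Df fm]]; exists (submod_elt Df) => //.
by apply: (h m); split.
Qed.

Lemma der_gr_subspace m : Gamma m -> is_subspace (der_gr (D := D) m).
Proof.
move=> Gm; have [S0 Sl] := scder_gr_subspace Gm; have [D0 Dl] := submodP D.
split; first by split.
move=> c d e [Dd dm] [De em]; split; rewrite ?submod_val_lin; [exact: Dl|exact: Sl].
Qed.

Lemma der_grP m d : der_gr m d -> Gamma m /\
  exists2 theta : {additive Lambda -> C}, theta m = 0 & submod_val d = chi m \o degree_derivation theta.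
Proof. by case. Qed.

Lemma der_homogE m d theta l x : Gamma m ->
  submod_val d = chi m \o degree_derivation theta -> lam_gr l x ->
  submod_val d x = theta l *: chi m x.
Proof.
by move=> Gm -> lx /=; rewrite (degree_derivationE _ lx) (linZ (chi_linear Gm)).
Qed.

Lemma chi_derivation_inj m theta eta : Gamma m ->
  chi m \o degree_derivation theta = chi m \o degree_derivation eta -> theta =1 eta.
Proof.
move=> Gm e; apply: (@degree_derivation_inj _ _ _ L); apply/funext => x.
have := congr1 (fun f => chi (- m) (f x)) e.
by rewrite /= !chiNK.
Qed.

(** A centroid element can be moved onto either factor of a bracket, so chi^m composed with a
    derivation is again a derivation. *)
Lemma der_leibniz d x y :
  submod_val d [x, y] = [submod_val d x, y] + [x, submod_val d y].
Proof.
move: d; apply: der_ind.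
  split=> [|c d e /= hd he].
    by rewrite /= (lin0 (br_linl _)) (lin0 (br_linr _)) addr0.
  rewrite ?submod_val_lin !fctE hd he (br_linl _ c) (br_linr _ c) scalerDr.
  by rewrite addrACA.
move=> m d /der_grP[Gm [theta _ dE]] /=; rewrite dE /=.
have [lc hc] := cb_centroid Gm; have dl := degree_derivation_linear (L := L) theta.
move: x; apply: (homog_ind (lt_direct L)).
- by rewrite !(lin0 (br_linl _), lin0 dl, lin0 lc) addr0.
- move=> u v hu hv; rewrite !(linD (br_linl _), linD dl, linD lc) hu hv.
  by rewrite addrACA.
move=> [a l] x /= lx; move: y; apply: (homog_ind (lt_direct L)).
- by rewrite !(lin0 (br_linr _), lin0 dl, lin0 lc) addr0.
- move=> u v hu hv; rewrite !(linD (br_linr _), linD dl, linD lc) hu hv.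
  by rewrite addrACA.
move=> [b n] y /= ly.
rewrite (degree_derivationE _ (lam_gr_homog (lt_graded lx ly))).
rewrite (degree_derivationE _ (lam_gr_homog lx)) (degree_derivationE _ (lam_gr_homog ly)).
rewrite !(linZ lc) (linZ (br_linl _)) (linZ (br_linr _)) raddfD scalerDl.
by rewrite -(hc _ _).1 -(hc _ _).2.
Qed.

Lemma der_lam0 d t : lt_gr 0 0 t -> submod_val d t = 0.
Proof.
move=> lt; move: d; apply: der_ind.
  split=> // c d e /= hd he; by rewrite ?submod_val_lin !fctE hd he scaler0 addr0.
move=> m d /der_grP[Gm [theta _ dE]] /=.
by rewrite (der_homogE Gm dE (lam_gr_homog lt)) raddf0 scale0r.
Qed.

(** Only degrees with l + n + m = 0 pair nontrivially, and there theta(m) = 0 gives theta(l) = -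
    theta(n). *)
Lemma der_skew (form : gradedForm L) d x y :
  form (submod_val d x) y = - form x (submod_val d y).
Proof.
move: d; apply: der_ind.
  split=> [|c d e /= hd he]; first by rewrite /= gform0l gform0r oppr0.
  by rewrite ?submod_val_lin !fctE !gformDl !gformDr !gformZl !gformZr hd he mulrN opprD.
move=> m d /der_grP[Gm [theta tm dE]] /=; rewrite dE /=.
have cc := cb_centroid Gm; have [lc _] := cc.
have dl := degree_derivation_linear (L := L) theta.
move: x; apply: lam_gr_ind.
- by rewrite (lin0 dl) (lin0 lc) !gform0l oppr0.
- by move=> u v hu hv; rewrite (linD dl) (linD lc) !gformDl hu hv opprD.
move=> l x lx; move: y; apply: lam_gr_ind.
- by rewrite (lin0 dl) (lin0 lc) !gform0r oppr0.
- by move=> u v hu hv; rewrite (linD dl) (linD lc) !gformDr hu hv opprD.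
move=> n y ly; rewrite !(degree_derivationE _ lx, degree_derivationE _ ly) !(linZ lc).
rewrite gformZl gformZr (centroid_form form cc).
have [s0|s0] := eqVneq (l + (n + m)) 0; last first.
  by rewrite (gf_graded form s0 lx (cb_degree Gm ly)) !mulr0 oppr0.
have -> : theta l = - theta n; last by rewrite mulNr.
by apply/eqP; rewrite -addr_eq0; have := congr1 theta s0; rewrite !raddfD raddf0 /= tm addr0 => ->.
Qed.

Lemma der_br_linr d : linear (fun e => der_br d e : der).
Proof.
move=> c u v; apply: val_inj; apply/funext => x /=.
rewrite /commutator ?submod_val_lin !fctE /= (linD (der_linear d)) (linZ (der_linear d)).
by rewrite scalerBr opprD addrACA.
Qed.

Lemma der_br_linl e : linear (fun d => der_br d e : der).
Proof. by move=> c u v; rewrite der_br_lin. Qed.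

Lemma der_br_skew d e : der_br d e = - der_br e d.
Proof. by apply: val_inj; apply/funext => x /=; rewrite /commutator !fctE opprB. Qed.

Lemma der_br_gr m n d e : der_gr m d -> der_gr n e -> der_gr (m + n) (der_br d e).
Proof. by move=> [_ hd] [_ he]; split; [exact: submod_in|exact: scder_gr_comm]. Qed.

Lemma der_brE m n d e theta eta : der_gr m d -> der_gr n e ->
  submod_val d = chi m \o degree_derivation theta ->
  submod_val e = chi n \o degree_derivation eta ->
  forall l x, lam_gr l x ->
  submod_val (der_br d e) x = (theta n * eta l - eta m * theta l) *: chi (m + n) x.
Proof.
move=> hd he dE eE l x lx.
have [[Gm _] [Gn _]] := (der_grP hd, der_grP he).
rewrite /= /commutator (der_homogE Gm dE lx) (der_homogE Gn eE lx).
rewrite (linZ (der_linear d)) (linZ (der_linear e)).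
rewrite (der_homogE Gm dE (cb_degree Gn lx)) (der_homogE Gn eE (cb_degree Gm lx)).
rewrite !scalerA !chiD // [n + m]addrC -scalerBl; congr (_ *: _).
by rewrite !raddfD /=; ring.
Qed.

Lemma der_eqP d e :
  (forall l x, lam_gr l x -> submod_val d x = submod_val e x) -> d = e.
Proof.
move=> h; apply: val_inj; apply/funext; apply: lam_gr_ind => //.
- by rewrite /= !(lin0 (der_linear _)).
- by move=> x y /= hx hy; rewrite !(linD (der_linear _)) hx hy.
Qed.

(** Both coefficients in the bracket formula, theta(-m) and eta(m), vanish. *)
Lemma der_br_degree0 m d e : der_gr m d -> der_gr (- m) e -> der_br d e = 0.
Proof.
move=> hd he; apply: der_eqP => l x lx.
have [Gm [theta tm dE]] := der_grP hd; have [Gn [eta en eE]] := der_grP he.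
rewrite (der_brE hd he dE eE lx) raddfN /= tm oppr0 mul0r sub0r.
by move/eqP: en; rewrite raddfN oppr_eq0 => /eqP /= ->; rewrite mul0r oppr0 scale0r.
Qed.

Lemma der0P p : der_gr (D := D) 0 p ->
  exists theta : {additive Lambda -> C}, submod_val p = degree_derivation theta.
Proof.
move=> /der_grP[_ [theta _ pE]]; exists theta.
by rewrite pE; apply/funext => x /=; rewrite chi0.
Qed.

Lemma der_br0l p d m theta : der_gr 0 p -> submod_val p = degree_derivation theta ->
  der_gr m d -> der_br p d = theta m *: d.
Proof.
move=> hp pE hd; have [Gm [eta em dE]] := der_grP hd.
have pE' : submod_val p = chi 0 \o degree_derivation theta.
  by rewrite pE; apply/funext => x /=; rewrite chi0.
apply: der_eqP => l x lx; rewrite (der_brE hp hd pE' dE lx).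
have -> : submod_val (theta m *: d) x = theta m *: submod_val d x.
  by have := submod_val_lin (theta m) d 0; rewrite addr0 => ->; rewrite !fctE addr0.
by rewrite (der_homogE Gm dE lx) raddf0 mul0r subr0 add0r scalerA.
Qed.

Lemma dual_lin phi : scalar (submod_val phi).
Proof. by case: (submod_in phi). Qed.

Lemma dual0 phi : submod_val phi 0 = 0. Proof. exact: (lin0 (dual_lin phi)). Qed.
Lemma dualZ phi c d : submod_val phi (c *: d) = c * submod_val phi d.
Proof. exact: (linZ (dual_lin phi)). Qed.

Lemma val_dualB phi psi d :
  submod_val (phi - psi) d = submod_val phi d - submod_val psi d.
Proof. by []. Qed.

Lemma val_dualZ c phi d : submod_val (c *: phi) d = c * submod_val phi d.
Proof. by []. Qed.

Lemma val_dual_lin c phi psi d :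
  submod_val (c *: phi + psi) d = c * submod_val phi d + submod_val psi d.
Proof. by []. Qed.

Lemma val_dual_sum (I : Type) (r : seq I) (F : I -> dual) d :
  submod_val (\sum_(i <- r) F i) d = \sum_(i <- r) submod_val (F i) d.
Proof. exact: (big_morph (fun phi : dual => submod_val phi d)). Qed.

Lemma dual_eqP phi psi :
  (forall m d, der_gr m d -> submod_val phi d = submod_val psi d) -> phi = psi.
Proof.
move=> h; apply: val_inj; apply/funext; apply: der_ind h.
split; first by rewrite /= !dual0.
by move=> c d e /= hd he; rewrite !dual_lin hd he.
Qed.

(** The dual of D^n, which has degree -n in the graded dual; this is the source of the minus signs
    in [sigma_gr] and [wt_dual]. *)
Definition dual_gr n phi : Prop :=
  forall m d, m != n -> der_gr m d -> submod_val phi d = 0.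

Lemma dual_action0r d : dual_action d 0 = 0 :> dual.
Proof. exact: val_inj. Qed.

Lemma dual_action_lin c d e phi psi :
  dual_action (c *: d + e) phi = c *: dual_action d phi + dual_action e phi /\
  dual_action d (c *: phi + psi) = c *: dual_action d phi + dual_action d psi.
Proof.
split; apply: val_inj; apply/funext => u.
  rewrite /= ?submod_val_lin !fctE /= (der_br_linr u c) dual_lin.
  by [].
by rewrite /= ?submod_val_lin !fctE.
Qed.

Lemma dual_action_degree0 p phi n theta : der_gr 0 p ->
  submod_val p = degree_derivation theta -> dual_gr n phi ->
  dual_action p phi = (- theta n) *: phi.
Proof.
move=> hp pE hphi; apply: dual_eqP => m e em.
have -> : submod_val ((- theta n) *: phi) e = - theta n * submod_val phi e.
  by have := submod_val_lin (- theta n) phi 0; rewrite addr0 => ->; rewrite !fctE addr0.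
rewrite /= der_br_skew (der_br0l hp pE em) -scaleNr dualZ.
have [->//|mn] := eqVneq m n.
by rewrite (hphi m e mn em) !mulr0.
Qed.

Lemma sigma_gr (form : gradedForm L) l k x y : lam_gr l x -> lam_gr k y ->
  dual_gr (- (l + k)) (sigma form D x y).
Proof.
move=> lx ky m d mn [Dd dm] /=.
apply: (gf_graded form _ (scder_gr_degree dm lx) ky).
by apply: contraNneq mn => h; rewrite -addr_eq0 -h addrC addrAC.
Qed.

Lemma sigma_lin (form : gradedForm L) c x x' y :
  sigma form D (c *: x + x') y = c *: sigma form D x y + sigma form D x' y /\
  sigma form D y (c *: x + x') = c *: sigma form D y x + sigma form D y x'.
Proof.
split; apply: val_inj; apply/funext => d /=; rewrite ?submod_val_lin !fctE /=.
  by rewrite (linD (der_linear d)) (linZ (der_linear d)) gformDl gformZl.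
by rewrite gformDr gformZr.
Qed.

(* The element representing a on L_0^0 does not depend on the degree. *)
Lemma coroot_degree_indep (form : gradedForm L) a l k x y x' y' :
  reduced Delta ->
  lt_gr a l x -> lt_gr (- a) (- l) y -> lt_gr a k x' -> lt_gr (- a) (- k) y' ->
  form x y = form x' y' -> [x, y] = [x', y'].
Proof.
move=> red lx ly lx' ly' h.
have gr0 m u v : lt_gr a m u -> lt_gr (- a) (- m) v -> lt_gr (l0 := L) 0 0 [u, v].
  by move=> lu lv; have := lt_graded lu lv; rewrite !subrr.
(* Against L_0^0, [u, v] depends only on a and (u, v); the form pairs L_0^0 with no other piece. *)
have ft m u v t (w : {scalar rs_space Delta}) : lt_gr a m u -> lt_gr (- a) (- m) v ->
    (forall b n z, lt_gr b n z -> [t, z] = w b *: z) ->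
    form [u, v] t = w a * form u v.
  move=> lu lv hw; rewrite (gf_invariant form) br_skew (hw _ _ _ lv) gformNr gformZr.
  by rewrite linearN mulNr opprK.
apply/eqP; rewrite -subr_eq0; apply/eqP/(gf_nondeg (g := form)) => z.
have lk : lt_gr (l0 := L) 0 0 ([x, y] - [x', y']).
  by apply: (subspaceB (gr_subspace _ _ _)); apply: gr0; eassumption.
move: z; apply: (homog_ind (lt_direct L)); first exact: gform0r.
  by move=> u v hu hv; rewrite gformDr hu hv addr0.
move=> [b m] t /= lt; apply: contrapT => /eqP ne.
have [b0 m0] := form_graded red lk lt ne; rewrite !oppr0 in b0 m0; subst b m.
have [w hw] := cartan_weight lt; move/eqP: ne; apply.
by rewrite gformDl gformNl (ft _ _ _ _ w lx ly hw) (ft _ _ _ _ w lx' ly' hw) h subrr.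
Qed.

(* For x in L_a^l and x' in L_a^0 one can choose y and y' so that both brackets
   are chi^(-m) t_a, where t_a represents a on L_0^0. *)
Lemma dual_ev (form : gradedForm L) (W : set dual) m : reduced Delta ->
  Gamma m -> is_subspace W ->
  (forall a l k x y x' y', nonzero_root a -> lt_gr a l x -> lt_gr (- a) (- (l + m)) y ->
     lt_gr a k x' -> lt_gr (- a) (- (k + m)) y' -> [x, y] = [x', y'] ->
     W (sigma form D x y - sigma form D x' y')) ->
  forall l, exists phi, [/\ W phi, dual_gr m phi &
    forall d theta, der_gr m d -> submod_val d = chi m \o degree_derivation theta ->
      submod_val phi d = theta l].
Proof.
move=> red Gm hW h; apply: (@Lambda_gen _ _ _ L).
  split.
    exists 0; split => //; first by case: hW.
    by move=> d theta _ _; rewrite raddf0.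
  move=> u v [phi [Wphi gphi ephi]] [psi [Wpsi gpsi epsi]].
  exists (phi - psi); split; first exact: subspaceB.
    move=> n d nm dn.
    by rewrite val_dualB (gphi n d nm dn) (gpsi n d nm dn) subrr.
  move=> d theta dm dE.
  by rewrite val_dualB (ephi d theta dm dE) (epsi d theta dm dE) raddfB.
move=> a l x ha lx x0; have [x' lx' x0'] := gr_neq0 L red ha.
(* The normalisation (chi^m u, y) = 1 makes [sigma u y] evaluate chi^m d_theta to theta(k). *)
have ex k u : lt_gr a k u -> u != 0 ->
    exists2 y, lt_gr (- a) (- (k + m)) y & form (chi m u) y = 1.
  move=> lu u0; have [|y ly fy] := form_dual form red (chi_gr red Gm lu).
    by rewrite chi_eq0.
  exists ((form (chi m u) y)^-1 *: y); first exact: (subspaceZ _ (gr_subspace _ _ _)).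
  by rewrite gformZr mulVf.
have [y ly fy] := ex _ _ lx x0; have [y' ly' fy'] := ex _ _ lx' x0'.
have cc := cb_centroid Gm.
have exy : [x, y] = [x', y'].
  rewrite -[LHS](chiNK _ Gm) -[RHS](chiNK _ Gm) (cc.2 x y).1 (cc.2 x' y').1.
  congr (chi _ _); apply: (coroot_degree_indep (form := form) red
    (chi_gr red Gm lx) ly (chi_gr red Gm lx') ly').
  by rewrite fy fy'.
exists (sigma form D x y - sigma form D x' y'); split.
- exact: (h a l 0).
- move=> n d nm dn; rewrite val_dualB.
  rewrite (sigma_gr form (lam_gr_homog lx) (lam_gr_homog ly) _ dn).
    rewrite (sigma_gr form (lam_gr_homog lx') (lam_gr_homog ly') _ dn) ?subrr //.
    by rewrite add0r opprK add0r.
  by rewrite opprD opprK addKr.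
(* The difference takes the value theta(l) - theta(0) = theta(l). *)
move=> d theta dm dE; rewrite val_dualB /=.
rewrite (der_homogE Gm dE (lam_gr_homog lx)) (der_homogE Gm dE (lam_gr_homog lx')).
by rewrite !gformZl fy fy' raddf0 mul0r subr0 mulr1.
Qed.

(* An element of D^m is determined by the values of the functionals of [dual_ev]
   on generators of Lambda, so these functionals span (D^m)^*. *)
Lemma dual_span (form : gradedForm L) (W : set dual) : reduced Delta ->
  free_of_finite_rank Lambda -> is_subspace W ->
  (forall m a l k x y x' y', Gamma m -> nonzero_root a ->
     lt_gr a l x -> lt_gr (- a) (- (l + m)) y ->
     lt_gr a k x' -> lt_gr (- a) (- (k + m)) y' -> [x, y] = [x', y'] ->
     W (sigma form D x y - sigma form D x' y')) ->
  forall phi, W phi.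
Proof.
move=> red [r [g hg]] hW h phi.
have part m : exists psi, [/\ W psi, dual_gr m psi &
    forall d, der_gr m d -> submod_val psi d = submod_val phi d].
  (* Outside Gamma the set [der_gr m] is empty, so 0 serves. *)
  have [Gm|nG] := pselect (Gamma m); last first.
    exists 0; split => //; first by case: hW.
    by move=> d /der_grP[].
  have [Psi hPsi] := choice (dual_ev red Gm hW (fun a l k x y x' y' =>
    h m a l k x y x' y' Gm)).
  have [||d dm d0|c hc] := @functional_span _ _ r (der_gr m)
     (fun i d => submod_val (Psi (g i)) d) (submod_val phi) (der_gr_subspace Gm).
  - by move=> i c u v _ _; rewrite dual_lin.
  - by move=> c u v _ _; rewrite dual_lin.
  - have [_ [theta _ dE]] := der_grP dm.
    have t0 l : theta l = 0.
      have [c [-> _]] := hg l; rewrite raddf_sum big1 // => i _.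
      have [_ _ /(_ d theta dm dE)] := hPsi (g i); rewrite d0 => e.
      by rewrite raddfMz -e mul0rz.
    have -> : d = 0; last by rewrite dual0.
    by apply: der_eqP => l x lx; rewrite (der_homogE Gm dE lx) t0 scale0r.
  exists (\sum_(i < r) c i *: Psi (g i)).
  have sumE d : submod_val (\sum_(i < r) c i *: Psi (g i)) d =
      \sum_(i < r) c i * submod_val (Psi (g i)) d.
    by rewrite val_dual_sum; apply: eq_bigr => i _; rewrite val_dualZ.
  split.
  - apply: (big_ind W); first by case: hW.
      by move=> u v; exact: subspaceD.
    by move=> i _; apply: subspaceZ => //; case: (hPsi (g i)).
  - move=> n d nm dn; rewrite sumE big1 // => i _.
    by have [_ /(_ n d nm dn) -> _] := hPsi (g i); rewrite mulr0.
  by move=> d dm; rewrite sumE hc.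
have [Psi hPsi] := choice part.
have [_ fphi] : is_graded_functional (submod_val phi) := submod_in phi.
pose F := fset_set [set m | exists2 d, der_gr m d & submod_val phi d != 0].
suff -> : phi = \sum_(m <- F) Psi m.
  apply: (big_ind W); first by case: hW.
    by move=> u v; exact: subspaceD.
  by move=> m _; case: (hPsi m).
apply: dual_eqP => m d dm; rewrite val_dual_sum.
have z n : n != m -> submod_val (Psi n) d = 0.
  by rewrite eq_sym => nm; have [_ /(_ m d nm dm)] := hPsi n.
have [mF|mF] := boolP (m \in F).
  rewrite (big_fsetD1 m) //= big_seq big1 ?addr0.
    by case: (hPsi m) => _ _ ->.
  by move=> n; rewrite !inE => /andP[nm _]; exact: z.
rewrite big_seq big1.
  apply: contrapT => /eqP ne; move/negP: mF; apply.
  by rewrite in_fset_set // inE /=; exists d.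
by move=> n nF; apply: z; apply: contraNneq mF => <-.
Qed.

End Derivations.

(** * Weights of the Cartan subalgebra *)

Section Weights.
Context {R : realType} {Lambda : zmodType} {Delta : rootSystem R}.
Context {L : lieTorus Delta Lambda} {cb : centroidBasis L}.
Variables (D : permissible cb) (form : gradedForm L).
Hypothesis red : reduced Delta.
Local Notation C := R[i].
Local Notation Gamma := (cb_Gamma cb).
Local Notation chi := (cb_chi cb).
Local Notation der := (submod_type D).
Local Notation dual := (submod_type (graded_dual_submod D)).
Local Notation cartan := (submod_type (cartan_submod D)).
Local Notation E := (ealg D).
Local Notation inL := (inL D).
Implicit Types (x y z : L) (a b : rs_space Delta) (l m n : Lambda) (d e : der).
Implicit Types (phi psi : dual) (theta eta : {additive Lambda -> C}).
Implicit Types (h : cartan) (u v w : E) (r s : cartan -> C).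
Local Notation "[ x , y ]" := (lt_br x y).

Lemma sigma0l x : sigma form D 0 x = 0.
Proof. by have := (sigma_lin D form (-1) 0 0 x).1; rewrite scaler0 addr0 scaleN1r addNr. Qed.

Lemma dual_action0l phi : dual_action 0 phi = 0.
Proof. by have := (dual_action_lin (-1) 0 0 phi 0).1; rewrite scaler0 addr0 scaleN1r addNr. Qed.

Lemma ebr_linl v : linear (fun u : E => ebr form u v : E).
Proof.
case: v => [[y psi] e] c [[x phi] d] [[x' phi'] d'].
congr (_, _, _).
- rewrite /= ?submod_val_lin !fctE (br_linl y c) (linD (der_linear e)) (linZ (der_linear e)).
  rewrite !scalerBr !scalerDr opprD -!addrA; congr (_ + _).
  rewrite addrCA; congr (_ + _); rewrite [RHS]addrCA; congr (_ + _).
  by rewrite [RHS]addrCA.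
- rewrite /= (sigma_lin D form c x x' y).1 (dual_action_lin c d d' psi 0).1.
  rewrite (dual_action_lin c e 0 phi phi').2 scalerBr scalerDr opprD -!addrA.
  congr (_ + _); rewrite addrCA; congr (_ + _); rewrite [RHS]addrCA; congr (_ + _).
  by rewrite [RHS]addrCA.
- exact: der_br_linl.
Qed.

Lemma ebr_linr u : linear (fun v : E => ebr form u v : E).
Proof.
case: u => [[x phi] d] c [[y psi] e] [[y' psi'] e'].
congr (_, _, _).
- rewrite /= ?submod_val_lin !fctE (br_linr x c) (linD (der_linear d)) (linZ (der_linear d)).
  rewrite !scalerBr !scalerDr opprD -!addrA; congr (_ + _).
  rewrite addrCA; congr (_ + _); rewrite [RHS]addrCA; congr (_ + _).
  by rewrite [RHS]addrCA.
- rewrite /= (sigma_lin D form c y y' x).2 (dual_action_lin c d 0 psi psi').2.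
  rewrite (dual_action_lin c e e' phi 0).1 scalerBr scalerDr opprD -!addrA.
  congr (_ + _); rewrite addrCA; congr (_ + _); rewrite [RHS]addrCA; congr (_ + _).
  by rewrite [RHS]addrCA.
- exact: der_br_linr.
Qed.

Lemma ebr_inL x y : ebr form (inL x) (inL y) = ([x, y], sigma form D x y, 0) :> E.
Proof.
congr (_, _, _).
- by rewrite !subr0 addr0.
- by rewrite !dual_action0l addr0 subr0.
- exact: (lin0 (der_br_linl _)).
Qed.

Lemma ebr_inD_inL d x : ebr form (inD d) (inL x) = inL (submod_val d x) :> E.
Proof.
congr (_, _, _).
- by rewrite /= (lin0 (br_linl _)) add0r subr0.
- by rewrite /= sigma0l dual_action0r dual_action0l add0r subr0.
- exact: (lin0 (der_br_linr _)).
Qed.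

Lemma ebr_inD d e : ebr form (inD d) (inD e) = inD (der_br d e) :> E.
Proof.
congr (_, _, _).
- by rewrite /= (lin0 (br_linl _)) !(lin0 (der_linear _)) subr0 add0r.
- by rewrite /= sigma0l !dual_action0r add0r subr0.
Qed.

(** In the dual component this is the equivariance of [sigma] under D, which follows from skewness
    of d. *)
Lemma ebr_inD_leibniz d x y :
  ebr form (inD d) (ebr form (inL x) (inL y)) =
  ebr form (inL (submod_val d x)) (inL y) + ebr form (inL x) (inL (submod_val d y)) :> E.
Proof.
rewrite !ebr_inL; congr (_, _, _).
- by rewrite /= (lin0 (br_linl _)) add0r subr0 der_leibniz.
- rewrite /= sigma0l dual_action0l add0r subr0; apply: dual_eqP => m e _ /=.
  by rewrite /commutator gformDl gformNl (der_skew form d) opprK.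
- by rewrite /= (lin0 (der_br_linr _)) addr0.
Qed.

(** psi sees a bracket [e, d] only when e and d have opposite degrees, and then the bracket is 0. *)
Lemma cartan_dual_action d psi : dual_gr 0 psi -> dual_action d psi = 0.
Proof.
move=> hpsi; move: d; apply: der_ind.
  split; first exact: dual_action0l.
  by move=> c d e /= hd he; rewrite (dual_action_lin c d e psi 0).1 hd he scaler0 addr0.
move=> m d dm /=; apply: dual_eqP => n e en /=.
have [s0|s0] := eqVneq (n + m) 0; last exact: hpsi s0 (der_br_gr en dm).
have em : n = - m by apply/eqP; rewrite -addr_eq0 s0.
rewrite der_br_skew; subst n.
by rewrite (der_br_degree0 dm en) oppr0 dual0.
Qed.

Lemma cartan_in h : cartan_set (submod_val h).
Proof. exact: (@submod_in _ _ (cartan_submod D) h). Qed.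

(** All cross terms vanish: derivations kill L_0^0, hence so does [sigma t x], and D annihilates
    (D^0)^*. *)
Lemma cartan_ebr h x phi d : let t := (submod_val h).1.1 in let p := (submod_val h).2 in
  ebr form (submod_val h) (x, phi, d) =
  ([t, x] + submod_val p x, dual_action p phi, der_br p d).
Proof.
have := cartan_in h; case: (submod_val h) => [[t psi] p] [/= t0 psi0 _].
congr (_, _, _); first by rewrite (der_lam0 d t0) subr0.
rewrite (cartan_dual_action d psi0) subr0.
rewrite -[RHS]add0r; congr (_ + _); apply: dual_eqP => m e _ /=.
by rewrite (der_lam0 e t0) gform0l.
Qed.

(** A linear form and an additive map are recorded, rather than an eigenvalue for each piece, so
    that [wt] is additive in the pair (a, l). *)
Definition cartan_weights h (p : {scalar rs_space Delta} * {additive Lambda -> C}) : Prop :=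
  (forall b m z, lt_gr b m z -> [(submod_val h).1.1, z] = p.1 b *: z) /\
  submod_val (submod_val h).2 = degree_derivation p.2.

Lemma cartan_weights_ex h : exists p, cartan_weights h p.
Proof.
have [/= t0 _ p0] := cartan_in h.
have [w hw] := cartan_weight t0; have [theta pE] := der0P p0.
by exists (w, theta).
Qed.

(* The weight (a, l), by which the Cartan subalgebra acts on L_a^l. *)
Definition wt a l h : C :=
  let p := sval (cid (cartan_weights_ex h)) in p.1 a + p.2 l.

Lemma wt_addL a b l m : wt (a + b) (l + m) = wt a l + wt b m.
Proof. by apply/funext => h; rewrite /wt !fctE !raddfD /= addrACA. Qed.

Lemma wt_opp a l : wt (- a) (- l) = - wt a l.
Proof. by apply/funext => h; rewrite /wt !fctE !raddfN /= opprD. Qed.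

Lemma wt_inL a l x : lt_gr a l x -> root_space form (wt a l) (inL x).
Proof.
move=> lx h; rewrite cartan_ebr /wt; case: cid => p [/= hw ->].
rewrite (hw _ _ _ lx) (degree_derivationE _ (lam_gr_homog lx)) -scalerDl.
by rewrite dual_action0r (lin0 (der_br_linr _)); congr (_, _, _); rewrite scaler0.
Qed.

Lemma wt_inD m d : der_gr m d -> root_space form (wt 0 m) (inD d).
Proof.
move=> dm h; rewrite cartan_ebr /wt; have [_ _ /= p0] := cartan_in h.
case: cid => p [/= hw pE].
rewrite (lin0 (br_linr _)) (lin0 (der_linear _)) addr0 dual_action0r.
by rewrite (der_br0l p0 pE dm) raddf0 add0r; congr (_, _, _); rewrite scaler0.
Qed.

Lemma wt_dual m phi : dual_gr m phi -> root_space form (wt 0 (- m)) (0, phi, 0).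
Proof.
move=> pm h; rewrite cartan_ebr /wt; have [_ _ /= p0] := cartan_in h.
case: cid => p [/= hw pE].
rewrite (lin0 (br_linr _)) (lin0 (der_linear _)) addr0 (lin0 (der_br_linr _)).
by rewrite (dual_action_degree0 p0 pE pm) raddf0 add0r raddfN; congr (_, _, _); rewrite scaler0.
Qed.

Lemma root_space_subspace r : is_subspace (root_space form r).
Proof.
split=> [h|c u v hu hv h]; first by rewrite (lin0 (ebr_linr _)) scaler0.
by rewrite ebr_linr hu hv scalerDr !scalerA mulrC.
Qed.

(** The part in L_0^(l+m) and the [sigma] part, which lies in the dual of D^(-(l+m)), have the same
    weight. *)
Lemma wt_bracket a b l m x y : a + b = 0 -> lt_gr a l x -> lt_gr b m y ->
  root_space form (wt 0 (l + m)) (ebr form (inL x) (inL y)).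
Proof.
move=> ab lx ly; rewrite ebr_inL.
have -> : ([x, y], sigma form D x y, 0) = inL [x, y] + (0, sigma form D x y, 0) :> E.
  by congr (_, _, _); rewrite ?addr0 ?add0r.
apply: (subspaceD (root_space_subspace _)).
  by apply: wt_inL; rewrite -ab; exact: lt_graded.
rewrite -[l + m]opprK; apply: wt_dual.
exact: sigma_gr (lam_gr_homog lx) (lam_gr_homog ly).
Qed.

Lemma root_scalar r u : root_space form r u -> u != 0 -> scalar r.
Proof.
move=> hu u0 c h h'; apply/eqP.
have := hu (c *: h + h'); rewrite submod_val_lin (ebr_linl u c) !hu => /eqP.
rewrite eq_sym scalerA -scalerDl -subr_eq0 -scalerBl scaler_eq0 (negbTE u0) orbF.
by rewrite subr_eq0.
Qed.

Lemma is_rootP r u : root_space form r u -> u != 0 -> is_root form r.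
Proof. by move=> hu u0; split; [exact: root_scalar u0|exists u]. Qed.

Lemma inL_eq0 x : (inL x == 0) = (x == 0).
Proof. by apply/eqP/eqP => [[]|->]. Qed.

Lemma inL_lin : linear inL.
Proof. by move=> c x y; congr (_, _, _); rewrite /= scaler0 addr0. Qed.

Lemma inD_eq0 d : (inD d == 0) = (d == 0).
Proof. by apply/eqP/eqP => [[]|->]. Qed.

Lemma inD_lin : linear (fun d => inD d : E).
Proof. by move=> c x y; congr (_, _, _); rewrite /= scaler0 addr0. Qed.

Lemma wt_eigen a l x h (c : C) : lt_gr a l x -> x != 0 ->
  ebr form (submod_val h) (inL x) = c *: inL x -> wt a l h = c.
Proof.
move=> lx x0; rewrite (wt_inL lx) => /eqP.
rewrite -subr_eq0 -scalerBl scaler_eq0 inL_eq0 (negbTE x0) orbF subr_eq0.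
by move=> /eqP.
Qed.

Lemma cartan_inL t : lt_gr 0 0 t -> cartan_set (inL t).
Proof.
move=> t0; split=> //=.
split; first exact: (submodP D).1.
exact: (scder_gr_subspace (cb_subgroup cb).1).1.
Qed.

Definition cartanL t (t0 : lt_gr 0 0 t) : cartan :=
  @submod_elt _ _ (cartan_submod D) _ (cartan_inL t0).

Lemma cartanL_ebr t (t0 : lt_gr 0 0 t) x phi d :
  ebr form (submod_val (cartanL t0)) (x, phi, d) = ([t, x], 0, 0).
Proof.
rewrite cartan_ebr /= addr0; congr (_, _, _); first exact: dual_action0l.
exact: (lin0 (der_br_linl _)).
Qed.

Lemma wt0_cartanL t (t0 : lt_gr 0 0 t) l x : lt_gr 0 l x -> x != 0 -> wt 0 l (cartanL t0) = 0.
Proof.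
move=> lx x0; apply: (wt_eigen lx x0); rewrite cartanL_ebr scale0r.
by have [w hw] := cartan_weight t0; rewrite (hw _ _ _ lx) linear0 scale0r.
Qed.

Lemma cartan_inD p : der_gr 0 p -> cartan_set (inD p : E).
Proof. by move=> p0; split => //=; case: (gr_subspace L 0 0). Qed.

Definition cartanD p (p0 : der_gr 0 p) : cartan :=
  @submod_elt _ _ (cartan_submod D) _ (cartan_inD p0).

(** Only values on L_0^0 are compared, so the lemma applies to weights that agree up to an isotropic
    root. *)
Lemma wt_inj_root a b l m x y : lt_gr a l x -> x != 0 -> lt_gr b m y -> y != 0 ->
  (forall t (t0 : lt_gr (l0 := L) 0 0 t), wt a l (cartanL t0) = wt b m (cartanL t0)) -> a = b.
Proof.
move=> lx x0 ly y0 e.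
have Dg c k z : lt_gr c k z -> z != 0 -> c \in rs_roots Delta.
  by move=> lz; apply: contraNT => Dc; rewrite (gr_out Dc lz) eqxx.
apply: coroot_separates; [exact: (Dg _ _ _ lx x0)|exact: (Dg _ _ _ ly y0)|] => c hc.
have [t t0 ht] := coroot_elt L red hc.
have eig b' k z : lt_gr b' k z -> z != 0 -> wt b' k (cartanL t0) = rs_coroot c b'.
  move=> lz z0; apply: (wt_eigen lz z0); rewrite cartanL_ebr (ht _ _ _ lz).
  exact: (linZ inL_lin).
by rewrite -(eig _ _ _ lx x0) -(eig _ _ _ ly y0) e.
Qed.

(** The root is read off on L_0^0, the degree on D^0 by injectivity of [ev]. *)
Lemma wt_inj a b l m x y : lt_gr a l x -> x != 0 -> lt_gr b m y -> y != 0 ->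
  wt a l = wt b m -> a = b /\ l = m.
Proof.
move=> lx x0 ly y0 e; split.
  by apply: (wt_inj_root lx x0 ly y0) => t t0; rewrite e.
apply: (pm_ev_inj (p := D)); apply/funext => -[theta /= th0].
have th : graded_part cb D 0 (degree_derivation theta) by move: th0; rewrite inE.
have p0 : der_gr 0 (submod_elt th.1) by [].
have eig b' k z : lt_gr b' k z -> z != 0 -> wt b' k (cartanD p0) = theta k.
  move=> lz z0; apply: (wt_eigen lz z0); rewrite ebr_inD_inL /=.
  by rewrite (degree_derivationE _ (lam_gr_homog lz)) (linZ inL_lin).
by rewrite /ev /= -(eig _ _ _ lx x0) -(eig _ _ _ ly y0) e.
Qed.

(** L_0^0 acts by zero on the graded dual and on D, which forces u into L; two nonzero components of
    u would give two pairs with the same weight. *)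
Lemma root_spaceP r u (t : L) (t0 : lt_gr 0 0 t) : root_space form r u -> u != 0 ->
  r (cartanL t0) != 0 ->
  exists a l x, [/\ nonzero_root a, lt_gr a l x, u = inL x & r = wt a l].
Proof.
case: u => [[x phi] d] hu u0 rt.
have e := hu (cartanL t0); rewrite cartanL_ebr in e.
have e2 : 0 = r (cartanL t0) *: phi := congr1 (fun v : E => v.1.2) e.
have e3 : 0 = r (cartanL t0) *: d := congr1 (fun v : E => v.2) e.
have phi0 : phi = 0.
  by apply/eqP; move/esym/eqP: e2; rewrite scaler_eq0 (negbTE rt).
have d0 : d = 0.
  by apply/eqP; move/esym/eqP: e3; rewrite scaler_eq0 (negbTE rt).
subst phi d; have x0 : x != 0 by rewrite -inL_eq0.
have dS : is_direct_sum (@torus_gr _ _ _ L) := lt_direct L.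
have comp p : component (@torus_gr _ _ _ L) x p != 0 -> r = wt p.1 p.2.
  move=> xp; apply/funext => h.
  pose T z := [(submod_val h).1.1, z] + submod_val (submod_val h).2 z.
  have lT : linear T.
    by move=> c y z; rewrite /T br_linr der_linear scalerDr addrACA.
  have hT q z : torus_gr q z -> T z = wt q.1 q.2 h *: z.
    by move=> lz; have := wt_inL lz h; rewrite cartan_ebr => /(congr1 (fun v : E => v.1.1)).
  have Tx : T x = r h *: x by have := hu h; rewrite cartan_ebr => /(congr1 (fun v : E => v.1.1)).
  have := component_diag dS (k := fun q => wt q.1 q.2 h) lT hT x p.
  rewrite Tx; have := component_lin dS (r h) x 0; rewrite addr0 => ->.
  rewrite component0 // addr0 => /eqP; rewrite -subr_eq0 -scalerBl scaler_eq0.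
  by rewrite (negbTE xp) orbF subr_eq0 => /eqP.
have [[a l] xal] := component_neq0 dS x0.
have lx : lt_gr a l x.
  apply: (component_supp1 dS (j := (a, l))) => -[b m]; apply: contraNeq => xbm.
  have [/= -> ->] := wt_inj (component_in dS x (b, m)) xbm
    (component_in dS x (a, l)) xal (etrans (esym (comp _ xbm)) (comp _ xal)).
  by [].
have re := comp _ xal.
exists a, l, x; split => //; split.
  by apply: contraNT x0 => Da; rewrite (gr_out Da lx) eqxx.
apply: contraNneq rt => a0; rewrite re /= a0; apply/eqP/(@wt0_cartanL _ _ _ x) => //.
by rewrite -a0.
Qed.

Lemma eform_sym u v : eform form u v = eform form v u.
Proof.
by case: u v => [[x phi] d] [[y psi] e] /=; rewrite (gf_sym form) -!addrA; congr (_ + _); rewrite addrC.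
Qed.

Lemma dual_ev0 l : exists phi, dual_gr 0 phi /\
  forall d theta, der_gr 0 d -> submod_val d = degree_derivation theta ->
    submod_val phi d = theta l.
Proof.
have [||phi [_ h1 h2]] :=
    @dual_ev _ _ _ _ _ D form setT 0 red (cb_subgroup cb).1 _ _ l => //.
exists phi; split => // d theta dm dE; apply: h2 => //.
by rewrite dE; apply/funext => x /=; rewrite chi0.
Qed.

(** (D^0)^* acts by zero, so r vanishes on it as well. Pairing t_r with (D^0)^* then shows that t_r
    has no component in D^0, and r vanishes on what remains. *)
Lemma isotropicP r : is_root form r ->
  (forall t (t0 : lt_gr (l0 := L) 0 0 t), r (cartanL t0) = 0) -> root_form form r r = 0.
Proof.
move=> [lr [u hu u0]] rt; rewrite /root_form /t_vec.
(* Without a representing element [t_vec] is the default 0, for which the claim is immediate. *)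
case: xgetP => [T _ hT|_]; last by rewrite /= gform0l !add0r.
rewrite hT; have [t0 psi0 p0] := cartan_in T.
have r0 : r 0 = 0 := lin0 lr.
have cphi psi : dual_gr 0 psi -> cartan_set ((0, psi, 0) : E).
  move=> h0; split => //=; first by case: (gr_subspace L 0 0).
  split; first exact: (submodP D).1.
  exact: (scder_gr_subspace (cb_subgroup cb).1).1.
have rphi psi (h0 : dual_gr 0 psi) :
    r (@submod_elt _ _ (cartan_submod D) _ (cphi psi h0)) = 0.
  set h := submod_elt _; have : ebr form (submod_val h) u = 0.
    case: (u) => [[x phi] d].
    by rewrite cartan_ebr /= (lin0 (br_linl _)) add0r dual_action0l (lin0 (der_br_linl _)).
  by rewrite hu => /eqP; rewrite scaler_eq0 (negbTE u0) orbF => /eqP.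
have p00 : (submod_val T).2 = 0.
  have [theta pE] := der0P p0; apply: der_eqP => l x lx.
  rewrite pE (degree_derivationE _ lx).
  have [psi [hpsi /(_ _ _ p0 pE) <-]] := dual_ev0 l.
  have := hT (@submod_elt _ _ (cartan_submod D) _ (cphi psi hpsi)).
  rewrite rphi; case: (submod_val T) => [[t phi] p] /=.
  by rewrite gform0r dual0 !add0r => ->; rewrite scale0r.
have -> : T = cartanL t0 + @submod_elt _ _ (cartan_submod D) _ (cphi _ psi0).
  apply: val_inj; move: p00; rewrite /=; case: (submod_val T) t0 psi0 => [[t phi] p] /= _ _ ->.
  by congr (_, _, _); rewrite ?addr0 ?add0r.
by rewrite (linD lr) rt rphi addr0.
Qed.

(** The weight is represented by [x, f] / (x, f) plus the functional theta |-> theta(l) on D^0, and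
    its value there is 2 / (x, f). *)
Lemma nonisotropic_wt a l x : nonzero_root a -> lt_gr a l x -> x != 0 ->
  nonisotropic_root form (wt a l).
Proof.
move=> ha lx x0; have rx : is_root form (wt a l).
  by apply: (is_rootP (wt_inL lx)); rewrite inL_eq0.
split=> //; have [f [lf f0 hf]] := sl2_triple ha lx x0.
have fxf := form_neq0 form red ha lx x0 lf f0.
pose t := (form x f)^-1 *: [x, f].
have t0 : lt_gr 0 0 t.
  apply: (subspaceZ _ (gr_subspace _ _ _)).
  by have := lt_graded lx lf; rewrite !subrr.
have [psi [hpsi psiE]] := dual_ev0 l.
have cu : cartan_set ((t, psi, 0) : E).
  split => //; split; first exact: (submodP D).1.
  exact: (scder_gr_subspace (cb_subgroup cb).1).1.
pose T : cartan := @submod_elt _ _ (cartan_submod D) _ cu.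
have hT h : eform form (submod_val T) (submod_val h) = wt a l h.
  have [s0 phi0 p0] := cartan_in h; have [w hw] := cartan_weight s0.
  have [theta pE] := der0P p0.
  symmetry; apply: (wt_eigen lx x0); rewrite cartan_ebr.
  rewrite (hw _ _ _ lx) pE (degree_derivationE _ (lam_gr_homog lx)) -scalerDl.
  rewrite dual_action0r (lin0 (der_br_linr _)) -[RHS](linZ inL_lin); congr (inL (_ *: _)).
  have := psiE _ _ p0 pE; case: (submod_val h) s0 hw => [[s phi] p] /= s0 hw ->.
  rewrite dual0 addr0 /t gformZl (gf_invariant form) br_skew (hw _ _ _ lf).
  by rewrite gformNr gformZr linearN mulNr opprK mulrCA mulVf // mulr1.
rewrite /root_form; set T' := t_vec _ _.
have hT' h : eform form (submod_val T') (submod_val h) = wt a l h.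
  rewrite /T' /t_vec; case: xgetP => [T1 _ hT1|/(_ T)]; first exact: hT1.
  by move=> /(_ hT).
(* The chosen representative T' may differ a priori from T; symmetry of the form gives (T', T') =
   (T, T') = (T', T), which is the weight at T. *)
rewrite hT' -hT eform_sym hT'.
have -> : wt a l T = 2 / form x f.
  apply: (wt_eigen lx x0); rewrite cartan_ebr dual_action0r (lin0 (der_br_linr _)) /=.
  rewrite addr0 /t (linZ (br_linl _)) (hf _ _ _ lx) scalerA rs_coroot2; [|by case: ha..].
  by rewrite -(linZ inL_lin) mulrC.
by apply/eqP; rewrite mulf_neq0 ?invr_eq0 // pnatr_eq0.
Qed.

Lemma nonisotropicP r u : nonisotropic_root form r -> root_space form r u -> u != 0 ->
  exists a l x, [/\ nonzero_root a, lt_gr a l x, x != 0, u = inL x & r = wt a l].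
Proof.
move=> [rr rn] hu u0.
have [[t [t0 rt]]|h] := pselect (exists t (t0 : lt_gr (l0 := L) 0 0 t), r (cartanL t0) <> 0).
  have [a [l [x [ha lx ux rE]]]] := root_spaceP hu u0 (introN eqP rt).
  by exists a, l, x; split => //; rewrite -inL_eq0 -ux.
exfalso; apply: rn; apply: isotropicP => // t t0.
by apply: contrapT => rt; apply: h; exists t, t0.
Qed.

(** A nonzero value on L_0^0 would place the root vector in some L_a^l with a nonzero, whose weight
    is not isotropic. *)
Lemma isotropic_cartanL r t (t0 : lt_gr 0 0 t) : isotropic_root form r -> r (cartanL t0) = 0.
Proof.
move=> [[_ [u hu u0]] r0]; apply: contrapT => /eqP rt.
have [a [l [x [ha lx ux rE]]]] := root_spaceP hu u0 rt.
have x0 : x != 0 by rewrite -inL_eq0 -ux.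
by have [_] := nonisotropic_wt ha lx x0; rewrite -rE.
Qed.

Lemma nonisotropic_cartanL r : nonisotropic_root form r ->
  exists t (t0 : lt_gr (l0 := L) 0 0 t), r (cartanL t0) != 0.
Proof.
move=> [rr rn]; apply: contrapT => h; apply: rn; apply: isotropicP => // t t0.
by apply: contrapT => /eqP rt; apply: h; exists t, t0.
Qed.

Lemma isotropic_wt l u : root_space form (wt 0 l) u -> u != 0 ->
  isotropic_root form (wt 0 l).
Proof.
move=> hu u0; have rr := is_rootP hu u0; split => //.
apply: isotropicP => // t t0.
rewrite /wt; case: cid => p [/= hw pE]; rewrite linear0 add0r.
suff : p.2 =1 (\0 : {additive Lambda -> C}) by move=> ->.
apply: (@degree_derivation_inj _ _ _ L); rewrite -pE; apply/funext; apply: lam_gr_ind.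
- by rewrite (lin0 (degree_derivation_linear _)).
- by move=> x y hx hy; rewrite (linD (degree_derivation_linear _)) -hx -hy /= addr0.
- by move=> k x lx; rewrite (degree_derivationE _ lx) scale0r.
Qed.

End Weights.

(** * The extended involution *)

Section ExtendInvolution.
Context {R : realType} {Lambda : zmodType} {Delta : rootSystem R}.
Context {L : lieTorus Delta Lambda} {cb : centroidBasis L}.
Variables (D : permissible cb) (form : gradedForm L).
Hypothesis red : reduced Delta.
Local Notation C := R[i].
Local Notation Gamma := (cb_Gamma cb).
Local Notation chi := (cb_chi cb).
Local Notation der := (submod_type D).
Local Notation dual := (submod_type (graded_dual_submod D)).
Local Notation cartan := (submod_type (cartan_submod D)).
Local Notation E := (ealg D).
Variables tau g : L -> L.
Hypothesis ct : chevalley_involution tau.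
Hypothesis tK : cancel tau g.
Hypothesis gK : cancel g tau.
Hypothesis nt : normalized cb tau.
Hypothesis sD : symmetric_der D.
Implicit Types (x y z : L) (a b : rs_space Delta) (l m n : Lambda) (d e : der).
Implicit Types (phi psi : dual) (theta eta : {additive Lambda -> C}).
Implicit Types (h : cartan) (u v w : E) (r s : cartan -> C).
Local Notation "[ x , y ]" := (lt_br x y).

(** Condition (1) gives e in D^(-m) with chi^m e = d_theta; applying chi^(-m) identifies e. *)
Lemma symmetric_part m theta : Gamma m ->
  graded_part cb D m (chi m \o degree_derivation theta) ->
  graded_part cb D (- m) (chi (- m) \o degree_derivation theta).
Proof.
move=> Gm hm; have : chi_graded_part D (- m) m (chi (- m) \o (chi m \o degree_derivation theta)).
  by exists (chi m \o degree_derivation theta).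
rewrite sD // => -[e he ee].
suff <- : e = chi (- m) \o degree_derivation theta by [].
apply/funext => x; rewrite -[LHS](chiNK _ Gm).
have := congr1 (fun f => f x) ee; rewrite /= => ->.
by rewrite chiNK.
Qed.

(** The normalisation exchanges chi^m and chi^(-m) with no scalar, and the sign appears because tau
    reverses degrees. *)
Lemma conj_homog m theta : Gamma m ->
  tau \o (chi m \o degree_derivation theta) \o g = - (chi (- m) \o degree_derivation theta).
Proof.
move=> Gm; apply/funext => x; rewrite fctE /=.
have := congr1 (fun f => f (degree_derivation theta (g x))) (nt Gm); rewrite /= => ->.
by rewrite (chevalley_derivation _ _ ct) gK (linN (chi_linear (GammaN Gm))).
Qed.

Lemma conj_part m f : graded_part cb D m f -> graded_part cb D (- m) (tau \o f \o g).
Proof.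
move=> hf; have [_ [Gm [theta tm fE]]] := hf; rewrite fE in hf *.
rewrite conj_homog //; have [h1 h2] := symmetric_part Gm hf.
split; first exact: (subspaceN (submodP D)).
exact: (subspaceN (scder_gr_subspace (GammaN Gm))).
Qed.

Lemma conj_der (f : L -> L) : submod_set D f -> submod_set D (tau \o f \o g).
Proof.
rewrite {1}pm_graded => hf; have lt := chevalley_linear ct.
suff : lspan (\bigcup_(m in [set: Lambda]) graded_part cb D m)
    `<=` [set f : L -> L | submod_set D (tau \o f \o g)] by move=> /(_ _ hf).
apply: lspan_min; last by move=> e [m _ /conj_part[]].
split=> [/=|c u v /= hu hv].
  have -> : tau \o (0 : L -> L) \o g = 0 by apply/funext => x; rewrite /= (lin0 lt).
  exact: (submodP D).1.
have -> : tau \o (c *: u + v) \o g = c *: (tau \o u \o g) + (tau \o v \o g).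
  by apply/funext => x; rewrite /= !fctE lt.
exact: (submodP D).2.
Qed.

Definition conj_in_der d : der := submod_elt (conj_der (submod_in d)).

Lemma conj_in_derE d x : submod_val (conj_in_der d) x = tau (submod_val d (g x)). Proof. by []. Qed.

Lemma conj_in_der_lin : linear (fun d => conj_in_der d : der).
Proof.
move=> c d e; apply: val_inj; apply/funext => x /=.
by rewrite ?submod_val_lin !fctE /= (chevalley_linear ct).
Qed.

Lemma conj_in_der_gr m d : der_gr m d -> der_gr (- m) (conj_in_der d).
Proof. by move=> /conj_part. Qed.

(** tau itself need not have order two; on D the two signs cancel and chi^m returns to itself. *)
Lemma conj_in_derK d : conj_in_der (conj_in_der d) = d.
Proof.
move: d; apply: der_ind.
  split; first by rewrite /= !(lin0 conj_in_der_lin).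
  by move=> c d e /= hd he; rewrite !conj_in_der_lin hd he.
move=> m d dm /=; have [Gm [theta _ dE]] := der_grP dm.
apply: val_inj; apply/funext => x /=.
have := congr1 (fun f => f (g x)) (conj_homog theta Gm); rewrite -dE /= => ->.
rewrite fctE (linN (chevalley_linear ct)).
have := congr1 (fun f => f x) (conj_homog theta (GammaN Gm)); rewrite /= => ->.
by rewrite fctE opprK opprK dE.
Qed.

Lemma conj_in_der_br d e : conj_in_der (der_br d e) = der_br (conj_in_der d) (conj_in_der e).
Proof.
apply: val_inj; apply/funext => x; rewrite /= /commutator /=.
by rewrite (linB (chevalley_linear ct)) !tK.
Qed.

Lemma conj_in_der_degree0 d : der_gr 0 d -> conj_in_der d = - d.
Proof.
move=> dm; have [Gm [theta _ dE]] := der_grP dm.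
apply: val_inj; apply/funext => x /=.
have := congr1 (fun f => f x) (conj_homog theta Gm); rewrite -dE /= => ->.
by rewrite oppr0 -dE.
Qed.

Lemma conj_dual_functional phi : is_graded_functional (fun d => submod_val phi (conj_in_der d)).
Proof.
have [lphi fphi] : is_graded_functional (submod_val phi) := submod_in phi.
split; first by move=> c d e; rewrite /= conj_in_der_lin lphi.
apply: sub_finite_set (finite_image (fun m => - m) fphi) => m [d dm hd] /=.
exists (- m); last exact: opprK.
by exists (conj_in_der d) => //; exact: conj_in_der_gr.
Qed.

(** The contragredient map would use the inverse of [conj_in_der], which is its own inverse. *)
Definition conj_dual phi : dual :=
  @submod_elt _ _ (graded_dual_submod D) _ (conj_dual_functional phi).

Lemma conj_dualE phi d : submod_val (conj_dual phi) d = submod_val phi (conj_in_der d).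
Proof. by []. Qed.

Lemma conj_dual_lin : linear (fun phi => conj_dual phi : dual).
Proof.
by move=> c phi psi; apply: dual_eqP => m d _; rewrite conj_dualE !val_dual_lin !conj_dualE.
Qed.

Lemma conj_dualK phi : conj_dual (conj_dual phi) = phi.
Proof. by apply: dual_eqP => m d _; rewrite !conj_dualE conj_in_derK. Qed.

Lemma conj_dual_degree0 phi : dual_gr 0 phi -> conj_dual phi = - phi.
Proof.
move=> h0; apply: dual_eqP => m d dm.
have -> : submod_val (- phi) d = - submod_val phi d by [].
have [m0|m0] := eqVneq m 0.
  by subst m; rewrite conj_dualE conj_in_der_degree0 // (linN (dual_lin phi)).
by rewrite conj_dualE (h0 m d) // (h0 (- m)) ?oppr0 ?oppr_eq0 //; exact: conj_in_der_gr.
Qed.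

Definition taub u : E := (tau u.1.1, conj_dual u.1.2, conj_in_der u.2).

Lemma taub_lin : linear (fun u => taub u : E).
Proof.
move=> c [[x phi] d] [[y psi] e]; congr (_, _, _).
- exact: (chevalley_linear ct).
- exact: conj_dual_lin.
- exact: conj_in_der_lin.
Qed.

Lemma taub_br u v : taub (ebr form u v) = ebr form (taub u) (taub v).
Proof.
case: u v => [[x phi] d] [[y psi] e]; have lt := chevalley_linear ct.
congr (_, _, _).
- by rewrite /= (linB lt) (linD lt) (chevalley_br _ _ ct) !tK.
- apply: dual_eqP => m k _.
  transitivity (form (submod_val (conj_in_der k) x) y + submod_val psi (der_br (conj_in_der k) d)
    - submod_val phi (der_br (conj_in_der k) e)); first by [].
  transitivity (form (submod_val k (tau x)) (tau y) + submod_val psi (conj_in_der (der_br k (conj_in_der d)))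
    - submod_val phi (conj_in_der (der_br k (conj_in_der e)))); last by [].
  rewrite !conj_in_der_br !conj_in_derK; congr (_ + _ - _).
  (* For the [sigma] term the claim is the invariance of the form under tau. *)
  by rewrite -[k in RHS]conj_in_derK [in RHS]conj_in_derE tK chevalley_form.
- exact: conj_in_der_br.
Qed.

Definition taub_inv u : E := (g u.1.1, conj_dual u.1.2, conj_in_der u.2).

Lemma taubK : cancel taub taub_inv.
Proof. by move=> [[x phi] d]; rewrite /taub_inv /= tK conj_dualK conj_in_derK. Qed.

Lemma taub_invK : cancel taub_inv taub.
Proof. by move=> [[x phi] d]; rewrite /taub /= gK conj_dualK conj_in_derK. Qed.

Lemma taub_cartan h : taub (submod_val h) = - submod_val h.
Proof.
have [] := cartan_in h; case: (submod_val h) => [[t psi] p] /= t0 psi0 p0.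
congr (_, _, _).
- by case: ct => _ _ _ ->.
- exact: conj_dual_degree0.
- exact: conj_in_der_degree0.
Qed.

Lemma taub_root_space r : taub @` root_space form r = root_space form (- r).
Proof.
apply/seteqP; split=> [_ [u hu <-] h|v hv].
  rewrite -[submod_val h]opprK -taub_cartan (linN (ebr_linl _ _)) -taub_br hu.
  by rewrite (linZ taub_lin) -scaleNr.
exists (taub_inv v); last exact: taub_invK.
move=> h; apply: (can_inj taubK); rewrite taub_br taub_invK taub_cartan.
rewrite (linN (ebr_linl _ _)) hv (linZ taub_lin) taub_invK.
by rewrite !fctE scaleNr opprK.
Qed.

Lemma taub_chevalley : chevalley_involution_ealg form taub.
Proof.
split.
- split; [exact: taub_lin| |exact: taub_br].
  by exists taub_inv; [exact: taubK|exact: taub_invK].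
(* The period n of tau is doubled because the action on D and its dual has period two. *)
- have [_ [n n0 tn] _ _] := ct; exists (n + n)%N; first by rewrite addn_gt0 n0.
  have it k x phi d : iter (k + k) taub (x, phi, d) = (iter (k + k) tau x, phi, d).
    elim: k => [//|k IH]; rewrite addnS !addSn 2!iterS IH.
    by rewrite /taub /= conj_dualK conj_in_derK.
  by move=> [[x phi] d]; rewrite it iterD !tn.
- by move=> r _; exact: taub_root_space.
Qed.

Lemma taub_extends : extends tau taub.
Proof.
by move=> x; congr (_, _, _); rewrite ?(lin0 conj_dual_lin) ?(lin0 conj_in_der_lin).
Qed.

Lemma taub_inD d : taub (inD d) = inD (conj_in_der d).
Proof.
by congr (_, _, _); rewrite ?(lin0 conj_dual_lin) ?(lin0 (chevalley_linear ct)).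
Qed.

Lemma conj_in_der_homog m theta d : Gamma m -> submod_val d = chi m \o degree_derivation theta ->
  submod_val (conj_in_der d) = - (chi (- m) \o degree_derivation theta).
Proof. by move=> Gm dE; rewrite -conj_homog // -dE. Qed.

Lemma taub_opposite : opposite_on_der taub.
Proof.
move=> m theta d Gm dm dE; exists (conj_in_der d); last exact: taub_inD.
exact: conj_in_der_homog.
Qed.

End ExtendInvolution.

(** * Integral structures *)

Section Integral.
Context {R : realType} {Lambda : zmodType} {Delta : rootSystem R}.
Context {L : lieTorus Delta Lambda} {cb : centroidBasis L}.
Variables (D : permissible cb) (form : gradedForm L).
Hypothesis red : reduced Delta.
Hypothesis free : free_of_finite_rank Lambda.
Local Notation C := R[i].
Local Notation Gamma := (cb_Gamma cb).
Local Notation chi := (cb_chi cb).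
Local Notation der := (submod_type D).
Local Notation dual := (submod_type (graded_dual_submod D)).
Local Notation cartan := (submod_type (cartan_submod D)).
Local Notation E := (ealg D).
Local Notation inL := (inL D).
Implicit Types (x y z : L) (a b : rs_space Delta) (l m n : Lambda) (d e : der).
Implicit Types (phi psi : dual) (theta eta : {additive Lambda -> C}).
Implicit Types (h : cartan) (u v w : E) (r s : cartan -> C).
Local Notation "[ x , y ]" := (lt_br x y).

(** Zero is excluded because members of an integral structure are root vectors. No independence is
    required, so all integral derivations can be taken at once. *)
Definition integral_der : set der := [set d | d != 0 /\
  exists m theta, [/\ Gamma m, der_gr m d, integral_hom theta
    & submod_val d = chi m \o degree_derivation theta]].

(** The elements without D-component form a subalgebra containing all nonisotropic root spaces. This
    keeps the added derivations out of the core. *)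
Lemma core_der0 u : core form u -> u.2 = 0.
Proof.
apply: (smallest_sub (X := [set u : E | u.2 = 0])).
  split.
    split=> [//|c [[x phi] d] [[y psi] e] /= -> ->].
    by rewrite scaler0 addr0.
  by move=> [[x phi] d] [[y psi] e] /= -> ->; exact: (lin0 (der_br_linl _)).
move=> v [r rn hv] /=; have [->//|v0] := eqVneq v 0.
by have [a [l [x [_ _ _ -> _]]]] := nonisotropicP red rn hv v0.
Qed.

Lemma nonisotropic_opp r : nonisotropic_root form r -> nonisotropic_root form (- r).
Proof.
move=> rn; have [_ [u hu u0]] := rn.1.
have [a [l [x [ha lx x0 _ ->]]]] := nonisotropicP red rn hu u0.
have [y ly xy] := form_dual form red lx x0.
rewrite -wt_opp; apply: (nonisotropic_wt D form red (nonzero_root_opp ha) ly).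
by apply: contraNneq xy => ->; rewrite gform0r.
Qed.

Variables (taub : E -> E) (Bc : set E).
Hypothesis Bcore : Bc `<=` core (D := D) form.
Hypothesis Broot : Bc `<=` is_root_vector (D := D) form.
Hypothesis Btau : taub @` Bc = opp_set Bc.
Variable chv : (cartan -> C) -> E.
Hypothesis chvP : chevalley_system form taub chv.
Hypothesis Bchv : forall r, nonisotropic_root form r ->
  Bc `&` root_space form r = [set chv r].
Hypothesis Bspan : forall s, isotropic_root form s ->
  zspan (Bc `&` root_space form s) = bracket_span form Bc s.
Hypothesis Bchi : chi_stable Bc.

Lemma Bc_basis a l x : nonzero_root a -> lt_gr a l x -> x != 0 ->
  exists y, [/\ Bc `&` root_space form (wt a l) = [set inL y], Bc (inL y),
    lt_gr a l y, y != 0 & exists c : C, x = c *: y].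
Proof.
move=> ha lx x0; have rn := nonisotropic_wt D form red ha lx x0.
have e := Bchv rn; have [Bv hv] : (Bc `&` root_space form (wt a l)) (chv (wt a l)).
  by rewrite e.
have v0 : chv (wt a l) != 0 by case: (Broot Bv).
have [b [m [y [hb ly y0 ve re]]]] := nonisotropicP red rn hv v0.
have [ab lm] := wt_inj form red lx x0 ly y0 re; subst b m.
exists y; rewrite -ve; split => //.
exact: (gr_line ha ly y0 lx).
Qed.

(** A nonzero bracket is a root vector for the isotropic root s = (0, l + m), where the axiom on
    [Bc] rewrites bracket spans as spans of [Bc]. *)
Lemma bracket_zspan a l m y z : nonzero_root a -> lt_gr a l y -> lt_gr (- a) m z ->
  Bc (inL y) -> Bc (inL z) -> zspan Bc (ebr form (inL y) (inL z)).
Proof.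
move=> ha ly lz By Bz; have [->|n0] := eqVneq (ebr form (inL y) (inL z)) 0.
  exact: (zspan_subgroup Bc).1.
have hs : root_space form (wt (D := D) 0 (l + m)) (ebr form (inL y) (inL z)).
  exact: wt_bracket (subrr a) ly lz.
have si := isotropic_wt red hs n0.
suff : bracket_span form Bc (wt 0 (l + m)) (ebr form (inL y) (inL z)).
  by rewrite -Bspan //; apply: zspanS => v [].
have z0 : z != 0 by rewrite -(inL_eq0 D); case: (Broot Bz).
have [x lx zx] := form_dual form red lz z0; rewrite opprK in lx.
have x0 : x != 0 by apply: contraNneq zx => ->; rewrite gform0r.
have rn := nonisotropic_wt D form red ha lx x0.
(* With r = (a, -m) one has r + s = (a, l) and -r = (-a, m); r is a root because z has a partner x
   under the form. *)
apply: zspan_sub; exists (wt a (- m)).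
  exact: rn.
exists (inL y), (inL z); split => //; split => //.
  rewrite -wt_addL addr0 addrCA addNr addr0; exact: wt_inL.
rewrite -wt_opp opprK; exact: wt_inL.
Qed.

(** [Bc] has a single element in L_a^l, so projecting an integral combination to this piece leaves
    an integer multiple of it. *)
Lemma zspan_component a l x : nonzero_root a -> lt_gr a l x -> x != 0 ->
  zspan Bc (inL x) -> exists y k, [/\ Bc (inL y), lt_gr a l y & x = y *~ k].
Proof.
move=> ha lx x0 Bx; have [y [ey By ly y0 _]] := Bc_basis ha lx x0.
have dS : is_direct_sum (@torus_gr _ _ _ L) := lt_direct L.
suff h v : zspan Bc v -> exists k : int,
    component (@torus_gr _ _ _ L) v.1.1 (a, l) = y *~ k.
  have [k] := h _ Bx; rewrite /= (component_id dS (i := (a, l)) lx) => ->.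
  by exists y, k.
apply: (zspan_min (S := [set v : E | exists k : int,
    component (@torus_gr _ _ _ L) v.1.1 (a, l) = y *~ k])).
  split; first by exists 0; rewrite /= (component0 dS) mulr0z.
  move=> u w [k hk] [k' hk']; exists (k - k').
  by rewrite /= (componentB dS) hk hk' mulrzBr.
move=> w Bw; have [w0 [r rr hw]] := Broot Bw.
have [r0|/eqP r0] := eqVneq (root_form form r r) 0; last first.
  have [b [m [z [hb lz z0 wz re]]]] := nonisotropicP red (conj rr r0) hw w0.
  have [e|ne] := eqVneq (a, l) (b, m); last first.
    by exists 0; rewrite wz mulr0z; exact: (component_neq dS (i := (b, m))).
  case: e => ea el; subst b m; exists 1; rewrite mulr1z.
  have : [set inL y] w by rewrite -ey; split => //; rewrite -re.
  by move=> ->; exact: (component_id dS (i := (a, l)) ly).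
exists 0; rewrite mulr0z.
(* The L-part of an isotropic root vector commutes with t, which acts on L_a^l by 2; so its
   component there is 0. *)
have [t t0 ht] := coroot_elt L red ha.
have := isotropic_cartanL red t0 (conj rr r0).
have := hw (cartanL D t0); case: (w) => [[z phi] d]; rewrite cartanL_ebr => e0 rt0.
have tz : [t, z] = 0 by have := congr1 (fun v : E => v.1.1) e0; rewrite rt0 scale0r.
have := component_diag dS (k := fun q => rs_coroot a q.1) (br_linr t)
  (fun q x' lx' => ht _ _ _ lx') z (a, l).
rewrite tz (component0 dS) rs_coroot2; [|by case: ha..].
by move=> /esym /eqP; rewrite scaler_eq0 pnatr_eq0 /= => /eqP.
Qed.

(** * The action of one integral derivation on the span of [Bc] *)

Section Derivation.
Variables (m : Lambda) (theta : {additive Lambda -> C}) (d : der).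
Hypothesis Gm : Gamma m.
Hypothesis dE : submod_val d = chi m \o degree_derivation theta.
Hypothesis itheta : integral_hom theta.

Lemma der_chi_zspan a l y : nonzero_root a -> lt_gr a l y -> Bc (inL y) ->
  zspan Bc (inL (submod_val d y)).
Proof.
move=> ha ly By; have [k tk] := itheta l.
rewrite (der_homogE Gm dE (lam_gr_homog ly)) tk (linZ (inL_lin D)) scaler_int.
apply: subgroupMz (zspan_subgroup _) _; exact: Bchi Gm ha ly By.
Qed.

(** Condition (3) gives only membership in the span, whereas [bracket_zspan] needs elements of [Bc]
    itself. *)
Lemma der_component a l y : nonzero_root a -> lt_gr a l y -> Bc (inL y) ->
  submod_val d y = 0 \/ exists y' k,
    [/\ Bc (inL y'), lt_gr a (l + m) y' & submod_val d y = y' *~ k].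
Proof.
move=> ha ly By; have [->|dy0] := eqVneq (submod_val d y) 0; [by left|right].
apply: (zspan_component ha _ dy0 (der_chi_zspan ha ly By)).
rewrite (der_homogE Gm dE (lam_gr_homog ly)).
by apply: (subspaceZ _ (gr_subspace _ _ _)); exact: chi_gr.
Qed.

Lemma der_bracket_zspan a l k y z : nonzero_root a -> lt_gr a l y -> lt_gr (- a) k z ->
  Bc (inL y) -> Bc (inL z) ->
  zspan Bc (ebr form (inD d) (ebr form (inL y) (inL z))).
Proof.
move=> ha ly lz By Bz; have hS := zspan_subgroup Bc; rewrite ebr_inD_leibniz.
apply: (subgroupD hS).
  have [->|[y' [j [By' ly' ->]]]] := der_component ha ly By.
    by rewrite (lin0 (inL_lin D)) (lin0 (ebr_linl _ _)); case: hS.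
  rewrite (linMz (inL_lin D)) (linMz (ebr_linl form (inL z))).
  by apply: (subgroupMz _ hS); exact: bracket_zspan ly' lz By' Bz.
have [->|[z' [j [Bz' lz' ->]]]] := der_component (nonzero_root_opp ha) lz Bz.
  by rewrite (lin0 (inL_lin D)) (lin0 (ebr_linr _ _)); case: hS.
rewrite (linMz (inL_lin D)) (linMz (ebr_linr form (inL y))).
by apply: (subgroupMz _ hS); exact: bracket_zspan ly lz' By Bz'.
Qed.

Lemma der_zspan u : Bc u -> zspan Bc (ebr form (inD d) u).
Proof.
move=> Bu; have hS := zspan_subgroup Bc; have [u0 [s sr hu]] := Broot Bu.
have [s0|/eqP s0] := eqVneq (root_form form s s) 0; last first.
  have [a [l [y [ha ly y0 ue _]]]] := nonisotropicP red (conj sr s0) hu u0.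
  rewrite ue in Bu *; rewrite ebr_inD_inL; exact: der_chi_zspan ha ly Bu.
have si : isotropic_root form s by [].
suff h v : bracket_span form Bc s v -> zspan Bc (ebr form (inD d) v).
  by apply: h; rewrite -Bspan //; apply: zspan_sub.
apply: (zspan_min (S := [set v | zspan Bc (ebr form (inD d) v)])).
  have br0 : zspan Bc (ebr form (inD d) 0) by rewrite (lin0 (ebr_linr _ _)); case: hS.
  split=> // w w' hw hw'.
  suff : zspan Bc (ebr form (inD d) (w - w')) by [].
  by rewrite (linB (ebr_linr form (inD d))); exact: hS.2.
move=> {hu u0 Bu}_ [r rn] [y' [z' [[By hy] [Bz hz] ->]]].
have [y0 _] := Broot By; have [z0 _] := Broot Bz.
(* s vanishes on L_0^0, so an element of L_0^0 detecting r also detects r + s and -r, and puts y'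
   and z' in L. *)
have [t [t0 rt]] := nonisotropic_cartanL red rn.
have syt q (q0 : lt_gr (l0 := L) 0 0 q) : (r + s) (cartanL D q0) = r (cartanL D q0).
  by rewrite fctE (isotropic_cartanL red q0 si) addr0.
have [|a [l [y [ha ly ye yr]]]] := root_spaceP red (t0 := t0) hy y0; first by rewrite syt.
have [|b [k [z [hb lz ze zr]]]] := root_spaceP red (t0 := t0) hz z0.
  by rewrite fctE oppr_eq0.
subst y' z'; have {}y0 : y != 0 by rewrite -(inL_eq0 D).
have {}z0 : z != 0 by rewrite -(inL_eq0 D).
have [x lx yx] := form_dual form red ly y0.
have x0 : x != 0 by apply: contraNneq yx => ->; rewrite gform0r.
(* r + s and -r are opposite on L_0^0, which determines the roots though not the degrees. *)
have ab : - a = b.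
  apply: (wt_inj_root (D := D) form red lx x0 lz z0) => q q0.
  have e1 : r (cartanL D q0) = wt a l (cartanL D q0) by rewrite -yr syt.
  have e2 : - r (cartanL D q0) = wt b k (cartanL D q0) by rewrite -zr.
  have e3 : wt (- a) (- l) (cartanL D q0) = - wt a l (cartanL D q0) by rewrite wt_opp.
  by rewrite -e2 e3 e1.
subst b; exact: der_bracket_zspan ly lz By Bz.
Qed.

End Derivation.

(** * The complex span of [Bc] *)

Lemma lspan_bracket a l m x y : nonzero_root a -> lt_gr a l x -> lt_gr (- a) m y ->
  lspan Bc (ebr form (inL x) (inL y)).
Proof.
move=> ha lx ly; have hS := lspan_subspace Bc.
have [->|x0] := eqVneq x 0.
  by rewrite (lin0 (inL_lin D)) (lin0 (ebr_linl _ _)); case: hS.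
have [->|y0] := eqVneq y 0.
  by rewrite (lin0 (inL_lin D)) (lin0 (ebr_linr _ _)); case: hS.
have [x' [_ Bx lx' _ [c ->]]] := Bc_basis ha lx x0.
have [y' [_ By ly' _ [c' ->]]] := Bc_basis (nonzero_root_opp ha) ly y0.
rewrite !(linZ (inL_lin D)) (linZ (ebr_linl form _)) (linZ (ebr_linr form _)).
do 2 apply: (subspaceZ _ hS).
by apply: zspan_lspan; exact: bracket_zspan lx' ly' Bx By.
Qed.

Lemma lspan_dual phi : lspan Bc (0, phi, 0).
Proof.
have hS := lspan_subspace Bc; move: phi.
apply: (@dual_span _ _ _ _ _ D form [set phi | lspan Bc ((0, phi, 0) : E)] red free).
  split; first exact: hS.1.
  move=> c phi psi hphi hpsi.
  suff : lspan Bc ((0, c *: phi + psi, 0) : E) by [].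
  have -> : (0, c *: phi + psi, 0) = c *: (0, phi, 0) + (0, psi, 0) :> E.
    by congr (_, _, _); rewrite /= scaler0 addr0.
  exact: hS.2.
move=> m a l k x y x' y' Gm ha lx ly lx' ly' e.
suff : lspan Bc ((0, sigma form D x y - sigma form D x' y', 0) : E) by [].
have -> : (0, sigma form D x y - sigma form D x' y', 0) =
    ebr form (inL x) (inL y) - ebr form (inL x') (inL y') :> E.
  by rewrite !ebr_inL; congr (_, _, _); rewrite /= ?e subrr.
apply: (subspaceB hS); [exact: lspan_bracket lx ly|exact: lspan_bracket lx' ly'].
Qed.

Lemma lspan_inL x : lspan Bc (inL x).
Proof.
have hS := lspan_subspace Bc; move: x; apply: torus_gen.
- split; first by rewrite /= (lin0 (inL_lin D)); case: hS.
  by move=> c x y hx hy; rewrite /= (inL_lin D); exact: hS.2.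
- move=> a l x ha lx /=; have [->|x0] := eqVneq x 0.
    by rewrite (lin0 (inL_lin D)); case: hS.
  have [y [_ By _ _ [c ->]]] := Bc_basis ha lx x0.
  by rewrite (linZ (inL_lin D)); apply: (subspaceZ _ hS); exact: lspan_sub.
move=> a l m x y ha lx ly /=.
(* The bracket of E exceeds that of L by the term [sigma x y], already known to lie in the span. *)
have -> : inL [x, y] = ebr form (inL x) (inL y) - (0, sigma form D x y, 0).
  by rewrite ebr_inL; congr (_, _, _); rewrite /= ?subr0 ?subrr.
apply: (subspaceB hS); [exact: lspan_bracket lx ly|exact: lspan_dual].
Qed.

(** * Completion of [Bc] by integral derivations *)

Definition extended_basis : set E := Bc `|` [set inD d | d in integral_der].
Local Notation B := extended_basis.

(** Condition (2) concerns chi^(-m) D^m; the spanning statement is carried back to D^m by composing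
    with chi^m. *)
Lemma lspan_inD : integrally_spanned_der D -> forall d, lspan B (inD d).
Proof.
move=> iD; have hS := lspan_subspace B; apply: der_ind.
  split; first by rewrite /= (lin0 (@inD_lin _ _ _ _ _ D)); case: hS.
  by move=> c d e hd he; rewrite /= (@inD_lin _ _ _ _ _ D); exact: hS.2.
move=> m d dm /=; have [Gm _] := der_grP dm.
have : chi_graded_part D (- m) m (chi (- m) \o submod_val d) by exists (submod_val d).
rewrite iD //; set X := _ `&` _ => hX.
suff : lspan X `<=` [set f : L -> L | exists e : der, submod_val e = chi m \o f /\ lspan B (inD e)].
  move=> /(_ _ hX)[e [eE he]]; suff <- : e = d by [].
  by apply: val_inj; apply/funext => x /=; rewrite eE /= chiKN.
apply: lspan_min.
  split.
    exists 0; split; first by apply/funext => x /=; rewrite (lin0 (chi_linear Gm)).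
    by rewrite (lin0 (@inD_lin _ _ _ _ _ D)); case: hS.
  move=> c u v [e [eE he]] [e' [eE' he']]; exists (c *: e + e'); split.
    apply/funext => x; rewrite /= ?submod_val_lin !fctE eE eE' /=.
    by rewrite (chi_linear Gm).
  by rewrite (@inD_lin _ _ _ _ _ D); exact: hS.2.
move=> f [[e' [De em] e'E] [theta it tE]].
have e'f : e' = chi m \o f.
  by apply/funext => x; rewrite /= -e'E /= chiKN.
exists (submod_elt De); split => //.
have [e0|e0] := eqVneq (submod_elt De) 0; first by rewrite e0 (lin0 (@inD_lin _ _ _ _ _ D)); case: hS.
apply: lspan_sub; right; exists (submod_elt De) => //; split => //.
by exists m, theta; split => //=; rewrite e'f tE.
Qed.

Lemma extended_basis_root_space r : nonisotropic_root form r ->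
  B `&` root_space form r = Bc `&` root_space form r.
Proof.
move=> rn; apply/seteqP; split=> [u [[Bu|[d [d0 _] <-]] hu]|u [Bu hu]]; [by []| |].
  have hd : inD d != 0 :> E by rewrite inD_eq0.
  have [a [l [x [_ _ _ e _]]]] := nonisotropicP red rn hu hd.
  by have := congr1 (fun v : E => v.2) e => /= d00; rewrite d00 eqxx in d0.
by split => //; left.
Qed.

Lemma extended_basis_core : B `&` core (D := D) form = Bc.
Proof.
apply/seteqP; split=> [u [[//|[d [d0 _] <-]] /core_der0 /= d00]|u Bu].
  by rewrite d00 eqxx in d0.
by split; [left|exact: Bcore].
Qed.

(** The partner is chi^(-m) d_theta with the same integral theta. The two equations give the two
    inclusions in tau(B) = -B. *)
Lemma opposite_integral (oD : opposite_on_der taub) d : integral_der d ->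
  exists2 e, integral_der e & taub (inD d) = - inD e /\ taub (inD e) = - inD d.
Proof.
move=> [d0 [m [theta [Gm dm it dE]]]].
(* [integral_der] does not record theta(m) = 0; it is recovered from the uniqueness of theta. *)
have [_ [theta' tm' dE']] := der_grP dm.
have tm : theta m = 0 by rewrite (chi_derivation_inj Gm (etrans (esym dE) dE')).
have [d' d'E td] := oD m theta d Gm dm dE.
have GNm := GammaN Gm.
have eE : submod_val (- d') = chi (- m) \o degree_derivation theta.
  by apply: (etrans (y := - submod_val d')) => //; rewrite d'E opprK.
have em : der_gr (- m) (- d').
  split; first exact: submod_in.
  by split => //; exists theta => //; rewrite raddfN /= tm oppr0.
have [d'' d''E te] := oD (- m) theta (- d') GNm em eE.
have d''d : d'' = - d.
  by apply: val_inj; rewrite /= d''E opprK -dE.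
have inDN e : inD (- e) = - inD e :> E := linN (@inD_lin _ _ _ _ _ D) e.
exists (- d'); last by rewrite td te d''d !inDN opprK.
split; last by exists (- m), theta.
apply: contra_neq d0 => e0; apply: val_inj; apply/funext => x; rewrite /= dE /=.
have := congr1 (fun f => f x) eE; rewrite e0 /= => /esym /eqP.
by rewrite chi_eq0 // => /eqP ->; rewrite (lin0 (chi_linear Gm)).
Qed.

Lemma extended_basis_opp : opposite_on_der taub -> taub @` B = opp_set B.
Proof.
move=> oD; apply/seteqP; split=> [_ [u [Bu|[d hd <-]] <-]|_ [u [Bu|[d hd <-]] <-]].
- have : opp_set Bc (taub u) by rewrite -Btau; exists u.
  by move=> [v Bv <-]; exists v => //; left.
- have [e he [te _]] := opposite_integral oD hd.
  by exists (inD e) => //; right; exists e.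
- have : (taub @` Bc) (- u) by rewrite Btau; exists u.
  by move=> [v Bv <-]; exists v => //; left.
- have [e he [_ te]] := opposite_integral oD hd.
  by exists (inD e) => //; right; exists e.
Qed.

Lemma integral_der_br d e : integral_der d -> integral_der e ->
  zspan B (inD (der_br d e)).
Proof.
move=> [d0 [m [theta [Gm dm it dE]]]] [e0 [n [eta [Gn en ie eE]]]].
have [->|b0] := eqVneq (der_br d e) 0.
  by rewrite (lin0 (@inD_lin _ _ _ _ _ D)); case: (zspan_subgroup B).
(* The additive map of the bracket [chi^m d_theta, chi^n d_eta]; its values are integers because
   those of theta and eta are. *)
pose xi l : C := theta n * eta l - eta m * theta l.
have xiB : zmod_morphism xi by move=> u v; rewrite /xi !raddfB /=; ring.
pose xi' : {additive Lambda -> C} := HB.pack xi (GRing.isZmodMorphism.Build _ _ xi xiB).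
apply: zspan_sub; right; exists (der_br d e) => //; split => //.
exists (m + n), xi'; split.
- exact: cb_GammaD.
- exact: der_br_gr.
- move=> l; have [[i1 h1] [i2 h2]] := (it n, it l).
  have [[i3 h3] [i4 h4]] := (ie m, ie l).
  by exists (i1 * i4 - i3 * i2); rewrite /= /xi h1 h2 h3 h4 intrB !intrM.
have Gmn := cb_GammaD Gm Gn; have dl := degree_derivation_linear (L := L) xi'.
apply/funext; apply: lam_gr_ind => [|x y hx hy|l x lx].
- by rewrite (lin0 (der_linear _)) /= (lin0 dl) (lin0 (chi_linear Gmn)).
- rewrite (linD (der_linear _)) /= (linD dl) (linD (chi_linear Gmn)).
  by congr (_ + _); [exact: hx|exact: hy].
- by rewrite (der_brE dm en dE eE lx) /= (degree_derivationE _ lx) (linZ (chi_linear Gmn)).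
Qed.

Lemma extended_basis_integral : integrally_spanned_der D -> opposite_on_der taub ->
  integral_structure form taub B.
Proof.
move=> iD oD; split; split.
- apply/seteqP; split=> // -[[x phi] d] _; have hS := lspan_subspace B.
  have -> : (x, phi, d) = inL x + (0, phi, 0) + inD d :> E.
    by congr (_, _, _); rewrite /= ?addr0 ?add0r.
  have BcB : lspan Bc `<=` lspan B by apply: lspanS; left.
  apply: (subspaceD hS); last exact: lspan_inD.
  by apply: (subspaceD hS); apply: BcB; [exact: lspan_inL|exact: lspan_dual].
- move=> u [/Broot//|[d [d0 [m [theta [_ dm _ _]]]] <-]].
  have d0' : inD d != 0 :> E by rewrite inD_eq0.
  by split => //; exists (wt 0 m); [exact: is_rootP (wt_inD form dm) d0'|exact: wt_inD].
- exact: extended_basis_opp.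
- move=> r rn; have rn' := nonisotropic_opp rn.
  rewrite (extended_basis_root_space rn) (extended_basis_root_space rn') !Bchv //.
  have [_ <- _] := chvP rn; apply/seteqP; split=> [_ [u [v [-> -> ->]]] //|_ ->].
  by exists (chv r), (chv (- r)).
- move=> s si; rewrite extended_basis_core Bspan //; congr (zspan _).
  apply/seteqP; split=> w [r rn] [u [v [[Bu hu] [Bv hv] ->]]]; exists r => //; exists u, v.
    by split => //; split => //; left.
  split => //; last by rewrite -(extended_basis_root_space (nonisotropic_opp rn)).
  (* A derivation in B is nonzero; and for u nonzero, r + s is nonzero on L_0^0, hence nonisotropic,
     so B adds nothing to [Bc] in its root space. *)
  split => //; have [u0|u0] := eqVneq u 0.
    case: Bu => // -[d [d0 _] du].
    by move: d0; rewrite -(@inD_eq0 _ _ _ _ _ D) du u0 eqxx.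
  have [t [t0 rt]] := nonisotropic_cartanL red rn.
  have [|a [l [x [ha lx ux rE]]]] := root_spaceP red (t0 := t0) hu u0.
    by rewrite fctE (isotropic_cartanL red t0 si) addr0.
  have x0 : x != 0 by rewrite -(inL_eq0 D) -ux.
  have rsn := nonisotropic_wt D form red ha lx x0.
  have : (B `&` root_space form (r + s)) u by [].
  by rewrite rE extended_basis_root_space // => -[].
(* Outside the core u is an added derivation, and v is either in [Bc] or another such derivation. *)
- move=> _ [u [v [[[Bu|[d hd du]] nu] Bv ->]]].
    by exfalso; apply: nu; exact: Bcore.
  rewrite -du {nu}.
  case: Bv => [Bv|[e he <-]]; last by rewrite ebr_inD; exact: integral_der_br.
  have [_ [m [theta [Gm _ it dE]]]] := hd.
  have BcB : zspan Bc `<=` zspan B by apply: zspanS; left.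
  by apply: BcB; exact: der_zspan Gm dE it _ Bv.
Qed.

End Integral.

Theorem theorem4p2p1 (R : realType) (Lambda : zmodType)
    (Lambda_free : free_of_finite_rank Lambda)
    (Delta : rootSystem R)
    (Delta_irreducible : irreducible Delta) (Delta_reduced : reduced Delta)
    (L : lieTorus Delta Lambda) (L_centerless : centerless L)
    (form : gradedForm L) (cb0 : centroidBasis L)
    (tau : L -> L) (tau_chevalley : chevalley_involution tau) :
  (exists cb : centroidBasis L, normalized cb tau) /\
  (forall (cb : centroidBasis L) (D : permissible cb),
    normalized cb tau ->
    symmetric_der D ->
    exists taub : ealg D -> ealg D,
      [/\ chevalley_involution_ealg form taub,
          extends tau taub,
          opposite_on_der taub
        & integrally_spanned_der D ->
          forall Bc : set (ealg D),
            integral_structure_core form taub Bc ->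
            chi_stable Bc ->
            exists2 B : set (ealg D),
              integral_structure form taub B & Bc `<=` B]).
Proof.
split; first exact: normalized_exists cb0 _ Lambda_free tau_chevalley.
move=> cb D nt sD; have [g [tK gK _]] := chevalley_inverse tau_chevalley.
have oD := taub_opposite tau_chevalley gK nt sD.
exists (taub tau_chevalley gK nt sD); split => //.
- exact: taub_chevalley.
- exact: taub_extends.
move=> iD Bc [Bcore Broot Btau [x xP Bx] Bs] Bchi.
exists (extended_basis Bc); last by left.
exact: (extended_basis_integral Delta_reduced Lambda_free Bcore Broot Btau xP Bx Bs Bchi).
Qed.
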